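(* Let $\omega$ be a joint operator radius and let $J$ be the WOT-closed two-sided ideal of $F_n^\infty$ generated by some homogeneous polynomials $q_1,\ldots,q_d\in\mathcal P$ (i.e. by $q_j(S_1,\ldots,S_n)$). Let $T:=[T_1,\ldots,T_n]$, $T_i\in B(\mathcal H)$, be a row contraction such that $q_j(T_1,\ldots,T_n)=0$, $j=1,\ldots,d$. Then there is a unital completely contractive linear map $\Phi_T^J:\overline{\mathcal B}\to B(\mathcal H)$ such that $\Phi_T^J(B_\alpha B_\beta^* )=T_\alpha T_\beta^*$, $\alpha,\beta\in\mathbb F_n^+$. Moreover, $$\Phi_T^J(X)=\lim_{r\to1}K_{T,r}^*(X\otimes I_{\mathcal H})K_{T,r},\quad X\in\overline{\mathcal B},$$ where the convergence is in the operator norm topology and $\{K_{T,r}\}_{0<r<1}$ is the Poisson kernel associated with $T$. Furthermore: (i) if $\omega$ is norm quasi-continuous and admissible, then $$\omega\left([\Phi^J_{T,p}(F_1)]^*,\ldots,[\Phi^J_{T,p}(F_k)]^*\right)\le\omega(F_1^*,\ldots,F_k^* )$$ for any $F_1,\ldots,F_k\in M_p\otimes\mathcal A_n^J$ and $k,p\in\mathbb N$; (ii) if $\omega$ is norm quasi-continuous and strongly admissible, then $$\omega\left(\Phi^J_{T,p}(X_1),\ldots,\Phi^J_{T,p}(X_k)\right)\le\omega(X_1,\ldots,X_k)$$ for any $X_1,\ldots,X_k\in M_p\otimes\overline{\mathcal B}$ and $k,p\in\mathbb N$.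
   Context: All Hilbert spaces are complex, separable and nonzero; $n\in\mathbb N=\{1,2,\ldots\}$. $F^2(H_n)=\bigoplus_{k\ge0}H_n^{\otimes k}$ is the full Fock space of an $n$-dimensional Hilbert space with orthonormal basis $e_1,\ldots,e_n$; $S_i\psi=e_i\otimes\psi$; $F_n^\infty$ is the WOT-closed algebra generated by $S_1,\ldots,S_n,I$. $\mathbb F_n^+$ is the unital free semigroup on $g_1,\ldots,g_n$ with identity $g_0$; for $\alpha=g_{i_1}\cdots g_{i_k}$, $|\alpha|=k$, $e_\alpha=e_{i_1}\otimes\cdots\otimes e_{i_k}$, $T_\alpha=T_{i_1}\cdots T_{i_k}$; $e_{g_0}=1$, $T_{g_0}=I$. $\mathcal P$ is the set of polynomials $p=\sum_{|\alpha|\le m}a_\alpha e_\alpha$, $p(T_1,\ldots,T_n)=\sum a_\alpha T_\alpha$; $p$ is homogeneous if all $\alpha$ with $a_\alpha\ne0$ have the same length. $\mathcal M_J:=\overline{JF^2(H_n)}$, $\mathcal N_J:=F^2(H_n)\ominus\mathcal M_J$, $B_i:=P_{\mathcal N_J}S_i|_{\mathcal N_J}$. $\mathcal A_n^J$ is the norm closed algebra generated by $B_1,\ldots,B_n,I_{\mathcal N_J}$; $\mathcal B:=\mathrm{span}\{B_\alpha B_\beta^*:\alpha,\beta\in\mathbb F_n^+\}$ and $\overline{\mathcal B}$ is its norm closure. $M_p$: $p\times p$ complex matrices; $\Phi^J_{T,p}:=I_{M_p}\otimes\Phi^J_T$. Row contraction: $\sum T_iT_i^*\le I$. Poisson kernel: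 $K_{T,r}h=\sum_{k\ge0}\sum_{|\alpha|=k}e_\alpha\otimes r^{|\alpha|}\Delta_rT_\alpha^*h$, $\Delta_r=(I-r^2\sum T_iT_i^* )^{1/2}$, $0<r<1$; it is an isometry $\mathcal H\to F^2(H_n)\otimes\mathcal H$ which in the present situation has range in $\mathcal N_J\otimes\mathcal H$ and is regarded as an operator into $\mathcal N_J\otimes\mathcal H$. A joint operator radius $\omega$ is a family of maps $\omega:B(\mathcal H)^{(d)}\to[0,\infty)$ ($\mathcal H$ any separable Hilbert space, $d=1,2,\ldots$) with $\omega(T_1,\ldots,T_d)=\omega(T_{\sigma(1)},\ldots,T_{\sigma(d)})$ for every permutation $\sigma$ and $\omega(T_1,\ldots,T_d,0)=\omega(T_1,\ldots,T_d)$. It is admissible if always: (a) $\omega(U^*T_1U,\ldots,U^*T_dU)=\omega(T_1,\ldots,T_d)$ for unitary $U:\mathcal K\to\mathcal H$; (b) $\omega(I_{\mathcal G}\otimes T_1,\ldots,I_{\mathcal G}\otimes T_d)=\omega(T_1,\ldots,T_d)$ for any separable $\mathcal G$; (c) $\omega(T_1|_{\mathcal M},\ldots,T_d|_{\mathcal M})\le\omega(T_1,\ldots,T_d)$ for any subspace $\mathcal M$ invariant under each $T_i$. It is strongly admissible if it satisfies (a), (b) and (c$'$) $\omega(P_{\mathcal M}T_1|_{\mathcal M},\ldots,P_{\mathcal M}T_d|_{\mathcal M})\le\omega(T_1,\ldots,T_d)$ for any closed subspace $\mathcal M\subseteq\mathcal H$. It is norm quasi-continuous if for each $b\ge0$ the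 set $\{(T_1,\ldots,T_d):\omega(T_1,\ldots,T_d)\le b\}$ is closed in $B(\mathcal K)^{(d)}$ in the (product) norm topology, for all $\mathcal K,d$. *)

(* Defs.v *)
From HB Require Import structures.
From mathcomp Require Import all_boot all_order all_algebra all_fingroup finmap.
From mathcomp Require Import boolp classical_sets functions cardinality reals.
From mathcomp Require Import topology normedtype sequences.
From mathcomp Require Import complex ring.
Set Implicit Arguments.
Unset Strict Implicit.
Unset Printing Implicit Defensive.
Import Order.TTheory GRing.Theory Num.Theory numFieldNormedType.Exports.
Local Open Scope classical_set_scope.
Local Open Scope ring_scope.

(* A Hilbert space over R[i] is a complete normed module whose norm comes from
   an inner product, linear in its first argument. *)
HB.mixin Record CompleteNormedModule_isHilbert (R : realType) H
    & CompleteNormedModule R[i] H := {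
  hdot : H -> H -> R[i];
  hdot_scalar : forall z : H, scalar (hdot ^~ z);
  hdotC : forall x y : H, hdot x y = (hdot y x)^*;
  hdot_norm : forall x : H, hdot x x = `|x| ^+ 2
}.

#[short(type="hilbertType")]
HB.structure Definition Hilbert (R : realType) :=
  {H of CompleteNormedModule R[i] H & CompleteNormedModule_isHilbert R H}.

Arguments hdot {R s} : rename, simpl never.
Notation "''[' x , y ]" := (hdot x y)
  (format "''[' x ,  y ]") : ring_scope.

Section PreHilbert.
Variables (R : realType) (H : lmodType R[i]) (dot : H -> H -> R[i]).
Hypothesis dot_scalar : forall z : H, scalar (dot ^~ z).
Hypothesis dotC : forall x y : H, dot x y = (dot y x)^*.
Hypothesis dot_gt0 : forall x : H, x != 0 -> 0 < dot x x.

Lemma predotDl x y z : dot (x + y) z = dot x z + dot y z.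
Proof. by have := dot_scalar z 1 x y; rewrite scale1r mul1r. Qed.

Lemma predot0l z : dot 0 z = 0.
Proof. by apply: (addrI (dot 0 z)); rewrite -predotDl !addr0. Qed.

Lemma predotZl a x z : dot (a *: x) z = a * dot x z.
Proof. by have := dot_scalar z a x 0; rewrite addr0 predot0l addr0. Qed.

Lemma predotNl x z : dot (- x) z = - dot x z.
Proof. by rewrite -scaleN1r predotZl mulN1r. Qed.

Lemma predotBl x y z : dot (x - y) z = dot x z - dot y z.
Proof. by rewrite predotDl predotNl. Qed.

Lemma predotDr x y z : dot z (x + y) = dot z x + dot z y.
Proof. by rewrite dotC predotDl rmorphD /= -!dotC. Qed.

Lemma predotZr a x z : dot z (a *: x) = a^* * dot z x.
Proof. by rewrite dotC predotZl rmorphM /= -dotC. Qed.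

Lemma predotNr x z : dot z (- x) = - dot z x.
Proof. by rewrite dotC predotNl rmorphN /= -dotC. Qed.

Lemma predotBr x y z : dot z (x - y) = dot z x - dot z y.
Proof. by rewrite predotDr predotNr. Qed.

Lemma predot0r z : dot z 0 = 0.
Proof. by rewrite dotC predot0l rmorph0. Qed.

Lemma predot_ge0 x : 0 <= dot x x.
Proof.
by have [->|/dot_gt0/ltW//] := eqVneq x 0; rewrite predot0l.
Qed.

Lemma predot_CS x y : `|dot x y| ^+ 2 <= dot x x * dot y y.
Proof.
have [->|y0] := eqVneq y 0; first by rewrite !predot0r normr0 expr0n mulr0.
have yy := dot_gt0 y0; have yy0 := lt0r_neq0 yy.
have yyC : (dot y y)^* = dot y y by rewrite -dotC.
have := predot_ge0 (x - (dot x y / dot y y) *: y).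
rewrite predotBl !predotBr !predotZr !predotZl rmorphM fmorphV /= yyC.
rewrite normCK [dot y x]dotC.
set a := dot x y; set n := dot y y.
rewrite (_ : _ - _ = (dot x x * n - a * a^*) / n); last by field.
by rewrite pmulr_lge0 ?invr_gt0// subr_ge0.
Qed.

Definition prenorm x := sqrtC (dot x x).

Lemma prenorm_ge0 x : 0 <= prenorm x.
Proof. by rewrite sqrtC_ge0 predot_ge0. Qed.

Lemma prenorm2 x : prenorm x ^+ 2 = dot x x.
Proof. by rewrite sqrtCK. Qed.

Lemma prenormD x y : prenorm (x + y) <= prenorm x + prenorm y.
Proof.
rewrite -(@ler_pXn2r _ 2) ?nnegrE ?addr_ge0 ?prenorm_ge0//.
rewrite sqrrD !prenorm2 predotDl !predotDr [dot y x]dotC.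
rewrite (_ : _ + _ + _ = dot x x + (dot x y + (dot x y)^*) + dot y y); last ring.
rewrite lerD2r lerD2l.
have -> : dot x y + (dot x y)^* = 'Re (dot x y) *+ 2.
  by rewrite -mulr_natr ReE divfK// pnatr_eq0.
rewrite lerMn2r /=; apply: (le_trans (real_ler_norm (Creal_Re _))).
apply: (le_trans (leif_normC_Re_Creal _)).
rewrite -(@ler_pXn2r _ 2) ?nnegrE ?mulr_ge0 ?prenorm_ge0//.
by rewrite exprMn !prenorm2 predot_CS.
Qed.

Lemma prenormZ a x : prenorm (a *: x) = `|a| * prenorm x.
Proof.
rewrite /prenorm predotZl predotZr mulrA -normCK.
by rewrite sqrtCM ?nnegrE ?exprn_ge0 ?predot_ge0// sqrCK.
Qed.

Lemma prenorm_eq0 x : prenorm x = 0 -> x = 0.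
Proof.
move=> /eqP; rewrite sqrtC_eq0; have [//|/dot_gt0] := eqVneq x 0.
by move=> /lt0r_neq0 /negP.
Qed.

End PreHilbert.

Lemma complex_archi (R : realType) (e : R[i]) :
  0 < e -> exists n : nat, n.+1%:R^-1 < e.
Proof.
move=> e0; have e0R : 0 < complex.Re e by move: e0; rewrite ltcE => /andP[].
have /archi_boundP nP : 0 <= (complex.Re e)^-1 by rewrite invr_ge0 ltW.
exists (Num.bound (complex.Re e)^-1); set n := Num.bound _ in nP *.
have nP' : (n.+1%:R)^-1 < complex.Re e.
  rewrite invf_plt ?posrE// (lt_trans nP)// ltr_nat//.
have eE : e = (complex.Re e)%:C%C by rewrite RRe_real// gtr0_real.
rewrite eE; move: nP'; rewrite -ltcR; congr (_ < _).
by rewrite rmorphV ?unitfE ?pnatr_eq0//= rmorph_nat.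
Qed.

Definition seq_cauchy (R : realType) (V : zmodType) (N : V -> R[i])
    (u : nat -> V) :=
  forall e : R[i], 0 < e ->
    exists k : nat, forall m n, (k <= m)%N -> (k <= n)%N -> N (u m - u n) < e.

Definition seq_limit (R : realType) (V : zmodType) (N : V -> R[i])
    (u : nat -> V) (l : V) :=
  forall e : R[i], 0 < e -> exists k : nat, forall n, (k <= n)%N -> N (u n - l) < e.

Lemma seq_complete (R : realType) (V : normedModType R[i]) :
  (forall u : nat -> V, seq_cauchy Num.norm u -> exists l, seq_limit Num.norm u l) ->
  forall F : set_system V, ProperFilter F -> cauchy F -> cvg F.
Proof.
move=> Vc F FF Fc.
have /cauchyP Fc' := Fc.
have pos (n : nat) : 0 < n.+1%:R^-1 :> R[i] by rewrite invr_gt0 ltr0n.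
have /choice[u uP] : forall n : nat, exists x, F (ball x (n.+1%:R^-1 : R[i])).
  by move=> n; exact: Fc'.
have u_close m n : `|u m - u n| < m.+1%:R^-1 + n.+1%:R^-1.
  have [x [xm xn]] := filter_ex (filterI (uP m) (uP n)).
  move: xm xn; rewrite -!ball_normE/= => xm xn.
  rewrite -(subrK x (u m)) -addrA (le_lt_trans (ler_normD _ _))//.
  by rewrite ltrD// distrC.
have anti (k m : nat) : (k <= m)%N -> m.+1%:R^-1 <= k.+1%:R^-1 :> R[i].
  by move=> km; rewrite lef_pV2 ?posrE ?ltr0n// ler_nat.
have [|l lP] := Vc u.
  move=> e e0; have e20 : 0 < e / 2 by rewrite divr_gt0.
  have [k kP] := complex_archi e20.
  exists k => m n km kn; apply: (lt_trans (u_close m n)).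
  by rewrite (splitr e) ltrD//; apply: le_lt_trans kP; apply: anti.
apply/cvg_ex; exists l; apply/cvg_ballP => e e0.
have e20 : 0 < e / 2 by rewrite divr_gt0.
have [k kP] := complex_archi e20.
have [k' k'P] := lP _ e20.
have := uP (maxn k k'); apply: filterS => x; rewrite -!ball_normE/= => xP.
rewrite -(subrK (u (maxn k k')) l) -addrA (le_lt_trans (ler_normD _ _))//.
rewrite (splitr e) ltrD//; first by rewrite distrC k'P// leq_maxr.
by apply: (lt_trans xP); apply: le_lt_trans kP; apply: anti; rewrite leq_maxl.
Qed.

HB.factory Record Lmodule_isHilbert (R : realType) H & GRing.Lmodule R[i] H := {
  dot : H -> H -> R[i];
  dot_scalar : forall z : H, scalar (dot ^~ z);
  dotC : forall x y : H, dot x y = (dot y x)^*;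
  dot_gt0 : forall x : H, x != 0 -> 0 < dot x x;
  dot_complete : forall u : nat -> H, seq_cauchy (fun x => dot x x) u ->
    exists l, seq_limit (fun x => dot x x) u l
}.

HB.builders Context R H & Lmodule_isHilbert R H.

HB.instance Definition _ := Lmodule_isNormed.Build R[i] H
  (prenormD dot_scalar dotC dot_gt0) (prenormZ dot_scalar dotC dot_gt0)
  (prenorm_eq0 dot_gt0).

Let complete_subproof :
  forall F : set_system H, ProperFilter F -> cauchy F -> cvg F.
Proof.
apply: seq_complete => u uc.
have normE (x : H) : `|x| ^+ 2 = dot x x by exact: prenorm2.
have sq (x : H) e : 0 < e -> (`|x| < e) = (dot x x < e ^+ 2).
  by move=> e0; rewrite -normE ltr_pXn2r// ?nnegrE ?normr_ge0// ltW.
have [|l lP] := @dot_complete u.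
  move=> e e0; have se0 : 0 < sqrtC e by rewrite sqrtC_gt0.
  have [k kP] := uc _ se0; exists k => m n km kn.
  by rewrite -(sqrtCK e) -sq// kP.
exists l => e e0; have [k kP] := lP _ (exprn_gt0 2 e0).
by exists k => n /kP; rewrite sq.
Qed.

HB.instance Definition _ := Uniform_isComplete.Build H complete_subproof.

HB.instance Definition _ := CompleteNormedModule_isHilbert.Build R H
  dot_scalar dotC (fun x => esym (prenorm2 dot x)).

HB.end.

Section RealComplex.
Variable R : realType.

Lemma realcD (a b : R) : (a + b)%:C%C = a%:C%C + b%:C%C.
Proof. exact: rmorphD. Qed.

Lemma realcM (a b : R) : (a * b)%:C%C = a%:C%C * b%:C%C.
Proof. exact: rmorphM. Qed.

Lemma realc_norm (V : normedModType R[i]) (x : V) :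
  (complex.Re `|x|)%:C%C = `|x|.
Proof. by rewrite RRe_real ?normr_real. Qed.

Lemma realc_normc (x : R[i]) : (complex.Re `|x|)%:C%C = `|x|.
Proof. by rewrite RRe_real ?normr_real. Qed.

End RealComplex.

Section HilbertTheory.
Variables (R : realType) (H : hilbertType R).
Implicit Types x y z : H.

Lemma hdotDl x y z : '[x + y, z] = '[x, z] + '[y, z].
Proof. exact: predotDl hdot_scalar _ _ _. Qed.

Lemma hdotDr x y z : '[z, x + y] = '[z, x] + '[z, y].
Proof. exact: predotDr hdot_scalar hdotC _ _ _. Qed.

Lemma hdotZl a x z : '[a *: x, z] = a * '[x, z].
Proof. exact: predotZl hdot_scalar _ _ _. Qed.

Lemma hdotZr a x z : '[z, a *: x] = a^* * '[z, x].
Proof. exact: predotZr hdot_scalar hdotC _ _ _. Qed.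

Lemma hdotBl x y z : '[x - y, z] = '[x, z] - '[y, z].
Proof. exact: predotBl hdot_scalar _ _ _. Qed.

Lemma hdotBr x y z : '[z, x - y] = '[z, x] - '[z, y].
Proof. exact: predotBr hdot_scalar hdotC _ _ _. Qed.

Lemma hdot0l z : '[0, z] = 0.
Proof. exact: predot0l hdot_scalar _. Qed.

Lemma hdot0r z : '[z, 0] = 0.
Proof. exact: predot0r hdot_scalar hdotC _. Qed.

Lemma hdot_gt0 x : x != 0 -> 0 < '[x, x].
Proof. by move=> x0; rewrite hdot_norm exprn_gt0// normr_gt0. Qed.

Lemma hdot_CS x y : `|'[x, y]| <= `|x| * `|y|.
Proof.
rewrite -(@ler_pXn2r _ 2) ?nnegrE ?mulr_ge0// exprMn -!hdot_norm.
exact: predot_CS hdot_scalar hdotC hdot_gt0 _ _.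
Qed.

End HilbertTheory.

Section BoundedOperators.
Variables (R : realType) (H K : hilbertType R).

Definition bounded_linear : {pred H -> K} := fun f =>
  `[< linear f /\ exists M : R, forall x, `|f x| <= M%:C%C * `|x| >].

Record bop := Bop { bop_fun :> H -> K; bopP : bop_fun \in bounded_linear }.

HB.instance Definition _ := [isSub for bop_fun].
HB.instance Definition _ := [Choice of bop by <:].

Lemma bounded_linear_submod : submod_closed bounded_linear.
Proof.
split=> [|a f g /asboolP[fl [M fM]] /asboolP[gl [N gN]]]; apply/asboolP.
  split; first by move=> a x y /=; rewrite scaler0 addr0.
  by exists 0 => x /=; rewrite normr0 mul0r.
have E x : (a *: f + g) x = a *: f x + g x by [].
split=> [c x y /=|].
  rewrite !E fl gl !scalerDr !scalerA [a * c]mulrC; rewrite -!addrA; congr (_ + _).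
  by rewrite addrCA.
exists (complex.Re `|a| * M + N) => x; rewrite E.
rewrite realcD realcM realc_normc mulrDl.
by rewrite (le_trans (ler_normD _ _))// lerD// normrZ -mulrA ler_wpM2l.
Qed.

HB.instance Definition _ :=
  GRing.isSubmodClosed.Build _ _ bounded_linear bounded_linear_submod.
HB.instance Definition _ := [SubChoice_isSubLmodule of bop by <:].

Lemma bop_linear (A : bop) : linear A.
Proof. by have /asboolP[] := bopP A. Qed.

HB.instance Definition _ (A : bop) :=
  GRing.isLinear.Build R[i] H K *:%R (bop_fun A) (bop_linear A).

Lemma bop_ext (A B : bop) : A =1 B -> A = B.
Proof. by move=> AB; apply: val_inj; apply/funext. Qed.

Lemma bopD (A B : bop) x : (A + B) x = A x + B x.
Proof. by []. Qed.

Lemma bopN (A : bop) x : (- A) x = - A x.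
Proof. by []. Qed.

Lemma bopZ a (A : bop) x : (a *: A) x = a *: A x.
Proof. by []. Qed.

Lemma bop0 x : (0 : bop) x = 0.
Proof. by []. Qed.

Definition opnorm (A : bop) : R :=
  sup [set complex.Re `|A x| | x in [set x : H | `|x| <= 1]].

Let opnorm_has_ub (A : bop) :
  has_ubound [set complex.Re `|A x| | x in [set x : H | `|x| <= 1]].
Proof.
have /asboolP[_ [M AM]] := bopP A.
exists `|M| => _ [x /= x1 <-]; rewrite -lecR realc_norm.
rewrite (le_trans (AM x))// -[leRHS]mulr1.
apply: (@le_trans _ _ ((`|M|)%:C%C * `|x|)).
  by rewrite ler_wpM2r// lecR ler_norm.
by rewrite ler_wpM2l// ler0c.
Qed.

Lemma opnorm_ge0 (A : bop) : 0 <= opnorm A.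
Proof.
have -> : 0 = complex.Re `|A 0| by rewrite linear0 normr0.
by apply: ub_le_sup; [exact: opnorm_has_ub|exists 0 => //=; rewrite normr0].
Qed.

Lemma opnorm_bound (A : bop) x : `|A x| <= (opnorm A)%:C%C * `|x|.
Proof.
have [->|x0] := eqVneq x 0; first by rewrite linear0 !normr0 mulr0.
have nx : 0 < `|x| by rewrite normr_gt0.
rewrite -ler_pdivrMr//.
have -> : `|A x| / `|x| = `|A (`|x|^-1 *: x)|.
  by rewrite linearZ normrZ gtr0_norm ?invr_gt0// mulrC.
rewrite -[leLHS]realc_norm lecR.
apply: ub_le_sup; first exact: opnorm_has_ub.
exists (`|x|^-1 *: x) => //=.
by rewrite normrZ gtr0_norm ?invr_gt0// mulVf// lt0r_neq0.
Qed.

Lemma opnorm_le (A : bop) (M : R) :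
  0 <= M -> (forall x, `|A x| <= M%:C%C * `|x|) -> opnorm A <= M.
Proof.
move=> M0 AM; apply: ge_sup; first by exists (complex.Re `|A 0|), 0 => //=; rewrite normr0.
move=> _ [x /= x1 <-]; rewrite -lecR realc_norm.
by rewrite (le_trans (AM x))// -[leRHS]mulr1 ler_wpM2l// ler0c.
Qed.

Let opnormC (A : bop) : R[i] := (opnorm A)%:C%C.

Let opnormD (A B : bop) : opnormC (A + B) <= opnormC A + opnormC B.
Proof.
rewrite /opnormC -realcD lecR opnorm_le ?addr_ge0 ?opnorm_ge0// => x.
rewrite realcD mulrDl bopD (le_trans (ler_normD _ _))//.
by rewrite lerD// opnorm_bound.
Qed.

Let opnormZ a (A : bop) : opnormC (a *: A) = `|a| * opnormC A.
Proof.
have sub (b : R[i]) (B : bop) : opnormC (b *: B) <= `|b| * opnormC B.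
  rewrite /opnormC -(realc_normc b) -realcM lecR opnorm_le//.
    by rewrite mulr_ge0 ?opnorm_ge0// -ler0c realc_normc.
  move=> x; rewrite realcM realc_normc bopZ normrZ -mulrA.
  by rewrite ler_wpM2l// opnorm_bound.
apply/eqP; rewrite eq_le sub /=.
have [->|a0] := eqVneq a 0; first by rewrite normr0 mul0r ler0c opnorm_ge0.
rewrite -ler_pdivlMl ?normr_gt0// -normfV.
by have := sub a^-1 (a *: A); rewrite scalerA mulVf// scale1r.
Qed.

Let opnorm_eq0 (A : bop) : opnormC A = 0 -> A = 0.
Proof.
move=> A0; apply: bop_ext => x; apply/eqP; rewrite -normr_eq0 eq_le normr_ge0 andbT.
by rewrite (le_trans (opnorm_bound A x))// -/(opnormC A) A0 mul0r.
Qed.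

HB.instance Definition _ :=
  Lmodule_isNormed.Build R[i] bop opnormD opnormZ opnorm_eq0.

End BoundedOperators.

Notation "''B' ( H , K )" := (bop H K) (format "''B' ( H ,  K )") : type_scope.
Notation "''B' ( H )" := (bop H H) (format "''B' ( H )") : type_scope.

Lemma bop_norm (R : realType) (H K : hilbertType R) (A : 'B(H, K)) :
  `|A| = (opnorm A)%:C%C.
Proof. by []. Qed.

Section OperatorAlgebra.
Variable R : realType.
Implicit Types H K L : hilbertType R.

Lemma bop_bounded H K (A : 'B(H, K)) x : `|A x| <= `|A| * `|x|.
Proof. exact: opnorm_bound. Qed.

Definition mkbop H K (f : H -> K) (fl : linear f) (M : R)
    (fM : forall x, `|f x| <= M%:C%C * `|x|) : 'B(H, K) :=
  Bop (introT (asboolP _) (conj fl (ex_intro _ M fM))).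

Let id_linear H : linear (@idfun H).
Proof. by []. Qed.

Let id_bound H (x : H) : `|idfun x| <= 1%:C%C * `|x|.
Proof. by rewrite mul1r. Qed.

Definition bopid H : 'B(H) := mkbop (@id_linear H) (@id_bound H).

Let comp_linear H K L (A : 'B(K, L)) (B : 'B(H, K)) : linear (A \o B).
Proof. by move=> a x y /=; rewrite !linearP. Qed.

Let comp_bound H K L (A : 'B(K, L)) (B : 'B(H, K)) x :
  `|(A \o B) x| <= (opnorm A * opnorm B)%:C%C * `|x|.
Proof.
rewrite realcM -mulrA (le_trans (opnorm_bound _ _))//.
by rewrite ler_wpM2l ?ler0c ?opnorm_ge0// opnorm_bound.
Qed.

Definition bopcomp H K L (A : 'B(K, L)) (B : 'B(H, K)) : 'B(H, L) :=
  mkbop (comp_linear A B) (comp_bound A B).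

End OperatorAlgebra.

Notation "A '\bo' B" := (bopcomp A B) (at level 40, left associativity) : ring_scope.

Section SequentialCompleteness.
Variables (R : realType) (H : hilbertType R).

Lemma hdot_lt (x : H) (e : R[i]) : 0 < e -> (`|x| < e) = ('[x, x] < e ^+ 2).
Proof. by move=> e0; rewrite hdot_norm ltr_pXn2r// ?nnegrE ?normr_ge0// ltW. Qed.

Lemma seq_limit_cvg (u : nat -> H) (l : H) :
  seq_limit (fun x => '[x, x]) u l <-> u @ \oo --> l.
Proof.
split=> [ul|/cvgrPdist_lt ul e e0].
  apply/cvgrPdist_lt => e e0; have [k kP] := ul _ (exprn_gt0 2 e0).
  by exists k => // n /= /kP; rewrite distrC hdot_lt.
have se0 : 0 < sqrtC e by rewrite sqrtC_gt0.
have [k _ kP] := ul _ se0; exists k => n kn.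
by rewrite -(sqrtCK e) -hdot_lt// distrC kP.
Qed.

Lemma seq_cauchy_cvg (u : nat -> H) :
  seq_cauchy (fun x => '[x, x]) u -> exists l : H, u @ \oo --> l.
Proof.
move=> uc; apply/cvg_ex/cauchy_cvgP/cauchy_ballP => e e0.
have [k kP] := uc _ (exprn_gt0 2 e0).
rewrite near_map2; exists ([set n | (k <= n)%N], [set n | (k <= n)%N]).
  by split; exists k.
move=> [m n] [/= km kn]; rewrite -ball_normE /= hdot_lt//; exact: kP.
Qed.

End SequentialCompleteness.

Section ClosedSubspaces.
Variables (R : realType) (H : hilbertType R).

Record csubspace := CSubspace {
  csub_set :> set H;
  csub_submod : csub_set 0 /\
    forall (a : R[i]) x y, csub_set x -> csub_set y -> csub_set (a *: x + y);
  csub_closed : closed csub_set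
}.

Definition csub_pred (M : csubspace) : {pred H} := fun x => `[< csub_set M x >].

Record csub (M : csubspace) :=
  CSub { csub_val :> H; csub_valP : csub_val \in csub_pred M }.

Lemma csub_pred_submod M : submod_closed (csub_pred M).
Proof.
have [M0 ML] := csub_submod M.
split=> [|a x y /asboolP Mx /asboolP My]; apply/asboolP => //; exact: ML.
Qed.

HB.instance Definition _ M := [isSub for @csub_val M].
HB.instance Definition _ M := [Choice of csub M by <:].
HB.instance Definition _ M :=
  GRing.isSubmodClosed.Build _ _ (csub_pred M) (csub_pred_submod M).
HB.instance Definition _ M := [SubChoice_isSubLmodule of csub M by <:].

Section Instance.
Variable M : csubspace.

Let cdot (x y : csub M) : R[i] := '[csub_val x, csub_val y].

Let cdot_scalar z : scalar (cdot ^~ z).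
Proof. by move=> a x y; rewrite /cdot /= hdotDl hdotZl. Qed.

Let cdotC x y : cdot x y = (cdot y x)^*.
Proof. exact: hdotC. Qed.

Let cdot_gt0 x : x != 0 -> 0 < cdot x x.
Proof.
by move=> x0; apply: hdot_gt0; apply: contra x0 => /eqP x0; apply/eqP/val_inj.
Qed.

Let cdot_complete (u : nat -> csub M) : seq_cauchy (fun x => cdot x x) u ->
  exists l, seq_limit (fun x => cdot x x) u l.
Proof.
move=> uc; have [|l ul] := @seq_cauchy_cvg _ H (fun n => csub_val (u n)).
  by move=> e e0; have [k kP] := uc _ e0; exists k.
have Ml : csub_set M l.
  refine (@closed_cvg nat H \oo _ (fun n => csub_val (u n)) (csub_set M)
    (@csub_closed M) _ l ul).
  by apply: nearW => n; exact/asboolP/csub_valP.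
exists (CSub (introT (asboolP _) Ml)); exact/seq_limit_cvg.
Qed.

HB.instance Definition _ := Lmodule_isHilbert.Build R (csub M)
  cdot_scalar cdotC cdot_gt0 cdot_complete.

Lemma csub_dotE (x y : csub M) : '[x, y] = '[csub_val x, csub_val y].
Proof. by []. Qed.

Lemma csub_normE (x : csub M) : `|x| = `|csub_val x|.
Proof.
by apply: (@pexpIrn _ 2); rewrite ?nnegrE ?normr_ge0// -!hdot_norm.
Qed.

Let incl_linear : linear (@csub_val M).
Proof. by []. Qed.

Let incl_bound (x : csub M) : `|csub_val x| <= 1%:C%C * `|x|.
Proof. by rewrite mul1r csub_normE. Qed.

Definition csub_incl : 'B(csub M, H) := mkbop incl_linear incl_bound.

(* The orthogonal projection of H onto M, with codomain M. Here and below [get]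
   selects the operator with the stated property, which is unique; it exists by
   the projection theorem (csub_proj), Riesz representation (adj), and the
   existence of positive square roots (op_sqrt). *)
Definition csub_proj : 'B(H, csub M) :=
  get [set P : 'B(H, csub M) | forall (x : H) (y : csub M), '[x - csub_incl (P x), csub_incl y] = 0].

(* P_M T|_M; for M invariant under T this is the restriction T|_M *)
Definition compression (T : 'B(H)) : 'B(csub M) := csub_proj \bo T \bo csub_incl.

End Instance.

Lemma closed_orthocompl (S : set H) :
  closed [set x : H | forall y, S y -> '[x, y] = 0].
Proof.
move=> x xc y Sy; apply/eqP; rewrite -normr_eq0; apply/eqP/le_anti.
rewrite normr_ge0 andbT; apply/ler_addgt0Pl => e e0; rewrite addr0.
have ny0 : 0 < `|y| + 1 by rewrite ltr_wpDl.
have [|z [zS]] := xc (ball x (e / (`|y| + 1))).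
  by apply: nbhsx_ballx; rewrite divr_gt0.
rewrite -ball_normE /= => xz.
rewrite -[x](subrK z) hdotDl zS// addr0 (le_trans (hdot_CS _ _))//.
rewrite (le_trans (ler_wpM2r _ (ltW xz)))// -mulrA ler_piMr ?(ltW e0)//.
by rewrite mulrC ler_pdivrMr// mul1r lerDl.
Qed.

Definition orthocompl (S : set H) : csubspace.
Proof.
refine (@CSubspace [set x : H | forall y, S y -> '[x, y] = 0] _
  (@closed_orthocompl S)).
by split=> [y _|a x x' xS x'S y Sy]; rewrite ?hdot0l// hdotDl hdotZl xS ?x'S// mulr0 addr0.
Defined.

End ClosedSubspaces.

Section ComplexLimits.
Variable R : realType.
Implicit Types p q : nat -> R[i].

Definition climn p : R[i] :=
  Complex (limn (fun n => complex.Re (p n))) (limn (fun n => complex.Im (p n))).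

Definition ccvgn p :=
  cvgn (fun n => complex.Re (p n)) /\ cvgn (fun n => complex.Im (p n)).

Lemma ccvgn_lin (a : R[i]) p q : ccvgn p -> ccvgn q ->
  ccvgn (fun n => a * p n + q n) /\
  climn (fun n => a * p n + q n) = a * climn p + climn q.
Proof.
case: a => a b [pr pi] [qr qi].
have -> : (fun n => Complex a b * p n + q n) = fun n =>
    Complex (a * complex.Re (p n) - b * complex.Im (p n) + complex.Re (q n))
      (a * complex.Im (p n) + b * complex.Re (p n) + complex.Im (q n)).
  by apply/funext => n; case: (p n) => c d; case: (q n).
rewrite /ccvgn /climn /=.
have cr : (fun n => a * complex.Re (p n) - b * complex.Im (p n) + complex.Re (q n))
    @ \oo --> a * limn (fun n => complex.Re (p n)) - b * limn (fun n => complex.Im (p n))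
              + limn (fun n => complex.Re (q n)).
  by apply: cvgD => //; apply: cvgB; exact: cvgMr.
have ci : (fun n => a * complex.Im (p n) + b * complex.Re (p n) + complex.Im (q n))
    @ \oo --> a * limn (fun n => complex.Im (p n)) + b * limn (fun n => complex.Re (p n))
              + limn (fun n => complex.Im (q n)).
  by apply: cvgD => //; apply: cvgD; exact: cvgMr.
split; first by split; [apply: cvgP cr|apply: cvgP ci].
by rewrite (cvg_lim _ cr)// (cvg_lim _ ci).
Qed.

Lemma climn_conj p : ccvgn p -> climn (fun n => (p n)^*) = (climn p)^*.
Proof.
move=> [_ pi]; rewrite /climn /=; apply/eqP; rewrite eq_complex /=; apply/andP; split.
  by rewrite (_ : (fun n => _) = fun n => complex.Re (p n))//;
    apply/funext => n; case: (p n).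
have -> : (fun n => complex.Im (p n)^*) = fun n => - complex.Im (p n).
  by apply/funext => n; case: (p n).
by rewrite limN.
Qed.

Lemma climn_mono p (M : R[i]) : (forall n, 0 <= p n) ->
  {homo p : m n / (m <= n)%N >-> m <= n} -> (forall n, p n <= M) ->
  ccvgn p /\ (forall n, p n <= climn p) /\ climn p <= M.
Proof.
move=> p0 pm pM.
have Im0 n : complex.Im (p n) = 0 by have := p0 n; rewrite lecE => /andP[/eqP].
have M0 : complex.Im M = 0.
  by have := le_trans (p0 0) (pM 0); rewrite lecE => /andP[/eqP].
have le n : complex.Re (p n) <= complex.Re M.
  by have := pM n; rewrite lecE => /andP[].
have mono : {homo (fun n => complex.Re (p n)) : m n / (m <= n)%N >-> m <= n}.
  by move=> m n /pm; rewrite lecE => /andP[].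
have cr : cvgn (fun n => complex.Re (p n)).
  by apply: nondecreasing_is_cvgn => //; exists (complex.Re M) => _ [n _ <-].
have ImE : (fun n => complex.Im (p n)) = cst 0 by apply/funext => n; exact: Im0.
split; first by split=> //; rewrite ImE; exact: is_cvg_cst.
have lE : climn p = (limn (fun n => complex.Re (p n)))%:C%C.
  by rewrite /climn ImE lim_cst.
rewrite lE; split=> [n|]; rewrite lecE /= ?Im0 ?M0 eqxx /=.
  exact: nondecreasing_cvgn_le.
by apply: limr_le => //; exact: nearW.
Qed.

Lemma ccvgn_series (t : nat -> R[i]) (M : R[i]) :
  (forall n, \sum_(0 <= k < n) `|t k| <= M) ->
  ccvgn (fun n => \sum_(0 <= k < n) t k).
Proof.
move=> tM.
have M0 : complex.Im M = 0.
  by have := tM 0; rewrite big_geq// lecE => /andP[/eqP].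
have cv (f : nat -> R) : (forall k, `|f k|%:C%C <= `|t k|) -> cvgn (series f).
  move=> ft; apply: normed_cvg; apply: nondecreasing_is_cvgn.
    by move=> m n mn; apply: (@nondecreasing_series _ (fun k => `|f k|) xpredT) => // k _.
  exists (complex.Re M) => _ [n _ <-]; rewrite -lecR.
  have -> : (complex.Re M)%:C%C = M by case: (M) M0 => ? ? /= ->.
  apply: le_trans (tM n); rewrite /series /= (big_morph _ (@realcD R) erefl).
  by apply: ler_sum => k _; exact: ft.
have Re_sum n : complex.Re (\sum_(0 <= k < n) t k) = \sum_(0 <= k < n) complex.Re (t k).
  by apply: (big_morph _ _ erefl) => -[a b] [c d].
have Im_sum n : complex.Im (\sum_(0 <= k < n) t k) = \sum_(0 <= k < n) complex.Im (t k).
  by apply: (big_morph _ _ erefl) => -[a b] [c d].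
split.
- rewrite (_ : (fun n => _) = series (fun k => complex.Re (t k))); last first.
    by apply/funext => n; exact: Re_sum.
  by apply: cv => k; exact: normc_ge_Re.
- rewrite (_ : (fun n => _) = series (fun k => complex.Im (t k))); last first.
    by apply/funext => n; exact: Im_sum.
  apply: cv => k; case: (t k) => a b /=; rewrite normc_def lecR /=.
  by rewrite -sqrtr_sqr ler_wsqrtr// lerDr sqr_ge0.
Qed.

End ComplexLimits.

Section HilbertSum.
Variables (R : realType) (I : countType) (H : hilbertType R).
Implicit Types f g : I -> H.

Definition sq_bounded (M : R[i]) f :=
  forall s : seq I, uniq s -> \sum_(i <- s) `|f i| ^+ 2 <= M.

Definition sq_summable : {pred I -> H} := fun f => `[< exists M, sq_bounded M f >].

(* H^(I), the orthogonal direct sum of copies of H indexed by I *)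
Record hsum := HSum { hsum_fun :> I -> H; hsumP : hsum_fun \in sq_summable }.

HB.instance Definition _ := [isSub for hsum_fun].
HB.instance Definition _ := [Choice of hsum by <:].

Let sq_le (V : normedModType R[i]) (x y : V) :
  `|x + y| ^+ 2 <= 2 * `|x| ^+ 2 + 2 * `|y| ^+ 2.
Proof.
have xy : `|x + y| ^+ 2 <= (`|x| + `|y|) ^+ 2.
  by rewrite ler_pXn2r ?nnegrE ?addr_ge0 ?normr_ge0// ler_normD.
rewrite (le_trans xy)// -subr_ge0.
rewrite (_ : _ - _ = (`|x| - `|y|) ^+ 2); last by ring.
by apply: real_exprn_even_ge0 => //; rewrite realB ?normr_real.
Qed.

Definition mkhsum (f : I -> H) (M : R[i]) (fM : sq_bounded M f) : hsum :=
  @HSum f (introT (asboolP _) (ex_intro (fun M => sq_bounded M f) M fM)).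

Lemma sq_boundedD M N (a : R[i]) f g : sq_bounded M f -> sq_bounded N g ->
  sq_bounded (2 * (`|a| ^+ 2 * M) + 2 * N) (a *: f + g).
Proof.
move=> fM gN s us.
apply: (@le_trans _ _ (\sum_(i <- s) (2 * (`|a| ^+ 2 * `|f i| ^+ 2) + 2 * `|g i| ^+ 2))).
  by apply: ler_sum => i _; apply: le_trans (sq_le _ _) _; rewrite normrZ exprMn.
rewrite big_split /= -!mulr_sumr lerD// ler_wpM2l// ?ler_wpM2l// ?exprn_ge0//;
  by [exact: fM|exact: gN].
Qed.

Lemma sq_summable_submod : submod_closed sq_summable.
Proof.
split=> [|a f g /asboolP[M fM] /asboolP[N gN]]; apply/asboolP.
  by exists 0 => s _; rewrite big1// => i _; rewrite normr0 expr0n.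
by exists (2 * (`|a| ^+ 2 * M) + 2 * N); exact: sq_boundedD.
Qed.

HB.instance Definition _ :=
  GRing.isSubmodClosed.Build _ _ sq_summable sq_summable_submod.
HB.instance Definition _ := [SubChoice_isSubLmodule of hsum by <:].

Lemma hsumD (f g : hsum) i : (f + g) i = f i + g i.
Proof. by []. Qed.

Lemma hsumZ (a : R[i]) (f : hsum) i : (a *: f) i = a *: f i.
Proof. by []. Qed.

Lemma hsum_ext (f g : hsum) : f =1 g -> f = g.
Proof. by move=> fg; apply: val_inj; apply/funext. Qed.

Definition enum_upto (n : nat) : seq I := pmap pickle_inv (iota 0 n).

Lemma enum_upto_uniq n : uniq (enum_upto n).
Proof. by apply: (pmap_uniq (@pickle_invK I)); exact: iota_uniq. Qed.

Lemma mem_enum_upto n i : (i \in enum_upto n) = (choice.pickle i < n)%N.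
Proof.
rewrite /enum_upto mem_pmap; apply/mapP/idP => [[k]|lt].
  rewrite mem_iota /= add0n => kn ki.
  by have := @pickle_invK I k; rewrite -ki /= => ->.
by exists (choice.pickle i); rewrite ?mem_iota ?pickleK_inv.
Qed.

Lemma sum_subseq_le (F : I -> R[i]) (s t : seq I) : (forall i, 0 <= F i) ->
  uniq s -> uniq t -> {subset s <= t} -> \sum_(i <- s) F i <= \sum_(i <- t) F i.
Proof.
move=> F0 us ut st; rewrite [leRHS](bigID (mem s)) /= -[X in _ <= X + _]big_filter.
have ps : perm_eq [seq i <- t | i \in s] s.
  apply: uniq_perm => [||i]; [exact: filter_uniq|exact: us|].
  rewrite mem_filter.
  by case: (boolP (i \in s)) => //= /st ->.
rewrite (perm_big _ ps) /=.
by rewrite lerDl sumr_ge0.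
Qed.

Lemma sum_enum_mono (F : I -> R[i]) : (forall i, 0 <= F i) ->
  {homo (fun n => \sum_(i <- enum_upto n) F i) : m n / (m <= n)%N >-> m <= n}.
Proof.
move=> F0 m n mn; apply: sum_subseq_le => //; rewrite ?enum_upto_uniq// => i.
by rewrite !mem_enum_upto => /leq_trans; exact.
Qed.

Definition hsum_dot_upto f g (n : nat) : R[i] :=
  \sum_(i <- enum_upto n) '[f i, g i].

(* \sum_(i : I) '[f i, g i], along the enumeration of I *)
Definition hsum_dot (f g : hsum) : R[i] := climn (hsum_dot_upto f g).

Lemma hsum_dot_cvg (f g : hsum) : ccvgn (hsum_dot_upto f g).
Proof.
have /asboolP[M fM] := hsumP f; have /asboolP[N gN] := hsumP g.
have -> : hsum_dot_upto f g = fun n => \sum_(0 <= k < n)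
    oapp (fun i => '[f i, g i]) 0 (@pickle_inv I k).
  by apply/funext => n; rewrite /hsum_dot_upto big_pmap /index_iota subn0.
apply: (@ccvgn_series R _ (M + N)) => n.
have -> : \sum_(0 <= k < n) `|oapp (fun i => '[f i, g i]) 0 (@pickle_inv I k)|
    = \sum_(i <- enum_upto n) `|'[f i, g i]|.
  rewrite big_pmap /index_iota subn0; apply: eq_bigr => k _.
  by case: pickle_inv => //=; rewrite normr0.
apply: (@le_trans _ _ (\sum_(i <- enum_upto n) (`|f i| ^+ 2 + `|g i| ^+ 2))).
  apply: ler_sum => i _; apply: le_trans (hdot_CS _ _) _.
  rewrite -subr_ge0 (_ : _ - _ = (`|f i| - `|g i|) ^+ 2 + `|f i| * `|g i|); last by ring.
  apply: addr_ge0; last by rewrite mulr_ge0.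
  by apply: real_exprn_even_ge0 => //; rewrite realB ?normr_real.
by rewrite big_split /= lerD// ?fM ?gN ?enum_upto_uniq.
Qed.

Let dot_scalar (h : hsum) : scalar (hsum_dot ^~ h).
Proof.
move=> a f g /=.
have [_ <-] := ccvgn_lin a (hsum_dot_cvg f h) (hsum_dot_cvg g h).
congr climn; apply/funext => n; rewrite /hsum_dot_upto mulr_sumr -big_split /=.
by apply: eq_bigr => i _; rewrite hdotDl hdotZl.
Qed.

Let dotC (f g : hsum) : hsum_dot f g = (hsum_dot g f)^*.
Proof.
rewrite /hsum_dot -climn_conj; last exact: hsum_dot_cvg.
congr climn; apply/funext => n; rewrite /hsum_dot_upto rmorph_sum.
by apply: eq_bigr => i _; exact: hdotC.
Qed.

Let dot_mono (f : hsum) M : sq_bounded M f ->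
  (forall n, hsum_dot_upto f f n <= hsum_dot f f) /\ hsum_dot f f <= M.
Proof.
move=> fM.
have E n : hsum_dot_upto f f n = \sum_(i <- enum_upto n) `|f i| ^+ 2.
  by apply: eq_bigr => i _; exact: hdot_norm.
apply: (proj2 (@climn_mono R (hsum_dot_upto f f) M _ _ _)) => [n|m n mn|n].
- by rewrite E sumr_ge0// => i _; rewrite exprn_ge0.
- by rewrite !E; apply: sum_enum_mono => // i; rewrite exprn_ge0.
- by rewrite E; apply: fM; exact: enum_upto_uniq.
Qed.

Lemma hsum_dot_le (f : hsum) M : sq_bounded M f -> hsum_dot f f <= M.
Proof. by move=> /dot_mono[]. Qed.

Lemma hsum_dot_bounded (f : hsum) : sq_bounded (hsum_dot f f) f.
Proof.
move=> s us; have /asboolP[M /dot_mono[fM _]] := hsumP f.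
pose n := (\max_(i <- s) (choice.pickle i)).+1.
apply: le_trans (fM n); rewrite /hsum_dot_upto.
rewrite [leRHS](eq_bigr (fun i => `|f i| ^+ 2)); last by move=> i _; exact: hdot_norm.
apply: sum_subseq_le => [i|//||i si].
- by rewrite exprn_ge0.
- exact: enum_upto_uniq.
by rewrite mem_enum_upto ltnS; apply: leq_bigmax_seq.
Qed.

Let coord_le (f : hsum) i : `|f i| ^+ 2 <= hsum_dot f f.
Proof. by have := @hsum_dot_bounded f [:: i] isT; rewrite big_seq1. Qed.

Let dot_gt0 (f : hsum) : f != 0 -> 0 < hsum_dot f f.
Proof.
move=> f0; have [i fi] : exists i, f i != 0.
  apply: contrapT => /forallNP fi; move/negP: f0; apply; apply/eqP/val_inj.
  by apply/funext => i /=; apply/eqP; apply: contraT => /fi.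
by apply: lt_le_trans (coord_le f i); rewrite exprn_gt0// normr_gt0.
Qed.

Let dot_complete (u : nat -> hsum) : seq_cauchy (fun f : hsum => hsum_dot f f) u ->
  exists l, seq_limit (fun f : hsum => hsum_dot f f) u l.
Proof.
move=> uc.
have /choice[l lP] : forall i, exists x : H,
    seq_limit (fun x => '[x, x]) (fun n => u n i) x.
  move=> i; have [|x ux] := @seq_cauchy_cvg _ H (fun n => u n i).
    move=> e e0; have [k kP] := uc _ e0; exists k => m n km kn.
    by apply: le_lt_trans (kP _ _ km kn); rewrite hdot_norm; exact: (coord_le (u m - u n) i).
  by exists x; exact/seq_limit_cvg.
have fin (s : seq I) (e : R[i]) : 0 < e -> exists k, forall n, (k <= n)%N ->
    \sum_(i <- s) `|u n i - l i| ^+ 2 < e.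
  elim: s e => [|i s ih] e e0; first by exists 0 => n _; rewrite big_nil.
  have e20 : 0 < e / 2 by rewrite divr_gt0.
  have [k kP] := ih _ e20; have [k' k'P] := lP i _ e20.
  exists (maxn k k') => n; rewrite geq_max => /andP[/kP kn /k'P k'n].
  by rewrite big_cons (splitr e) ltrD// -hdot_norm.
have tail (e : R[i]) : 0 < e -> exists k, forall n, (k <= n)%N ->
    sq_bounded e (fun i => u n i - l i).
  move=> e0; have e40 : 0 < e / 4 by rewrite divr_gt0.
  have [k kP] := uc _ e40; exists k => n kn s us.
  have [k' k'P] := fin s _ e40; pose m := maxn k k'.
  apply: (@le_trans _ _ (\sum_(i <- s)
      (2 * `|(u n - u m) i| ^+ 2 + 2 * `|u m i - l i| ^+ 2))).
    apply: ler_sum => i _; apply: le_trans (sq_le _ _).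
    by rewrite addrA subrK.
  rewrite big_split /= -!mulr_sumr.
  have -> : e = 2 * (e / 4) + 2 * (e / 4) by field.
  rewrite lerD// ler_wpM2l//.
    by apply: le_trans (hsum_dot_bounded (u n - u m) us) _; apply/ltW/kP => //; rewrite leq_maxl.
  by apply/ltW/k'P; rewrite leq_maxr.
have l_sum : l \in sq_summable.
  apply/asboolP; have [k kP] := tail 1 ltr01.
  have /asboolP[M uM] := hsumP (u k).
  have lE : l = (-1) *: (fun i => u k i - l i) + (u k : I -> H).
    by apply/funext => i /=; rewrite [RHS]/GRing.add /= /GRing.scale /= scaleN1r opprB subrK.
  rewrite lE; eexists; apply: sq_boundedD; [exact: kP|exact: uM].
exists (HSum l_sum) => e e0; have e20 : 0 < e / 2 by rewrite divr_gt0.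
have [k kP] := tail _ e20; exists k => n kn.
have := @hsum_dot_le (u n - HSum l_sum) _ (kP n kn).
by move=> /le_lt_trans; apply; rewrite ltr_pdivrMr// ltr_pMr// ltr1n.
Qed.

HB.instance Definition _ := Lmodule_isHilbert.Build R hsum
  dot_scalar dotC dot_gt0 dot_complete.

Lemma hsum_normE (f : hsum) : `|f| ^+ 2 = hsum_dot f f.
Proof. by rewrite -hdot_norm. Qed.

Lemma hsum_bounded (f : hsum) : sq_bounded (`|f| ^+ 2) f.
Proof. by rewrite hsum_normE; exact: hsum_dot_bounded. Qed.

Lemma hsum_norm_le (f : hsum) M : sq_bounded M f -> `|f| ^+ 2 <= M.
Proof. by rewrite hsum_normE; exact: hsum_dot_le. Qed.

End HilbertSum.

Section ComplexLine.
Variable R : realType.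

(* C as a one-dimensional Hilbert space *)
Definition cline : Type := R[i].
HB.instance Definition _ := GRing.Lmodule.copy cline R[i]^o.

Let dot (x y : cline) : R[i] := (x : R[i]) * (y : R[i])^*.

Let dot_scalar z : scalar (dot ^~ z).
Proof. by move=> a x y; rewrite /dot mulrDl mulrA. Qed.

Let dotC x y : dot x y = (dot y x)^*.
Proof. by rewrite /dot rmorphM /= conjCK mulrC. Qed.

Let dotE (x : cline) : dot x x = `|x : R[i]| ^+ 2.
Proof. by rewrite normCK. Qed.

Let dot_gt0 x : x != 0 -> 0 < dot x x.
Proof. by move=> x0; rewrite dotE exprn_gt0// normr_gt0. Qed.

Let dot_complete (u : nat -> cline) : seq_cauchy (fun x => dot x x) u ->
  exists l, seq_limit (fun x => dot x x) u l.
Proof.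
move=> uc.
have uc' (e : R) : 0 < e -> exists k, forall m n, (k <= m)%N -> (k <= n)%N ->
    `|(u m : R[i]) - u n| < e%:C%C.
  move=> e0; have eC0 : 0 < e%:C%C :> R[i] by rewrite ltcR.
  have [k kP] := uc _ (exprn_gt0 2 eC0); exists k => m n km kn.
  have := kP _ _ km kn; rewrite dotE ltr_pXn2r// ?nnegrE ?normr_ge0//.
  exact: ltW.
have cv (f : R[i] -> R) : (forall x y, f (x - y) = f x - f y) ->
    (forall x, `|f x|%:C%C <= `|x|) -> exists l : R, (fun n => f (u n)) @ \oo --> l.
  move=> fB fx; apply/cvg_ex/cauchy_cvgP/cauchy_ballP => e e0.
  have [k kP] := uc' _ e0.
  rewrite near_map2; exists ([set n | (k <= n)%N], [set n | (k <= n)%N]).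
    by split; exists k.
  move=> [m n] [/= km kn]; rewrite -ball_normE /= -fB -ltcR.
  exact: le_lt_trans (fx _) (kP _ _ km kn).
have ImN (x : R[i]) : `|complex.Im x|%:C%C <= `|x|.
  case: x => a b /=; rewrite normc_def lecR /=.
  by rewrite -sqrtr_sqr ler_wsqrtr// lerDr sqr_ge0.
have [|a ua] := cv (@complex.Re R) _ (@normc_ge_Re R); first by case=> ? ? [].
have [|b ub] := cv (@complex.Im R) _ ImN; first by case=> ? ? [].
exists (Complex a b) => e e0.
have e0R : 0 < complex.Re e by move: e0; rewrite ltcE => /andP[].
have eE : e = (complex.Re e)%:C%C by rewrite RRe_real// gtr0_real.
pose d := Num.sqrt (complex.Re e / 2).
have d0 : 0 < d by rewrite sqrtr_gt0 divr_gt0.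
have [k _ kP] := (proj1 (cvgrPdist_lt _ _) ua) _ d0.
have [k' _ k'P] := (proj1 (cvgrPdist_lt _ _) ub) _ d0.
exists (maxn k k') => n; rewrite geq_max => /andP[/kP/= an /k'P/= bn].
rewrite dotE -add_Re2_Im2 eE ltcR.
have -> : complex.Re e = d ^+ 2 + d ^+ 2.
  by rewrite sqr_sqrtr -?splitr// ltW// divr_gt0.
have sq (t : R) : `|t| < d -> t ^+ 2 < d ^+ 2.
  by move=> td; rewrite -real_normK ?num_real// ltr_pXn2r ?nnegrE// ltW.
rewrite ltrD// sq//.
- by rewrite distrC in an; move: an; case: (u n).
- by rewrite distrC in bn; move: bn; case: (u n).
Qed.

HB.instance Definition _ := Lmodule_isHilbert.Build R cline
  dot_scalar dotC dot_gt0 dot_complete.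

Lemma cline_dotE (x y : cline) : '[x, y] = (x : R[i]) * (y : R[i])^*.
Proof. by []. Qed.

Lemma cline_normE (x : cline) : `|x| = `|x : R[i]|.
Proof.
apply: (@pexpIrn _ 2); rewrite ?nnegrE ?normr_ge0// -hdot_norm.
exact: dotE.
Qed.

End ComplexLine.

Section Operators.
Variable R : realType.
Implicit Types H K : hilbertType R.

Definition adj H K (A : 'B(H, K)) : 'B(K, H) :=
  get [set A' : 'B(K, H) | forall x y, '[A x, y] = '[x, A' y]].

Definition op_ge0 H (A : 'B(H)) : Prop := forall x : H, 0 <= '[A x, x].

Definition op_sqrt H (A : 'B(H)) : 'B(H) :=
  get [set D : 'B(H) | op_ge0 D /\ D \bo D = A].

Definition opword H n (T : 'I_n -> 'B(H)) (a : seq 'I_n) : 'B(H) :=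
  foldr (fun i A => T i \bo A) (bopid H) a.

Section MatrixOperator.
Variables (H K : hilbertType R) (p : nat) (X : 'M['B(H, K)]_p).

Let mx_fun (f : hsum 'I_p H) (i : 'I_p) : K := \sum_j X i j (f j).

Let mx_fun_bounded (f : hsum 'I_p H) :
  sq_bounded ((\sum_i \sum_j `|X i j|) ^+ 2 * `|f| ^+ 2) (mx_fun f).
Proof.
move=> s us.
have coord j : `|f j| <= `|f|.
  rewrite -(@ler_pXn2r _ 2) ?nnegrE ?normr_ge0//.
  by have := @hsum_bounded _ _ _ f [:: j] isT; rewrite big_seq1.
have row i : `|mx_fun f i| <= (\sum_j `|X i j|) * `|f|.
  apply: le_trans (ler_norm_sum _ _ _) _; rewrite mulr_suml; apply: ler_sum => j _.
  by apply: le_trans (bop_bounded _ _) _; rewrite ler_wpM2l.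
have c0 i : 0 <= \sum_j `|X i j| by rewrite sumr_ge0.
apply: (@le_trans _ _ (\sum_i `|mx_fun f i| ^+ 2)).
  apply: sum_subseq_le => //; last by move=> i _; rewrite mem_index_enum.
  - by move=> i; rewrite exprn_ge0.
  - exact: index_enum_uniq.
rewrite -exprMn mulr_suml expr2 mulr_suml; apply: ler_sum => i _.
rewrite expr2; apply: ler_pM; [exact: normr_ge0|exact: normr_ge0|exact: row|].
apply: le_trans (row i) _; rewrite [leRHS](bigD1 i)//= lerDl.
by rewrite sumr_ge0// => k _; rewrite mulr_ge0 ?c0 ?normr_ge0.
Qed.

Let mx_vec (f : hsum 'I_p H) : hsum 'I_p K := mkhsum (mx_fun_bounded f).

Let mx_vec_linear : linear mx_vec.
Proof.
move=> a f g; apply: hsum_ext => i.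
rewrite hsumD hsumZ /= /mx_fun scaler_sumr -big_split /=.
by apply: eq_bigr => j _; rewrite linearP.
Qed.

Let mx_vec_bound f :
  `|mx_vec f| <= (complex.Re (\sum_i \sum_j `|X i j|))%:C%C * `|f|.
Proof.
have c0 : 0 <= \sum_i \sum_j `|X i j| by rewrite sumr_ge0// => i _; rewrite sumr_ge0.
rewrite RRe_real ?ger0_real// -(@ler_pXn2r _ 2) ?nnegrE ?mulr_ge0// exprMn.
by apply: hsum_norm_le; exact: mx_fun_bounded.
Qed.

(* An element of M_p (x) B(H, K) is a p x p matrix of operators; it acts from
   C^p (x) H = H^(p) to C^p (x) K = K^(p). *)
Definition mxop : 'B(hsum 'I_p H, hsum 'I_p K) := mkbop mx_vec_linear mx_vec_bound.

Lemma mxopE f i : mxop f i = \sum_j X i j (f j).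
Proof. by []. Qed.

End MatrixOperator.

Section ClosedSpan.
Variables (H : hilbertType R) (S : set H).

Let clspan_set := [set x : H | forall M : csubspace H, S `<=` csub_set M -> csub_set M x].

Let clspan_submod : clspan_set 0 /\
  forall (a : R[i]) x y, clspan_set x -> clspan_set y -> clspan_set (a *: x + y).
Proof.
split=> [M _|a x y xM yM M SM]; have [M0 ML] := csub_submod M => //.
by apply: ML; [exact: xM|exact: yM].
Qed.

Let clspan_closed : closed clspan_set.
Proof.
move=> x xc M SM; apply: csub_closed => B /xc[y [yM By]].
by exists y; split=> //; exact: yM.
Qed.

Definition clspan : csubspace H := CSubspace clspan_submod clspan_closed.

Lemma sub_clspan : S `<=` clspan.
Proof. by move=> x Sx M; exact. Qed.

Lemma clspan_min (M : csubspace H) : S `<=` M -> clspan `<=` M.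
Proof. by move=> SM x; exact. Qed.

End ClosedSpan.

(* A Hilbert space tensor product of G and H: a realization of G (x) H with the
   canonical inner product and with the elementary tensors total. It is
   unique up to a unitary operator. *)
Record htensor (G H : hilbertType R) := HTensor {
  tspace :> hilbertType R;
  tmul : G -> H -> tspace;
  tmul_linearl : forall y, linear (tmul ^~ y);
  tmul_linearr : forall x, linear (tmul x);
  tmul_dot : forall x y x' y', '[tmul x y, tmul x' y'] = '[x, x'] * '[y, y'];
  tmul_total : forall M : csubspace tspace,
    (forall x y, csub_set M (tmul x y)) -> forall z, csub_set M z
}.

Definition tensop G H (W : htensor G H) (A : 'B(G)) (B : 'B(H)) : 'B(W) :=
  get [set Z : 'B(W) | forall x y, Z (tmul W x y) = tmul W (A x) (B y)].

Section SubTensor.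
Variables (G H : hilbertType R) (W : htensor G H) (N : csubspace G).

Definition subtensor_space : csubspace W :=
  clspan [set tmul W (csub_incl N x) y | x in [set: csub N] & y in [set: H]].

Let subtensor_in x y : tmul W (csub_incl N x) y \in csub_pred subtensor_space.
Proof. by apply/asboolP/sub_clspan; exists x => //; exists y. Qed.

Let subtmul (x : csub N) (y : H) : csub subtensor_space := CSub (subtensor_in x y).

Let subtmul_linearl y : linear (subtmul ^~ y).
Proof. move=> a x x'; apply: val_inj.
rewrite [LHS]/(tmul W (csub_incl N (a *: x + x')) y) linearP; exact: tmul_linearl. Qed.

Let subtmul_linearr x : linear (subtmul x).
Proof. move=> a y y'; apply: val_inj.
rewrite [LHS]/(tmul W (csub_incl N x) (a *: y + y')); exact: tmul_linearr. Qed.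

Let subtmul_dot x y x' y' : '[subtmul x y, subtmul x' y'] = '[x, x'] * '[y, y'].
Proof. by rewrite csub_dotE tmul_dot. Qed.

Let subtmul_total (M : csubspace (csub subtensor_space)) :
  (forall x y, csub_set M (subtmul x y)) -> forall z, csub_set M z.
Proof.
move=> Mt.
pose P := [set z : W | exists2 z' : csub subtensor_space, csub_set M z' & csub_val z' = z].
have Psub : P 0 /\ forall (a : R[i]) x y, P x -> P y -> P (a *: x + y).
  have [M0 ML] := csub_submod M; split; first by exists 0.
  by move=> a _ _ [x Mx <-] [y My <-]; exists (a *: x + y) => //; exact: ML.
have Pcl : closed P.
  move=> z zP.
  have zS : csub_set subtensor_space z.
    by apply: csub_closed => B /zP[_ [[z' _ <-] Bz]]; exists (csub_val z'); split=> //;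
      exact/asboolP/csub_valP.
  exists (CSub (introT (asboolP _) zS)) => //; apply: csub_closed => B Bz.
  move: Bz; rewrite -nbhs_ballE => -[e /= e0 eB].
  have [_ [[z' Mz' <-] zz']] := zP _ (nbhsx_ballx z e e0).
  exists z'; split=> //; apply: eB; move: zz'.
  by rewrite -!ball_normE /= csub_normE.
move=> z; have /asboolP zS := csub_valP z.
have [|z' Mz' /val_inj <- //] := zS (CSubspace Psub Pcl).
by move=> _ [x _ [y _ <-]]; exists (subtmul x y).
Qed.

(* for N a closed subspace of G, the space N (x) H inside G (x) H *)
Definition subtensor : htensor (csub N) H :=
  HTensor subtmul_linearl subtmul_linearr subtmul_dot subtmul_total.

End SubTensor.

Section SumTensor.
Variables (I : countType) (H : hilbertType R).
Let G := hsum I (cline R).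

Let stmul_fun (f : G) (h : H) (i : I) : H := (f i : R[i]) *: h.

Let stmul_bounded f h : sq_bounded (`|f| ^+ 2 * `|h| ^+ 2) (stmul_fun f h).
Proof.
move=> s us; rewrite (eq_bigr (fun i => `|f i| ^+ 2 * `|h| ^+ 2)); last first.
  by move=> i _; rewrite normrZ exprMn cline_normE.
by rewrite -mulr_suml ler_wpM2r ?exprn_ge0//; exact: hsum_bounded.
Qed.

Let stmul (f : G) (h : H) : hsum I H := mkhsum (stmul_bounded f h).

Let stmulE f h i : stmul f h i = (f i : R[i]) *: h.
Proof. by []. Qed.

Let cline_scale (a : R[i]) (x y : cline R) (h : H) :
  ((a *: x + y : cline R) : R[i]) *: h = a *: ((x : R[i]) *: h) + (y : R[i]) *: h.
Proof. by rewrite scalerA -scalerDl. Qed.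

Let stmul_linearl h : linear (stmul ^~ h).
Proof.
move=> a f g; apply: hsum_ext => i.
by rewrite hsumD hsumZ !stmulE hsumD hsumZ cline_scale.
Qed.

Let stmul_linearr f : linear (stmul f).
Proof.
move=> a h k; apply: hsum_ext => i.
by rewrite hsumD hsumZ !stmulE scalerDr !scalerA mulrC.
Qed.

Let stmul_dot f h g k : '[stmul f h, stmul g k] = '[f, g] * '[h, k].
Proof.
have c0 : ccvgn (fun _ : nat => 0 : R[i]) by split; exact: is_cvg_cst.
have [_] := ccvgn_lin '[h, k] (hsum_dot_cvg f g) c0.
have -> : climn (fun _ : nat => 0 : R[i]) = 0 by rewrite /climn !lim_cst.
rewrite addr0 mulrC => <-; congr climn; apply/funext => n.
rewrite addr0 mulr_sumr; apply: eq_bigr => i _.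
rewrite !stmulE hdotZl hdotZr cline_dotE.
by rewrite [LHS]mulrA [LHS]mulrC.
Qed.

Let hbasis_bounded (i : I) :
  sq_bounded 1 (fun j => (j == i)%:R : cline R).
Proof.
move=> s us; have [si|si] := boolP (i \in s).
  rewrite (bigD1_seq i)//= big1 => [|j /negbTE ->]; last by rewrite normr0 expr0n.
  by rewrite addr0 eqxx cline_normE normr1 expr1n.
rewrite big1_seq ?ler01// => j /= js; rewrite (_ : j == i = false) ?normr0 ?expr0n//.
by apply: contraNF si => /eqP <-.
Qed.

Definition hbasis (i : I) : hsum I (cline R) := mkhsum (hbasis_bounded i).

Let stmul_total (M : csubspace (hsum I H)) :
  (forall f h, csub_set M (stmul f h)) -> forall z, csub_set M z.
Proof.
move=> Mt z; apply: csub_closed => B; rewrite -nbhs_ballE => -[e /= e0 eB].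
pose zn n : hsum I H := \sum_(i <- enum_upto I n) stmul (hbasis i) (z i).
have [M0 ML] := csub_submod M.
have Mzn n : csub_set M (zn n).
  rewrite /zn; elim: enum_upto => [|i s ih]; first by rewrite big_nil.
  by rewrite big_cons -[stmul _ _]scale1r; exact: ML.
have znE n i : zn n i = if i \in enum_upto I n then z i else 0.
  have -> : zn n i = \sum_(j <- enum_upto I n) stmul (hbasis j) (z j) i.
    by rewrite /zn; elim: (enum_upto I n) => [|j s ih]; rewrite ?big_nil// !big_cons -ih.
  have [iE|iE] := ifPn.
    rewrite (bigD1_seq i) ?enum_upto_uniq//= big1 ?addr0 => [|j ji].
      by rewrite /stmul_fun /= eqxx scale1r.
    by rewrite /stmul_fun /= eq_sym (negbTE ji) scale0r.
  rewrite big1_seq// => j /= jE; rewrite /stmul_fun /= (_ : i == j = false) ?scale0r//.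
  by apply: contraNF iE => /eqP ->.
pose p n := \sum_(i <- enum_upto I n) `|z i| ^+ 2.
have tail n : `|z - zn n| ^+ 2 <= `|z| ^+ 2 - p n.
  apply: hsum_norm_le => s us; rewrite lerBrDr.
  have diff i : (z - zn n) i = if i \in enum_upto I n then 0 else z i.
    rewrite [LHS]/(z i - zn n i) znE; case: ifP => _; first exact: subrr.
    exact: subr0.
  have -> : \sum_(i <- s) `|(z - zn n) i| ^+ 2
      = \sum_(i <- [seq i <- s | i \notin enum_upto I n]) `|z i| ^+ 2.
    rewrite big_filter (bigID (mem (enum_upto I n))) /=.
    have -> : \sum_(i <- s | i \in enum_upto I n) `|(z - zn n) i| ^+ 2 = 0.
      apply: big1 => i iE; have := diff i; rewrite iE => dE.
      rewrite (_ : (z - zn n) i = 0) ?normr0 ?expr0n//; exact: dE.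
    rewrite add0r; apply: eq_bigr => i iE.
    by have := diff i; rewrite (negbTE iE) => dE; congr (`|_| ^+ 2); exact: dE.
  rewrite /p -big_cat; apply: hsum_bounded.
  rewrite cat_uniq filter_uniq// enum_upto_uniq andbT; apply/hasPn => i iE /=.
  by rewrite mem_filter /= iE.
have [n nP] : exists n, `|z| ^+ 2 - p n < e ^+ 2.
  apply: contrapT => /forallNP np.
  have pE m : hsum_dot_upto z z m = p m by apply: eq_bigr => i _; rewrite hdot_norm.
  have [||| _ [_ lim]] := @climn_mono R (hsum_dot_upto z z) (`|z| ^+ 2 - e ^+ 2).
  - by move=> m; rewrite pE sumr_ge0// => i _; rewrite exprn_ge0.
  - by move=> m k mk; rewrite !pE; apply: sum_enum_mono => // i; rewrite exprn_ge0.
  - move=> m; rewrite pE.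
    have zp : 0 <= `|z| ^+ 2 - p m.
      by rewrite subr_ge0; apply: hsum_bounded; exact: enum_upto_uniq.
    have e2 : e ^+ 2 \is Num.real by apply/ger0_real/exprn_ge0/ltW.
    have /negP := np m; rewrite -(real_leNgt e2 (ger0_real zp)).
    by rewrite lerBrDr -lerBrDl.
  move: lim; rewrite -[climn _]/(hsum_dot z z) -hsum_normE -subr_ge0 addrAC subrr add0r.
  by rewrite oppr_ge0 => /(lt_le_trans (exprn_gt0 2 e0)); rewrite ltxx.
exists (zn n); split; first exact: Mzn.
apply: eB; rewrite -ball_normE /=.
rewrite -(@ltr_pXn2r _ 2) ?nnegrE ?normr_ge0 ?(ltW e0)//.
exact: le_lt_trans (tail n) nP.
Qed.

(* l^2(I) (x) H = H^(I) *)
Definition hsum_tensor : htensor (hsum I (cline R)) H :=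
  HTensor stmul_linearl stmul_linearr stmul_dot stmul_total.

Lemma hsum_tensorE f h i : (tmul hsum_tensor f h : hsum I H) i = (f i : R[i]) *: h.
Proof. by []. Qed.

End SumTensor.

End Operators.

Section FockSpace.
Variables (R : realType) (n : nat).

(* the full Fock space F^2(H_n): e_alpha, for alpha a word, is hbasis alpha *)
Definition fock : hilbertType R := hsum (seq 'I_n) (cline R).

Let creation_fun (i : 'I_n) (f : fock) (a : seq 'I_n) : cline R :=
  if a is j :: b then if j == i then (f : hsum _ _) b else 0 else 0.

Let creation_bounded i (f : fock) : sq_bounded (`|f| ^+ 2) (creation_fun i f).
Proof.
move=> s us.
pose tl (a : seq 'I_n) := if a is j :: b then if j == i then Some b else None else None.
have tlK : ocancel tl (cons i) by case=> [|j b] //=; case: eqVneq => [->|].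
have -> : \sum_(a <- s) `|creation_fun i f a| ^+ 2
    = \sum_(b <- pmap tl s) `|(f : hsum _ _) b| ^+ 2.
  rewrite big_pmap; apply: eq_bigr => -[|j b] _ /=; first by rewrite normr0 expr0n.
  by case: eqVneq => //= _; rewrite normr0 expr0n.
by apply: hsum_bounded; exact: (pmap_uniq tlK).
Qed.

Let creation_vec i (f : fock) : fock := mkhsum (creation_bounded i f).

Let creation_linear i : linear (creation_vec i).
Proof.
move=> a f g; apply: hsum_ext => -[|j b]; rewrite hsumD hsumZ /=.
  by rewrite scaler0 addr0.
by case: eqVneq => // _; rewrite scaler0 addr0.
Qed.

Let creation_norm i (f : fock) : `|creation_vec i f| <= 1%:C%C * `|f|.
Proof.
rewrite mul1r -(@ler_pXn2r _ 2) ?nnegrE ?normr_ge0//.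
by apply: hsum_norm_le; exact: creation_bounded.
Qed.

(* the left creation operator psi |-> e_i (x) psi *)
Definition creation (i : 'I_n) : 'B(fock) :=
  mkbop (@creation_linear i) (@creation_norm i).

Lemma creation_basis i (a : seq 'I_n) :
  creation i (hbasis R a) = hbasis R (i :: a).
Proof.
apply: hsum_ext => -[|j b] //=; rewrite eqseq_cons.
by case: eqVneq.
Qed.

End FockSpace.

Section OperatorAlgebras.
Variables (R : realType) (H : hilbertType R).
Implicit Types A B : set 'B(H).

Definition is_subspace A : Prop :=
  A 0 /\ forall (a : R[i]) X Y, A X -> A Y -> A (a *: X + Y).

Definition is_subalgebra A : Prop :=
  is_subspace A /\ forall X Y, A X -> A Y -> A (X \bo Y).

(* closed for the weak operator topology, whose basic neighbourhoods are given
   by finitely many pairs of vectors *)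
Definition wot_closed A : Prop := forall T : 'B(H),
  (forall (s : seq (H * H)) (e : R[i]), 0 < e ->
     exists2 X, A X & forall xy, xy \in s -> `|'[(X - T) xy.1, xy.2]| < e) ->
  A T.

Definition is_ideal A B : Prop :=
  [/\ B `<=` A, is_subspace B &
      forall X Y, A X -> B Y -> B (X \bo Y) /\ B (Y \bo X)].

Definition norm_algebra A : set 'B(H) :=
  smallest [set B | is_subalgebra B /\ closed B] (A `|` [set bopid H]).

Definition wot_algebra A : set 'B(H) :=
  smallest [set B | is_subalgebra B /\ wot_closed B] (A `|` [set bopid H]).

Definition wot_ideal A S : set 'B(H) :=
  smallest [set B | is_ideal A B /\ wot_closed B] S.

Definition lin_span A : set 'B(H) := smallest is_subspace A.

End OperatorAlgebras.

Section CompleteContraction.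
Variables (R : realType) (H K : hilbertType R).

(* the matrices belonging to M_p (x) A *)
Definition mx_over (A : set 'B(H)) p (F : 'M['B(H)]_p) : Prop := forall i j, A (F i j).

Definition linear_on (A : set 'B(H)) (Phi : 'B(H) -> 'B(K)) : Prop :=
  forall (a : R[i]) X Y, A X -> A Y -> Phi (a *: X + Y) = a *: Phi X + Phi Y.

Definition completely_contractive_on (A : set 'B(H)) (Phi : 'B(H) -> 'B(K)) : Prop :=
  forall p (F : 'M['B(H)]_p), (0 < p)%N -> mx_over A F ->
  `|mxop (map_mx Phi F)| <= `|mxop F|.

End CompleteContraction.

Section Polynomials.
Variables (R : realType) (n : nat).

(* p : {ncpoly} stands for the sum of the p a *: e_a, a in the finite support of p *)
Definition ncpoly := {fsfun seq 'I_n -> R[i] with 0}.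

Definition nceval (H : hilbertType R) (p : ncpoly) (T : 'I_n -> 'B(H)) : 'B(H) :=
  \sum_(a <- finsupp p) p a *: opword T a.

Definition homogeneous (p : ncpoly) : Prop :=
  exists m : nat, forall a, a \in finsupp p -> size a = m.

End Polynomials.

Section Ideals.
Variables (R : realType) (n d : nat) (q : 'I_d -> ncpoly R n).

Definition Finfty : set 'B(fock R n) := wot_algebra (range (@creation R n)).

Definition Jideal : set 'B(fock R n) :=
  wot_ideal Finfty (range (fun j => nceval (q j) (@creation R n))).

Definition MJ : set (fock R n) :=
  closure [set (A : 'B(fock R n)) psi | A in Jideal & psi in [set: fock R n]].

Definition NJ : csubspace (fock R n) := orthocompl MJ.

Definition Bshift (i : 'I_n) : 'B(csub NJ) := compression NJ (creation R i).

Definition algAJ : set 'B(csub NJ) := norm_algebra (range Bshift).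

Definition spanB : set 'B(csub NJ) :=
  lin_span [set opword Bshift a \bo adj (opword Bshift b) | a in [set: seq 'I_n] & b in [set: seq 'I_n]].

End Ideals.

Arguments Finfty : clear implicits.
Arguments Jideal {R n d} q.
Arguments MJ {R n d} q.
Arguments NJ {R n d} q.
Arguments Bshift {R n d} q i.
Arguments algAJ {R n d} q.
Arguments spanB {R n d} q.

Section RowContractions.
Variables (R : realType) (n : nat) (H : hilbertType R) (T : 'I_n -> 'B(H)).

Definition row_contraction : Prop := op_ge0 (bopid H - \sum_i T i \bo adj (T i)).

(* Delta_r = (I - r^2 sum_i T_i T_i^* )^(1/2) *)
Definition defect (r : R) : 'B(H) :=
  op_sqrt (bopid H - (r ^+ 2)%:C%C *: \sum_i T i \bo adj (T i)).

Definition fock_tensor : htensor (fock R n) H := hsum_tensor (seq 'I_n) H.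

Definition poisson (r : R) : 'B(H, fock_tensor) :=
  get [set K : 'B(H, fock_tensor) | forall h,
    series (fun k => \sum_(a : k.-tuple 'I_n)
      tmul fock_tensor (hbasis R (tval a))
        ((r ^+ k)%:C%C *: defect r (adj (opword T a) h))) @ \oo --> K h].

Section PoissonJ.
Variables (d : nat) (q : 'I_d -> ncpoly R n).

Definition NJ_tensor : htensor (csub (NJ q)) H := subtensor fock_tensor (NJ q).

(* the Poisson kernel regarded as an operator into N_J (x) H *)
Definition poissonJ (r : R) : 'B(H, NJ_tensor) :=
  get [set K : 'B(H, NJ_tensor) | csub_incl _ \bo K = poisson r].

Definition poisson_transform (r : R) (X : 'B(csub (NJ q))) : 'B(H) :=
  adj (poissonJ r) \bo tensop NJ_tensor X (bopid H) \bo poissonJ r.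

End PoissonJ.

End RowContractions.

Section JointOperatorRadii.
Variable R : realType.

(* separable and nonzero *)
Definition standing (H : hilbertType R) : Prop :=
  (exists2 D : set H, countable D & dense D) /\ exists x : H, x != 0.

(* Only the values at standing spaces and at d > 0 are ever constrained or used. *)
Definition radius_family :=
  forall (H : hilbertType R) (d : nat), ('I_d -> 'B(H)) -> R.

Definition append0 (H : hilbertType R) d (T : 'I_d -> 'B(H)) (i : 'I_d.+1) : 'B(H) :=
  if unlift ord_max i is Some j then T j else 0.

Variable omega : radius_family.

Definition joint_operator_radius : Prop :=
  forall (H : hilbertType R) d (T : 'I_d -> 'B(H)), standing H -> (0 < d)%N ->
  [/\ 0 <= omega T,
      forall s : 'S_d, omega (fun i => T (s i)) = omega T &
      omega (append0 T) = omega T].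

Definition unitarily_invariant : Prop :=
  forall (H K : hilbertType R) (U : 'B(K, H)) d (T : 'I_d -> 'B(H)),
  standing H -> standing K -> (0 < d)%N ->
  adj U \bo U = bopid K -> U \bo adj U = bopid H ->
  omega (fun i => adj U \bo T i \bo U) = omega T.

Definition ampliation_invariant : Prop :=
  forall (G H : hilbertType R) (W : htensor G H) d (T : 'I_d -> 'B(H)),
  standing G -> standing H -> (0 < d)%N ->
  omega (fun i => tensop W (bopid G) (T i)) = omega T.

(* compression M (T i) is the restriction of T i to M, since M is invariant *)
Definition restriction_monotone : Prop :=
  forall (H : hilbertType R) (M : csubspace H) d (T : 'I_d -> 'B(H)),
  standing H -> (exists x : csub M, x != 0) -> (0 < d)%N ->
  (forall i x, csub_set M x -> csub_set M (T i x)) ->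
  omega (fun i => compression M (T i)) <= omega T.

Definition compression_monotone : Prop :=
  forall (H : hilbertType R) (M : csubspace H) d (T : 'I_d -> 'B(H)),
  standing H -> (exists x : csub M, x != 0) -> (0 < d)%N ->
  omega (fun i => compression M (T i)) <= omega T.

Definition admissible : Prop :=
  [/\ unitarily_invariant, ampliation_invariant & restriction_monotone].

Definition strongly_admissible : Prop :=
  [/\ unitarily_invariant, ampliation_invariant & compression_monotone].

Definition norm_quasi_continuous : Prop :=
  forall (K : hilbertType R) d (b : R), standing K -> (0 < d)%N -> 0 <= b ->
  closed [set T : {ptws 'I_d -> 'B(K)} | omega T <= b].

End JointOperatorRadii.

(* Main.v *)
(* For 0 <= r < 1 the norms of the homogeneous parts of the Poisson kernel K_r
   telescope, so K_r is an isometry, and (S_i^* (x) I) K_r = r K_r T_i^*.  An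
   element Y of F_n^infty commutes with right multiplication by words, so
   Y q(S) e_b is a norm limit of combinations of e_c (x) q (x) e_b; since q is
   homogeneous, K_r^* sends such a vector tensored with h to a multiple of
   T_c q(T) T_b (Delta_r h) = 0.  Hence K_r has range in N_J (x) H, and there
   (B_i^* (x) I) K_r = r K_r T_i^*.  The maps X |-> K_r^* (X (x) I) K_r are
   therefore complete contractions that send B_a B_b^* to r^(|a|+|b|) T_a T_b^*;
   they converge in norm on the span of these operators, hence on its closure.
   At the level r, each radius inequality is a compression to the range of
   the isometry I_p (x) K_r; it is a restriction for the adjoints of elements
   of A_n^J, whose ampliations leave that range invariant.  Quasi-continuity
   passes to the limit r -> 1. *)

Require Import Defs.
From HB Require Import structures.
From mathcomp Require Import all_boot all_order all_algebra all_fingroup finmap.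
From mathcomp Require Import boolp classical_sets functions cardinality reals.
From mathcomp Require Import topology normedtype sequences.
From mathcomp Require Import complex.
From mathcomp Require Import ring lra.
Set Implicit Arguments.
Unset Strict Implicit.
Unset Printing Implicit Defensive.
Import Order.TTheory GRing.Theory Num.Theory numFieldNormedType.Exports.
Local Open Scope classical_set_scope.
Local Open Scope ring_scope.

(** * Operators on Hilbert spaces *)

(** Adjoints, projections, square roots, tensored operators and Poisson kernels are all selected by
    [get], so each needs an existence proof before anything can be computed with it. Square roots of
    [1 - B] are built only for self-adjoint [B] of norm below 1. This covers [Delta_r], since
    [r < 1], and it also yields the bound [|A (x) 1| <= |A|], which has to be proved for an
    arbitrary realization of the tensor product. Matrices then cost little: a matrix of ampliations
    [X i j (x) 1_H] acts on [(G (x) H)^(p)], which is itself a tensor product of [G^(p)] and [H], in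
    either order of the factors. So complete contractivity follows from the norm bound for one
    operator, and the radius of such a matrix is found by ampliation invariance. The radius axioms
    speak of separable nonzero spaces; that [N_J] is nonzero is not assumed, but drawn from the
    isometry [K_r]. *)

Section Hilbert.
Variable R : realType.
Implicit Types H K L : hilbertType R.

Lemma conjC_real (c : R) : (c%:C%C)^* = c%:C%C :> R[i].
Proof. exact: conjc_real. Qed.

Lemma hdot_ext H (x y : H) : (forall z, '[x, z] = '[y, z]) -> x = y.
Proof.
move=> xy; apply/eqP; rewrite -subr_eq0; apply: contraT => /hdot_gt0.
by rewrite hdotBl xy subrr ltxx.
Qed.

Lemma hdot_suml H (I : Type) (s : seq I) (P : pred I) (F : I -> H) z :
  '[\sum_(i <- s | P i) F i, z] = \sum_(i <- s | P i) '[F i, z].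
Proof. by apply: (big_morph (hdot ^~ z)) => [x y|]; rewrite ?hdotDl ?hdot0l. Qed.

Lemma hdot_sumr H (I : Type) (s : seq I) (P : pred I) (F : I -> H) z :
  '[z, \sum_(i <- s | P i) F i] = \sum_(i <- s | P i) '[z, F i].
Proof. by apply: (big_morph (hdot z)) => [x y|]; rewrite ?hdotDr ?hdot0r. Qed.

Lemma ler_of_sqr (a b c : R[i]) : 0 <= a -> 0 <= b -> 0 <= c ->
  a ^+ 2 <= c ^+ 2 * b ^+ 2 -> a <= c * b.
Proof. by move=> a0 b0 c0; rewrite -exprMn ler_pXn2r// nnegrE mulr_ge0. Qed.

Lemma complex_le_eps (x : R[i]) : 0 <= x -> (forall e, 0 < e -> x <= e) -> x = 0.
Proof.
move=> x0 xe; apply/eqP; rewrite eq_le x0 andbT; apply/ler_addgt0Pr => e e0.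
by rewrite add0r xe.
Qed.

Lemma bop_add H K (A : 'B(H, K)) x y : A (x + y) = A x + A y.
Proof. exact: linearD. Qed.

Lemma bop_sub H K (A : 'B(H, K)) x y : A (x - y) = A x - A y.
Proof. exact: linearB. Qed.

Lemma bop_scale H K (A : 'B(H, K)) a x : A (a *: x) = a *: A x.
Proof. exact: linearZ. Qed.

Lemma bop_zero H K (A : 'B(H, K)) : A 0 = 0.
Proof. exact: linear0. Qed.

Lemma bop_sum H K (A : 'B(H, K)) (I : Type) (s : seq I) (P : pred I) (F : I -> H) :
  A (\sum_(i <- s | P i) F i) = \sum_(i <- s | P i) A (F i).
Proof. exact: linear_sum. Qed.

Lemma bop_continuous H K (A : 'B(H, K)) : continuous A.
Proof.
move=> x; apply/cvgrPdist_lt => e e0.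
have c0 : 0 < `|A| + 1 by rewrite ltr_wpDl.
have d0 : 0 < e / (`|A| + 1) by rewrite divr_gt0.
near=> y; rewrite -linearB.
apply: (le_lt_trans (bop_bounded _ _)).
apply: (@le_lt_trans _ _ ((`|A| + 1) * `|x - y|)).
  by rewrite ler_wpM2r// lerDl.
rewrite mulrC -ltr_pdivlMr//; near: y.
Unshelve. all: by end_near.
Qed.

Lemma bopB H K (A B : 'B(H, K)) x : (A - B) x = A x - B x.
Proof. by []. Qed.

Lemma closed_bop_eq H K (A B : 'B(H, K)) : closed [set x | A x = B x].
Proof.
have -> : [set x | A x = B x] = (A - B) @^-1` [set 0].
  apply/seteqP; split=> x AB.
    by change (A x - B x = 0); apply/eqP; rewrite subr_eq0; exact/eqP.
  by apply/eqP; rewrite -subr_eq0; exact/eqP.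
apply: preimage_closed; first by move=> x _; exact: bop_continuous.
exact: (accessible_closed_set1 (hausdorff_accessible (@norm_hausdorff _ K))).
Qed.

Definition hfun_fun H (y x : H) : cline R := '[x, y].

Let hfun_linear H (y : H) : linear (hfun_fun y).
Proof. by move=> a x x'; rewrite /hfun_fun hdotDl hdotZl. Qed.

Let hfun_bound H (y x : H) : `|hfun_fun y x| <= (complex.Re `|y|)%:C%C * `|x|.
Proof. by rewrite cline_normE realc_norm mulrC hdot_CS. Qed.

Definition hfun H (y : H) : 'B(H, cline R) := mkbop (@hfun_linear H y) (hfun_bound y).

Lemma csub0 H (M : csubspace H) : csub_set M 0.
Proof. by case: (csub_submod M). Qed.

Lemma csubP H (M : csubspace H) a x y : csub_set M x -> csub_set M y -> csub_set M (a *: x + y).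
Proof. by case: (csub_submod M) => _; exact. Qed.

Lemma csubD H (M : csubspace H) x y : csub_set M x -> csub_set M y -> csub_set M (x + y).
Proof. by move=> Mx My; rewrite -[x]scale1r; exact: csubP. Qed.

Lemma csubZ H (M : csubspace H) a x : csub_set M x -> csub_set M (a *: x).
Proof. by move=> Mx; rewrite -[_ *: _]addr0; apply: csubP => //; exact: csub0. Qed.

Lemma hdot_proj1 H (v m : H) : m != 0 -> let t := '[v, m] / '[m, m] in
  '[v - t *: m, v - t *: m] = '[v, v] - `|'[v, m]| ^+ 2 / '[m, m].
Proof.
move=> /hdot_gt0 /lt0r_neq0 m0 t.
have mmC : ('[m, m])^* = '[m, m] by rewrite -hdotC.
rewrite hdotBl !hdotBr !hdotZr !hdotZl /t rmorphM fmorphV /= mmC normCK.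
by rewrite (hdotC m v); field.
Qed.

(** A minimizing sequence for the distance to [M] is Cauchy. Orthogonality is first proved
    approximately for the terms of the sequence and then passed to the limit. *)
Lemma projection H (M : csubspace H) (x : H) :
  exists2 y, csub_set M y & forall m, csub_set M m -> '[x - y, m] = 0.
Proof.
(* The squared norm as a real number: the infimum is taken in [R], while norms live in [R[i]]. *)
have [N NE] : exists N : H -> R, forall v, (N v)%:C%C = '[v, v].
  exists (fun v => complex.Re `|v| ^+ 2) => v.
  by rewrite expr2 realcM realc_norm hdot_norm expr2.
have para a b : N (a + b) + N (a - b) = 2 * N a + 2 * N b.
  apply: (@complexI R); rewrite !realcD !realcM !NE (_ : 2%:C%C = 2); last first.
    exact: (rmorph_nat (real_complex R) 2).
  by rewrite hdotBl !hdotDl !hdotBr !hdotDr; ring.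
pose D := [set N (x - m) | m in csub_set M].
have N0 v : 0 <= N v by rewrite -ler0c NE hdot_norm exprn_ge0.
have iD : has_inf D.
  split; first by exists (N (x - 0)), 0 => //; exact: csub0.
  by exists 0 => _ [m _ <-].
pose d := inf D.
have dle m : csub_set M m -> d <= N (x - m) by move=> Mm; apply: ge_inf; [case: iD|exists m].
have /choice[u uP] : forall k : nat, exists m, csub_set M m /\ N (x - m) < d + k.+1%:R^-1.
  move=> k; have [|_ [m Mm <-] mP] := @inf_adherent _ D k.+1%:R^-1 _ iD.
    by rewrite invr_gt0 ltr0n.
  by exists m.
have NZ (c : R) v : N (c%:C%C *: v) = c ^+ 2 * N v.
  apply: (@complexI R); rewrite realcM !NE hdotZl hdotZr expr2 realcM mulrA.
  by rewrite conjC_real.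
have two : (2 : R)%:C%C = 2 :> R[i] by exact: (rmorph_nat (real_complex R) 2).
(* Parallelogram law for [x - u j] and [x - u i]; their midpoint is [x] minus a point of [M], so its
   squared norm is at least [d]. *)
have close i j : N (u i - u j) <= 2 * i.+1%:R^-1 + 2 * j.+1%:R^-1.
  have := para (x - u j) (x - u i).
  have -> : x - u j - (x - u i) = u i - u j by rewrite opprB addrC addrA subrK.
  have -> : x - u j + (x - u i) = 2%:C%C *: (x - 2^-1 *: (u i + u j)).
    rewrite two scalerBr scalerA mulfV ?pnatr_eq0// scale1r scaler_nat mulr2n.
    by rewrite addrACA -opprD [u j + _]addrC.
  rewrite NZ.
  have := dle (2^-1 *: (u i + u j)) (csubZ _ (csubD (uP i).1 (uP j).1)).
  have := (uP i).2; have := (uP j).2.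
  set a := i.+1%:R^-1; set b := j.+1%:R^-1.
  lra.
have [|l ul] := @seq_cauchy_cvg _ _ u.
  move=> e e0; have e4 : 0 < e / 4 by rewrite divr_gt0.
  have [k kP] := complex_archi e4; exists k => i j ki kj.
  have ck (j' : nat) : (k <= j')%N -> j'.+1%:R^-1 <= k.+1%:R^-1 :> R.
    by move=> ?; rewrite lef_pV2 ?posrE ?ltr0n// ler_nat.
  rewrite -NE; apply: (@le_lt_trans _ _ (4 * k.+1%:R^-1)).
    have -> : 4 * k.+1%:R^-1 = (4 * k.+1%:R^-1)%:C%C :> R[i].
      by rewrite realcM fmorphV !(rmorph_nat (real_complex R)).
    rewrite lecR; have := close i j; have := ck _ ki; have := ck _ kj.
    set a := i.+1%:R^-1; set b := j.+1%:R^-1; set c := k.+1%:R^-1; lra.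
  by rewrite mulrC -ltr_pdivlMr.
have Ml : csub_set M l.
  by apply: (closed_cvg (csub_set M) (@csub_closed _ _ M) _ _ ul); apply: nearW => k; case: (uP k).
exists l => // m Mm.
(* Moving [u k] by [t *: m] inside [M] lowers the squared distance by [|<v, m>|^2 / <m, m>];
   near-minimality bounds this gain by [1 / (k + 1)]. *)
have min k : `|'[x - u k, m]| ^+ 2 <= k.+1%:R^-1 * `|m| ^+ 2.
  have [->|m0] := eqVneq m 0.
    by rewrite hdot0r !normr0 expr0n mulr0.
  have mm0 := hdot_gt0 m0.
  set v := x - u k; set t := '[v, m] / '[m, m].
  have E := hdot_proj1 v m0; rewrite -/t in E.
  have lt : '[v, v] < '[v - t *: m, v - t *: m] + k.+1%:R^-1.
    have -> : k.+1%:R^-1 = (k.+1%:R^-1)%:C%C :> R[i].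
      by rewrite fmorphV (rmorph_nat (real_complex R)).
    rewrite -!NE -realcD ltcR; apply: (lt_le_trans (uP k).2).
    rewrite lerD2r; have := dle (u k + t *: m) (csubD (uP k).1 (csubZ _ Mm)).
    by rewrite opprD addrA.
  rewrite -hdot_norm -ler_pdivrMr//; move: lt; rewrite E => /ltW.
  by rewrite addrAC lerBrDr lerD2l.
apply/eqP; rewrite -normr_eq0; apply/eqP/complex_le_eps => // e e0.
have d0 : 0 < e / (2 * (`|m| + 1)) by rewrite divr_gt0// mulr_gt0// ltr_wpDl.
set dl := e / _ in d0.
have [k _ kP] := (proj1 (cvgrPdist_lt _ _) ul) _ d0.
have [k' k'P] := complex_archi (exprn_gt0 2 d0).
pose j := maxn k k'.
have -> : x - l = (x - u j) + (u j - l) by rewrite addrA subrK.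
have h1 : `|'[x - u j, m]| <= dl * `|m|.
  apply: ler_of_sqr => //; first exact: ltW.
  apply: (le_trans (min j)); rewrite ler_wpM2r ?exprn_ge0//.
  apply: le_trans (ltW k'P); rewrite lef_pV2 ?posrE ?ltr0n// ler_nat ltnS.
  exact: leq_maxr.
have h2 : `|'[u j - l, m]| <= dl * `|m|.
  apply: (le_trans (hdot_CS _ _)); rewrite ler_wpM2r// distrC ltW//.
  by apply: kP => /=; exact: leq_maxl.
rewrite hdotDl; apply: (le_trans (ler_normD _ _)); apply: (le_trans (lerD h1 h2)).
have c0 : 0 < `|m| + 1 by rewrite ltr_wpDl.
have e2 : e = dl * (`|m| + 1) * 2 by rewrite /dl; field; rewrite gt_eqF.
by rewrite -mulr2n -mulr_natr [leRHS]e2 ler_wpM2r// ler_wpM2l ?(ltW d0)// lerDl.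
Qed.

(** The residual of a projection onto [M] is orthogonal to [M]. Density claims below are reduced in
    this way to the vanishing of a vector orthogonal to all generators. *)
Lemma total_orthogonal H (M : csubspace H) :
  (forall z, (forall m, csub_set M m -> '[z, m] = 0) -> z = 0) -> forall x, csub_set M x.
Proof.
move=> M0 x; have [y My yP] := projection M x.
by have /eqP := M0 _ yP; rewrite subr_eq0 => /eqP ->.
Qed.

Lemma bop_eq_submod H K (A B : 'B(H, K)) : [set x | A x = B x] 0 /\
  forall (a : R[i]) x y, [set x | A x = B x] x -> [set x | A x = B x] y ->
    [set x | A x = B x] (a *: x + y).
Proof.
split=> [|a x y xk yk]; first by change (A 0 = B 0); rewrite !bop_zero.
change (A (a *: x + y) = B (a *: x + y)); rewrite !bop_linear.
by congr (_ *: _ + _); [exact: xk|exact: yk].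
Qed.

(** Packaged as a closed subspace because totality of elementary tensors and of basis vectors is
    stated through closed subspaces; an identity of operators then needs checking on generators
    only. *)
Definition bop_equalizer H K (A B : 'B(H, K)) : csubspace H :=
  CSubspace (bop_eq_submod A B) (@closed_bop_eq H K A B).

Lemma riesz H (A : 'B(H, cline R)) : exists y : H, forall x, A x = '[x, y].
Proof.
pose M := bop_equalizer A 0.
have [[x0 Ax0]|A0] := pselect (exists x, A x != 0); last first.
  exists 0 => x; rewrite hdot0r; apply/eqP; apply: contrapT => /negP Ax; apply: A0.
  by exists x.
have [p Mp pP] := projection M x0; set z := x0 - p in pP.
have Ap : A p = 0 by exact: Mp.
have Az : A z != 0 by rewrite /z bop_sub Ap subr0.
have z0 : z != 0 by apply: contraNneq Az => ->; rewrite bop_zero.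
have zz := lt0r_neq0 (hdot_gt0 z0).
pose a : R[i] := A z.
(* As [x - (A x / a) z] lies in the kernel [M], it is orthogonal to [z]: thus
   [<x, z> = (A x / a) <z, z>], which is solved for [A x]. *)
exists ((a^* / '[z, z]) *: z) => x.
have Mx : csub_set M (x - (A x / a : R[i]) *: z).
  apply/eqP; rewrite bop_sub bop_scale bop0 subr_eq0 /a; apply/eqP.
  by rewrite [RHS]divfK.
have := pP _ Mx; rewrite hdotC => /eqP; rewrite fmorph_eq0 hdotBl hdotZl subr_eq0 => /eqP xz.
rewrite hdotZr xz rmorphM /= conjCK fmorphV /= -hdotC.
by rewrite mulrACA [a * _]mulrC divfK// mulVf// mulr1.
Qed.

End Hilbert.

Section Operators.
Variable R : realType.
Implicit Types H K L : hilbertType R.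

Lemma bop_norm_le H K (A : 'B(H, K)) (M : R[i]) :
  0 <= M -> (forall x, `|A x| <= M * `|x|) -> `|A| <= M.
Proof.
move=> M0 AM; have ME : M = (complex.Re M)%:C%C by rewrite RRe_real ?ger0_real.
rewrite bop_norm ME lecR opnorm_le//; first by rewrite -ler0c -ME.
by move=> x; rewrite -ME.
Qed.

Lemma mkbop_ex H K (f : H -> K) (M : R[i]) : linear f -> 0 <= M ->
  (forall x, `|f x| <= M * `|x|) -> exists2 A : 'B(H, K), A =1 f & `|A| <= M.
Proof.
move=> fl M0 fM; have ME : M = (complex.Re M)%:C%C by rewrite RRe_real ?ger0_real.
have fM' x : `|f x| <= (complex.Re M)%:C%C * `|x| by rewrite -ME.
by exists (mkbop fl fM') => //; exact: bop_norm_le.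
Qed.

Lemma bop_dot_ext H K (A B : 'B(H, K)) :
  (forall x y, '[A x, y] = '[B x, y]) -> A = B.
Proof. by move=> AB; apply: bop_ext => x; exact: hdot_ext. Qed.

Lemma bop_norm_comp H K L (A : 'B(K, L)) (B : 'B(H, K)) : `|A \bo B| <= `|A| * `|B|.
Proof.
apply: bop_norm_le => [|x]; first by rewrite mulr_ge0.
by apply: (le_trans (bop_bounded A (B x))); rewrite -mulrA ler_wpM2l// bop_bounded.
Qed.

Lemma bop_comp_norm_le H K L (A : 'B(K, L)) (B : 'B(H, K)) (a b : R[i]) :
  `|A| <= a -> `|B| <= b -> `|A \bo B| <= a * b.
Proof. by move=> Aa Bb; apply: (le_trans (bop_norm_comp _ _)); rewrite ler_pM. Qed.

Lemma bopcompA H K L M (A : 'B(L, M)) (B : 'B(K, L)) (C : 'B(H, K)) :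
  A \bo (B \bo C) = A \bo B \bo C.
Proof. exact: bop_ext. Qed.

Lemma bopcomp1l H K (A : 'B(H, K)) : bopid K \bo A = A.
Proof. exact: bop_ext. Qed.

Lemma bopcomp1r H K (A : 'B(H, K)) : A \bo bopid H = A.
Proof. exact: bop_ext. Qed.

Lemma bopcompDl H K L (A B : 'B(K, L)) (C : 'B(H, K)) : (A + B) \bo C = A \bo C + B \bo C.
Proof. exact: bop_ext. Qed.

Lemma bopcompBl H K L (A B : 'B(K, L)) (C : 'B(H, K)) : (A - B) \bo C = A \bo C - B \bo C.
Proof. exact: bop_ext. Qed.

Lemma bopcompZl H K L a (A : 'B(K, L)) (C : 'B(H, K)) : (a *: A) \bo C = a *: (A \bo C).
Proof. exact: bop_ext. Qed.

Lemma bopcompDr H K L (A B : 'B(H, K)) (C : 'B(K, L)) : C \bo (A + B) = C \bo A + C \bo B.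
Proof. by apply: bop_ext => x; exact: bop_add. Qed.

Lemma bopcompBr H K L (A B : 'B(H, K)) (C : 'B(K, L)) : C \bo (A - B) = C \bo A - C \bo B.
Proof. by apply: bop_ext => x; exact: bop_sub. Qed.

Lemma bopcompZr H K L a (A : 'B(H, K)) (C : 'B(K, L)) : C \bo (a *: A) = a *: (C \bo A).
Proof. by apply: bop_ext => x; exact: bop_scale. Qed.

Lemma bop_sumE H K (I : Type) (s : seq I) (P : pred I) (F : I -> 'B(H, K)) x :
  (\sum_(i <- s | P i) F i) x = \sum_(i <- s | P i) F i x.
Proof. by apply: (big_morph (fun A : 'B(H, K) => A x)) => [A B|]; rewrite ?bopD ?bop0. Qed.

Lemma adj_exists H K (A : 'B(H, K)) :
  exists A' : 'B(K, H), forall x y, '[A x, y] = '[x, A' y].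
Proof.
have /choice[g gP] : forall y, exists z, forall x, '[A x, y] = '[x, z].
  by move=> y; have [z zP] := riesz (hfun y \bo A); exists z.
have gl : linear g.
  move=> a y z; apply: hdot_ext => x; rewrite hdotC -gP.
  by rewrite hdotDl hdotZl ![ '[g _, x] ]hdotC -!gP hdotDr hdotZr rmorphD rmorphM /= conjCK.
have gb y : `|g y| <= `|A| * `|y|.
  have [->|g0] := eqVneq (g y) 0; first by rewrite normr0 mulr_ge0.
  have gy0 : 0 < `|g y| by rewrite normr_gt0.
  rewrite -(ler_pM2l gy0) -expr2 -hdot_norm -gP -[leLHS]ger0_norm; last first.
    by rewrite gP hdot_norm exprn_ge0.
  apply: (le_trans (hdot_CS _ _)).
  rewrite mulrA ler_wpM2r// mulrC; exact: bop_bounded.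
have [A' A'g _] := mkbop_ex gl (normr_ge0 A) gb.
by exists A' => x y; rewrite A'g gP.
Qed.

Lemma adjP H K (A : 'B(H, K)) x y : '[A x, y] = '[x, adj A y].
Proof. exact: (getPex (adj_exists A)). Qed.

Lemma adjPr H K (A : 'B(H, K)) x y : '[adj A x, y] = '[x, A y].
Proof. by rewrite hdotC -adjP -hdotC. Qed.

Lemma adj_unique H K (A : 'B(H, K)) (B : 'B(K, H)) :
  (forall x y, '[A x, y] = '[x, B y]) -> adj A = B.
Proof.
move=> AB; apply: bop_dot_ext => x y.
by rewrite adjPr [RHS]hdotC -AB -hdotC.
Qed.

Lemma adjK H K (A : 'B(H, K)) : adj (adj A) = A.
Proof. by apply: adj_unique => x y; rewrite adjPr. Qed.

Lemma adj_comp H K L (A : 'B(K, L)) (B : 'B(H, K)) : adj (A \bo B) = adj B \bo adj A.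
Proof.
apply: adj_unique => x y; change ('[A (B x), y] = '[x, adj B (adj A y)]).
by rewrite !adjP.
Qed.

Lemma adj_id H : adj (bopid H) = bopid H.
Proof. exact: adj_unique. Qed.

Lemma adj0 H K : adj (0 : 'B(H, K)) = 0.
Proof. by apply: adj_unique => x y; rewrite !bop0 hdot0l hdot0r. Qed.

Lemma adjD H K (A B : 'B(H, K)) : adj (A + B) = adj A + adj B.
Proof. by apply: adj_unique => x y; rewrite !bopD hdotDl hdotDr !adjP. Qed.

Lemma adj_scale H K a (A : 'B(H, K)) : adj (a *: A) = a^* *: adj A.
Proof. by apply: adj_unique => x y; rewrite !bopZ hdotZl hdotZr adjP conjCK. Qed.

Lemma adjN H K (A : 'B(H, K)) : adj (- A) = - adj A.
Proof. by rewrite -scaleN1r adj_scale rmorphN1 scaleN1r. Qed.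

Lemma adj_norm_le H K (A : 'B(H, K)) : `|adj A| <= `|A|.
Proof.
apply: bop_norm_le => // y.
have [->|g0] := eqVneq (adj A y) 0; first by rewrite normr0 mulr_ge0.
have gy0 : 0 < `|adj A y| by rewrite normr_gt0.
rewrite -(ler_pM2l gy0) -expr2 -hdot_norm -adjP -[leLHS]ger0_norm; last first.
  by rewrite adjP hdot_norm exprn_ge0.
apply: (le_trans (hdot_CS _ _)).
rewrite mulrA ler_wpM2r// mulrC; exact: bop_bounded.
Qed.

Lemma adj_norm H K (A : 'B(H, K)) : `|adj A| = `|A|.
Proof. by apply/eqP; rewrite eq_le adj_norm_le -{1}[A]adjK adj_norm_le. Qed.

(** Polarization: [c <A x, y> + c^* <A y, x>] is a combination of diagonal values with real
    coefficients, hence real for every [c]; the cases [c = 1] and [c = i] together give the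
    symmetry. *)
Lemma op_ge0_selfadj H (A : 'B(H)) : op_ge0 A -> adj A = A.
Proof.
move=> A0; apply: adj_unique => x y; rewrite [RHS]hdotC.
have rl v : ('[A v, v])^* = '[A v, v] by apply/CrealP/ger0_real/A0.
have key (c : R[i]) : (c * '[A x, y])^* + (c^* * '[A y, x])^* = c * '[A x, y] + c^* * '[A y, x].
  have E : c * '[A x, y] + c^* * '[A y, x]
      = '[A (c *: x + y), c *: x + y] - `|c| ^+ 2 * '[A x, x] - '[A y, y].
    rewrite bop_add bop_scale hdotDl !hdotDr !hdotZl !hdotZr normCK; ring.
  have cc : (`|c| ^+ 2)^* = `|c| ^+ 2 by apply/CrealP; rewrite ger0_real ?exprn_ge0.
  by rewrite -rmorphD E !raddfB /= rmorphM /= !rl cc.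
have k1 := key 1; have ki := key 'i.
rewrite rmorph1 !mul1r in k1.
rewrite conjCi !rmorphM /= rmorphN /= conjCi opprK !mulNr in ki.
have {}ki : ('[A y, x])^* - ('[A x, y])^* = '[A x, y] - '[A y, x].
  have i0 : 'i != 0 :> R[i] by exact: neq0Ci.
  by apply: (mulfI i0); rewrite !mulrBr -ki addrC.
have two : ('[A y, x])^* * 2 = '[A x, y] * 2.
  rewrite (_ : _ * 2 = ('[A x, y])^* + ('[A y, x])^* + (('[A y, x])^* - ('[A x, y])^*)); last ring.
  by rewrite k1 ki; ring.
by apply/esym/(mulIf _ two); rewrite pnatr_eq0.
Qed.

Lemma selfadj_real H (A : 'B(H)) x : adj A = A -> '[A x, x] \is Num.real.
Proof. by move=> AA; apply/CrealP; rewrite -hdotC adjP AA. Qed.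

Lemma csub_proj_exists H (M : csubspace H) : exists P : 'B(H, csub M),
  forall x y, '[x - csub_incl M (P x), csub_incl M y] = 0.
Proof.
exists (adj (csub_incl M)) => x y.
have [p Mp pP] := projection M x.
have pM : p \in csub_pred M by apply/asboolP.
have -> : adj (csub_incl M) x = CSub pM.
  apply: hdot_ext => z; rewrite adjPr csub_dotE /=; apply/eqP; rewrite -subr_eq0 -hdotBl.
  by apply/eqP/pP/asboolP/csub_valP.
exact/pP/asboolP/csub_valP.
Qed.

Lemma csub_projP H (M : csubspace H) x y : '[x - csub_incl M (csub_proj M x), csub_incl M y] = 0.
Proof. exact: (getPex (csub_proj_exists M)). Qed.

Lemma csub_projE H (M : csubspace H) : csub_proj M = adj (csub_incl M).
Proof.
apply: bop_dot_ext => x y; rewrite adjPr; apply/esym/eqP; rewrite -subr_eq0.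
rewrite -[ '[csub_proj M x, y] ]/('[csub_incl M (csub_proj M x), csub_incl M y]).
by rewrite -hdotBl csub_projP.
Qed.

Lemma csub_incl_norm H (M : csubspace H) x : `|csub_incl M x| = `|x|.
Proof. by rewrite csub_normE. Qed.

Lemma csub_incl_inj H (M : csubspace H) : injective (csub_incl M).
Proof. by move=> x y /val_inj. Qed.

Lemma csub_inclP H (M : csubspace H) x : csub_set M (csub_incl M x).
Proof. exact/asboolP/csub_valP. Qed.

Lemma csub_projK H (M : csubspace H) x : csub_proj M (csub_incl M x) = x.
Proof. by apply: hdot_ext => y; rewrite csub_projE adjPr. Qed.

Lemma csub_proj_id H (M : csubspace H) x : csub_set M x -> csub_incl M (csub_proj M x) = x.
Proof.
move=> Mx; have xM : x \in csub_pred M by apply/asboolP.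
by rewrite -[x]/(csub_incl M (CSub xM)) csub_projK.
Qed.

Lemma compressionE H (M : csubspace H) (T : 'B(H)) :
  compression M T = adj (csub_incl M) \bo T \bo csub_incl M.
Proof. by rewrite /compression csub_projE. Qed.

Lemma adj_compression H (M : csubspace H) (T : 'B(H)) :
  adj (compression M T) = compression M (adj T).
Proof. by rewrite !compressionE !adj_comp adjK bopcompA. Qed.

End Operators.

(** * Completeness of B(H, K), square roots, extension from a total family *)

Section Completeness.
Variables (R : realType) (H K : hilbertType R).

Lemma bop_seq_complete (u : nat -> 'B(H, K)) :
  seq_cauchy Num.norm u -> exists l, seq_limit Num.norm u l.
Proof.
move=> uc.
have ptw x : exists l : K, (fun n => u n x) @ \oo --> l.
  apply: seq_cauchy_cvg => e e0.
  have d0 : 0 < sqrtC e / (`|x| + 1) by rewrite divr_gt0 ?sqrtC_gt0// ltr_wpDl.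
  have [k kP] := uc _ d0; exists k => m n km kn.
  rewrite -[e]sqrtCK -hdot_lt ?sqrtC_gt0// -bopB.
  apply: (le_lt_trans (bop_bounded _ _)).
  apply: (@le_lt_trans _ _ (`|u m - u n| * (`|x| + 1))).
    by rewrite ler_wpM2l// lerDl.
  by rewrite -ltr_pdivlMr ?ltr_wpDl//; exact: kP.
have /choice[f fP] := ptw.
have fl : linear f.
  move=> a x y; apply: (cvg_unique (@norm_hausdorff _ K) (fP _)).
  have -> : (fun n => u n (a *: x + y)) = (fun n => a *: u n x + u n y).
    by apply/funext => n; rewrite bop_linear.
  by apply: cvgD; [apply: cvgZr|].
(* The estimate is uniform in [x], so it gives the boundedness of [f] as well as convergence in
   norm. *)
have tail e : 0 < e -> exists k, forall n, (k <= n)%N -> forall x, `|u n x - f x| <= e * `|x|.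
  move=> e0; have [k kP] := uc _ e0; exists k => n kn x.
  apply/ler_addgt0Pr => d d0.
  have [j _ jP] := (proj1 (cvgrPdist_lt _ _) (fP x)) _ d0.
  pose m := maxn j k.
  have -> : u n x - f x = (u n x - u m x) - (f x - u m x) by rewrite opprB addrA subrK.
  apply: (le_trans (ler_normB _ _)); apply: lerD.
    rewrite -bopB; apply: (le_trans (bop_bounded _ _)).
    by rewrite ler_wpM2r// ltW// kP// leq_maxr.
  by apply/ltW/jP; exact: leq_maxl.
have [k kP] := tail 1 ltr01.
have fb x : `|f x| <= (`|u k| + 1) * `|x|.
  rewrite -[f x](subrK (u k x)) addrC mulrDl; apply: (le_trans (ler_normD _ _)).
  by rewrite lerD ?bop_bounded// distrC kP.
have [l lf _] := mkbop_ex fl (addr_ge0 (normr_ge0 _) ler01) fb.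
exists l => e e0; have e20 : 0 < e / 2 by rewrite divr_gt0.
have [j jP] := tail _ e20; exists j => n jn.
apply: (@le_lt_trans _ _ (e / 2)).
  by apply: bop_norm_le => [|x]; [exact: ltW|rewrite bopB lf jP].
by rewrite ltr_pdivrMr// ltr_pMr// ltr1n.
Qed.

HB.instance Definition _ :=
  Uniform_isComplete.Build 'B(H, K) (seq_complete bop_seq_complete).

End Completeness.

Section SquareRoot.
Variable R : realType.
Implicit Types H K L : hilbertType R.

Lemma closure_normP (V : normedModType R[i]) (S : set V) (x : V) :
  closure S x <-> forall e : R[i], 0 < e -> exists2 y, S y & `|x - y| < e.
Proof.
split=> [xS e e0|xS B].
  have [y [Sy]] := xS _ (nbhsx_ballx x e e0).
  by rewrite -ball_normE => xy; exists y.
rewrite -nbhs_ballE => -[e /= e0 eB].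
by have [y Sy xy] := xS e e0; exists y; split=> //; apply: eB; rewrite -ball_normE.
Qed.

Lemma pow_small (c e : R[i]) : 0 <= c -> c < 1 -> 0 < e -> exists k, c ^+ k < e.
Proof.
move=> c0 c1 e0.
have cE : c = (complex.Re c)%:C%C by rewrite RRe_real ?ger0_real.
have eE : e = (complex.Re e)%:C%C by rewrite RRe_real ?gtr0_real.
move: c0 c1 e0; rewrite cE eE; move: (complex.Re c) (complex.Re e) => {cE eE}c {}e.
rewrite ler0c !ltcR => c0 c1 e0.
have /cvgrPdist_lt/(_ _ e0)[k _ kP] : (fun n => c ^+ n) @ \oo --> 0.
  by apply: cvg_expr; rewrite ger0_norm.
exists k; have := kP k (leqnn k); rewrite sub0r normrN ger0_norm ?exprn_ge0//.
by rewrite -rmorphXn ltcR.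
Qed.

Lemma adj_cvg H K (T : Type) (F : set_system T) (FF : Filter F) (A : T -> 'B(H, K)) (l : 'B(H, K)) :
  A @ F --> l -> (fun t => adj (A t)) @ F --> adj l.
Proof.
move=> /cvgrPdist_lt Al; apply/cvgrPdist_lt => e /Al; apply: filterS => t.
by rewrite -adjN -adjD adj_norm.
Qed.

Lemma bopcomp_cvg H K L (T : Type) (F : set_system T) (FF : Filter F)
    (A : T -> 'B(K, L)) (B : T -> 'B(H, K)) a b :
  A @ F --> a -> B @ F --> b -> (fun t => A t \bo B t) @ F --> a \bo b.
Proof.
move=> /cvgrPdist_lt Aa /cvgrPdist_lt Bb; apply/cvgrPdist_lt => e e0.
have [c c0 cE] : exists2 c, 0 < c & c = `|a| + `|b| + 1.
  by eexists; [|reflexivity]; rewrite ltr_wpDl ?addr_ge0.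
have ce0 : 0 < c + e by rewrite addr_gt0.
have d0 : 0 < e / (c + e) by rewrite divr_gt0.
have d1 : e / (c + e) <= 1 by rewrite ler_pdivrMr// mul1r lerDr ltW.
have dc : e / (c + e) * c < e.
  by rewrite mulrAC ltr_pdivrMr// ltr_pM2l// ltrDl.
move: (e / _) d0 d1 dc => d d0 d1 dc.
near=> t.
have Ad : `|a - A t| < d by near: t; exact: Aa.
have Bd : `|b - B t| < d by near: t; exact: Bb.
have -> : a \bo b - A t \bo B t = (a - A t) \bo B t + a \bo (b - B t).
  by rewrite bopcompBl bopcompBr [RHS]addrC addrA subrK.
apply: (le_lt_trans (ler_normD _ _)); apply: le_lt_trans dc.
have Bt : `|B t| <= `|b| + 1.
  rewrite -[B t](subrK b) addrC; apply: (le_trans (ler_normD _ _)).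
  by rewrite lerD2l distrC (le_trans (ltW Bd)).
apply: (@le_trans _ _ (d * (`|b| + 1) + `|a| * d)).
  by apply: lerD; apply: bop_comp_norm_le => //; exact: ltW.
by rewrite cE (mulrC `|a|) -mulrDr addrC addrA.
Unshelve. all: by end_near.
Qed.

(* The fixed point of the contraction [Y |-> (B + Y^2) / 2] satisfies
   [(1 - Y)^2 = 1 - B]. *)
Lemma op_sqrt_exists H (B : 'B(H)) : adj B = B -> `|B| < 1 ->
  exists D : 'B(H), op_ge0 D /\ D \bo D = bopid H - B.
Proof.
move=> BB B1.
(* With this [s], [c = 1 - s] is the smaller root of [2 c = |B| + c^2]: the ball of radius [c] is
   mapped into itself by [g], and [c < 1] is also the Lipschitz constant of [g] there. *)
pose s : R[i] := sqrtC (1 - `|B|).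
have s0 : 0 < s by rewrite sqrtC_gt0 subr_gt0.
have s2 : s ^+ 2 = 1 - `|B| by rewrite sqrtCK.
have s1 : s <= 1.
  by rewrite -(@ler_pXn2r _ 2) ?nnegrE ?(ltW s0)// expr1n s2 gerDl oppr_le0.
pose c := 1 - s; have c0 : 0 <= c by rewrite subr_ge0.
have c1 : c < 1 by rewrite ltrBlDr ltrDl.
have cB : 2^-1 * (`|B| + c * c) = c.
  have -> : `|B| = 1 - s ^+ 2 by rewrite s2 opprB addrC subrK.
  by rewrite /c; field.
pose g (Y : 'B(H)) := 2^-1 *: (B + Y \bo Y).
pose Y k := iter k g 0.
have YS k : Y k.+1 = 2^-1 *: (B + Y k \bo Y k) by [].
have two : `|2^-1 : R[i]| = 2^-1 by rewrite ger0_norm// invr_ge0.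
have Yc k : `|Y k| <= c.
  elim: k => [|k ih]; first by rewrite normr0.
  rewrite YS normrZ two -cB ler_wpM2l ?invr_ge0//.
  by apply: (le_trans (ler_normD _ _)); rewrite lerD2l bop_comp_norm_le.
have Yadj k : adj (Y k) = Y k.
  elim: k => [|k ih]; first by rewrite adj0.
  rewrite YS adj_scale adjD BB adj_comp ih.
  by rewrite fmorphV rmorph_nat.
have contr A A' : `|A| <= c -> `|A'| <= c -> `|g A - g A'| <= c * `|A - A'|.
  move=> Ac A'c; rewrite /g -scalerBr normrZ two.
  have -> : B + A \bo A - (B + A' \bo A') = A \bo (A - A') + (A - A') \bo A'.
    by rewrite bopcompBr bopcompBl opprD addrACA subrr add0r addrA subrK.
  rewrite mulrC ler_pdivrMr//; apply: (le_trans (ler_normD _ _)).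
  rewrite mulr_natr mulr2n; apply: lerD; first exact: bop_comp_norm_le.
  by rewrite mulrC; exact: bop_comp_norm_le.
have gap k m n : `|Y (k + m)%N - Y (k + n)%N| <= c ^+ k * (2 * c).
  elim: k => [|k ih].
    rewrite mul1r; apply: (le_trans (ler_normB _ _)).
    by rewrite mulr_natl mulr2n lerD.
  rewrite !addSn; apply: (le_trans (contr _ _ (Yc _) (Yc _))).
  by rewrite exprS -mulrA ler_wpM2l.
have [|Z ZP] := @bop_seq_complete _ _ _ Y.
  move=> e e0; have e3 : 0 < e / 3 by rewrite divr_gt0.
  have [k kP] := pow_small c0 c1 e3.
  exists k => m n km kn; rewrite -(subnKC km) -(subnKC kn).
  apply: (le_lt_trans (gap _ _ _)).
  move: kP; rewrite ltr_pdivlMr//; apply: le_lt_trans.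
  rewrite ler_wpM2l ?exprn_ge0//; apply: (@le_trans _ _ 2); last by rewrite ler_nat.
  by rewrite ger_pMr// ltW.
have YZ : Y @ \oo --> Z.
  apply/cvgrPdist_lt => e /ZP[k kP]; exists k => // n /= /kP.
  by rewrite distrC.
have YZ1 : (fun k => Y k.+1) @ \oo --> Z by rewrite (cvg_shiftS Y).
have ZZ : Z = g Z.
  apply: (cvg_unique (@norm_hausdorff _ 'B(H)) YZ1); rewrite /g /Y /=.
  by apply: cvgZr; apply: cvgD; [exact: cvg_cst|exact: bopcomp_cvg].
have Zadj : adj Z = Z.
  apply: (cvg_unique (@norm_hausdorff _ 'B(H)) (adj_cvg _ YZ)).
  by rewrite (_ : (fun _ => _) = Y)//; apply/funext => k; exact: Yadj.
have Zc : `|Z| <= 1.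
  apply/ler_addgt0Pr => e /ZP[k /(_ k (leqnn k)) kP].
  rewrite -[Z](subrK (Y k)) addrC; apply: (le_trans (ler_normD _ _)); apply: lerD.
    exact: le_trans (Yc k) (ltW c1).
  by rewrite distrC ltW.
exists (bopid H - Z); split=> [x|].
  rewrite bopB hdotBl subr_ge0; apply: (le_trans (real_ler_norm _)).
    exact: selfadj_real.
  apply: (le_trans (hdot_CS _ _)); rewrite hdot_norm expr2 ler_wpM2r//.
  by apply: (le_trans (bop_bounded _ _)); rewrite ler_piMl.
have BE : B = Z + Z - Z \bo Z.
  apply/eqP; rewrite eq_sym subr_eq; apply/eqP.
  rewrite -mulr2n -scaler_nat {1}ZZ /g scalerA mulfV ?pnatr_eq0//.
  by rewrite scale1r.
rewrite bopcompBl !bopcompBr !bopcomp1l bopcomp1r BE.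
by rewrite !opprB opprD !addrA; congr (_ + _); rewrite addrAC.
Qed.

End SquareRoot.

Section Extension.
Variable R : realType.

(** The bound [d] is fixed before the space, so that one [d] serves both [W] and [W'] when a graph
    in [W x W'] is approximated. *)
Lemma lin_close (a e : R[i]) : 0 < e -> exists2 d : R[i], 0 < d &
  forall (V : normedModType R[i]) (u v u' v' : V),
  `|u - v| < d -> `|u' - v'| < d -> `|a *: u + u' - (a *: v + v')| < e.
Proof.
move=> e0; have a1 : 0 < `|a| + 1 by rewrite ltr_wpDl.
exists (e / (`|a| + 1)); first by rewrite divr_gt0.
move=> V u v u' v' uv u'v'; rewrite opprD addrACA -scalerBr.
have -> : e = `|a| * (e / (`|a| + 1)) + e / (`|a| + 1) by field; rewrite gt_eqF.
apply: (le_lt_trans (ler_normD _ _)); apply: ler_ltD => //.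
by rewrite normrZ ler_wpM2l// ltW.
Qed.

Lemma closure_submod (V : normedModType R[i]) (S : set V) :
  (S 0 /\ forall (a : R[i]) x y, S x -> S y -> S (a *: x + y)) ->
  closure S 0 /\ forall (a : R[i]) x y, closure S x -> closure S y -> closure S (a *: x + y).
Proof.
move=> [S0 SL]; split; first exact: subset_closure.
move=> a x y /closure_normP cx /closure_normP cy; apply/closure_normP => e e0.
have [d d0 dP] := lin_close a e0.
have [x' Sx xx'] := cx _ d0; have [y' Sy yy'] := cy _ d0.
by exists (a *: x' + y'); [exact: SL|exact: dP].
Qed.

(* [Z] is the closure of the graph of [sum c t |-> sum c s]. *)
Lemma bop_extension (W W' : hilbertType R) (I : Type) (t : I -> W) (s : I -> W') (M : R[i]) :
  0 <= M ->
  (forall N : csubspace W, (forall i, csub_set N (t i)) -> forall z, csub_set N z) ->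
  (forall l : seq (R[i] * I), `|\sum_(c <- l) c.1 *: s c.2| <= M * `|\sum_(c <- l) c.1 *: t c.2|) ->
  exists2 Z : 'B(W, W'), (forall i, Z (t i) = s i) & `|Z| <= M.
Proof.
move=> M0 total dom.
pose T (l : seq (R[i] * I)) := \sum_(c <- l) c.1 *: t c.2.
pose S (l : seq (R[i] * I)) := \sum_(c <- l) c.1 *: s c.2.
pose comb a (l l' : seq (R[i] * I)) := [seq (a * c.1, c.2) | c <- l] ++ l'.
have Tcomb a l l' : T (comb a l l') = a *: T l + T l'.
  rewrite /T big_cat big_map /= scaler_sumr; congr (_ + _).
  by apply: eq_bigr => c _; rewrite scalerA.
have Scomb a l l' : S (comb a l l') = a *: S l + S l'.
  rewrite /S big_cat big_map /= scaler_sumr; congr (_ + _).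
  by apply: eq_bigr => c _; rewrite scalerA.
pose rel w w' := forall e : R[i], 0 < e -> exists l, `|w - T l| < e /\ `|w' - S l| < e.
have rel_lin a x x' y y' : rel x x' -> rel y y' -> rel (a *: x + y) (a *: x' + y').
  move=> xx yy e e0; have [d d0 dP] := lin_close a e0.
  have [l [l1 l2]] := xx _ d0; have [l' [l1' l2']] := yy _ d0.
  by exists (comb a l l'); rewrite Tcomb Scomb; split; exact: dP.
have rel_bound w w' : rel w w' -> `|w'| <= M * `|w|.
  move=> ww; apply/ler_addgt0Pr => e e0.
  have d0 : 0 < e / (M + 1) by rewrite divr_gt0// ltr_wpDl.
  have [l [l1 l2]] := ww _ d0.
  have h1 : `|w'| <= `|S l| + e / (M + 1).
    by rewrite -{1}[w'](subrK (S l)) addrC (le_trans (ler_normD _ _))// lerD2l ltW.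
  have h2 : `|T l| <= `|w| + e / (M + 1).
    rewrite -{1}[T l](subrK w) addrC (le_trans (ler_normD _ _))// lerD2l ltW//.
    by rewrite distrC.
  apply: (le_trans h1); apply: (@le_trans _ _ (M * (`|w| + e / (M + 1)) + e / (M + 1))).
    by rewrite lerD2r; apply: (le_trans (dom l)); rewrite ler_wpM2l.
  have Mn : M + 1 != 0 by rewrite gt_eqF// ltr_wpDl.
  by rewrite (_ : _ + _ = M * `|w| + e)//; field.
have rel_ex w : exists w', rel w w'.
  have dense_T : forall e : R[i], 0 < e -> exists l, `|w - T l| < e.
    have TS : range T 0 /\ forall (a : R[i]) x y, range T x -> range T y -> range T (a *: x + y).
      split; first by exists [::]; rewrite // /T big_nil.
      by move=> a _ _ [l _ <-] [l' _ <-]; exists (comb a l l').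
    have /closure_normP wT : closure (range T) w.
      apply: (total (CSubspace (closure_submod TS) (@closed_closure _ _))) => i.
      apply: subset_closure; exists [:: (1, i)] => //.
      by rewrite /T big_seq1 scale1r.
    by move=> e e0; have [_ [l _ <-]] := wT e e0; exists l.
  have pos k : 0 < k.+1%:R^-1 :> R[i] by rewrite invr_gt0 ltr0n.
  have /choice[l lP] : forall k : nat, exists l, `|w - T l| < k.+1%:R^-1.
    by move=> k; exact: dense_T.
  have close m n : `|S (l m) - S (l n)| <= M * (m.+1%:R^-1 + n.+1%:R^-1).
    have -> : S (l m) - S (l n) = S (comb (-1) (l n) (l m)).
      by rewrite Scomb scaleN1r addrC.
    apply: (le_trans (dom _)); rewrite -/(T _) Tcomb scaleN1r ler_wpM2l//.
    have -> : - T (l n) + T (l m) = (w - T (l n)) - (w - T (l m)).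
      by rewrite opprB [RHS]addrC addrA subrK addrC.
    apply: (le_trans (ler_normB _ _)); rewrite addrC.
    by apply: lerD; exact/ltW/lP.
  have anti (k m : nat) : (k <= m)%N -> m.+1%:R^-1 <= k.+1%:R^-1 :> R[i].
    by move=> km; rewrite lef_pV2 ?posrE ?ltr0n// ler_nat.
  have [|w' Sw] := @seq_cauchy_cvg _ _ (fun k => S (l k)).
    move=> e e0.
    have d0 : 0 < sqrtC e / (2 * (M + 1)).
      by rewrite divr_gt0 ?sqrtC_gt0// mulr_gt0// ltr_wpDl.
    have [k kP] := complex_archi d0; exists k => m n km kn.
    rewrite -[e]sqrtCK -hdot_lt ?sqrtC_gt0//; apply: (le_lt_trans (close m n)).
    apply: (@le_lt_trans _ _ ((M + 1) * (2 * k.+1%:R^-1))).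
      apply: ler_pM => //; first by rewrite addr_ge0 ?(ltW (pos _)).
        by rewrite lerDl.
      by rewrite mulr_natl mulr2n lerD// anti.
    by rewrite mulrCA mulrA -ltr_pdivlMl ?mulr_gt0 ?ltr_wpDl// mulrC.
  exists w' => e e0.
  have [k kP] := complex_archi e0.
  have [j _ jP] := (proj1 (cvgrPdist_lt _ _) Sw) _ e0.
  exists (l (maxn k j)); split; last by apply: jP => /=; exact: leq_maxr.
  by apply: (lt_trans (lP _)); apply: le_lt_trans kP; apply: anti; exact: leq_maxl.
(* The difference of two values is related to [0], and [rel_bound] forces it to vanish. *)
have rel_uniq w w1 w2 : rel w w1 -> rel w w2 -> w1 = w2.
  move=> r1 r2; have := rel_bound _ _ (rel_lin (-1) _ _ _ _ r2 r1).
  rewrite !scaleN1r addNr normr0 mulr0 normr_le0 addrC subr_eq0.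
  by move=> /eqP.
have /choice[f fP] := rel_ex.
have fl : linear f.
  move=> a x y; apply: (rel_uniq (a *: x + y)); first exact: fP.
  by apply: rel_lin; exact: fP.
have [Z Zf ZM] := mkbop_ex fl M0 (fun x => rel_bound _ _ (fP x)).
exists Z => // i; rewrite Zf; apply: (rel_uniq (t i)); first exact: fP.
by move=> e e0; exists [:: (1, i)]; rewrite /T /S !big_seq1 /= !scale1r !subrr !normr0.
Qed.

End Extension.

(** * Tensor products *)

Section Tensor.
Variable R : realType.
Implicit Types G H L : hilbertType R.

Lemma tmulDl G H (W : htensor G H) x x' y : tmul W (x + x') y = tmul W x y + tmul W x' y.
Proof. by have := tmul_linearl W y 1 x x'; rewrite !scale1r. Qed.

Lemma tmulDr G H (W : htensor G H) x y y' : tmul W x (y + y') = tmul W x y + tmul W x y'.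
Proof. by have := tmul_linearr W x 1 y y'; rewrite !scale1r. Qed.

Lemma tmul0l G H (W : htensor G H) y : tmul W 0 y = 0.
Proof. by apply: (addrI (tmul W 0 y)); rewrite -tmulDl !addr0. Qed.

Lemma tmul0r G H (W : htensor G H) x : tmul W x 0 = 0.
Proof. by apply: (addrI (tmul W x 0)); rewrite -tmulDr !addr0. Qed.

Lemma tmul_norm G H (W : htensor G H) x y : `|tmul W x y| = `|x| * `|y|.
Proof.
apply: (@pexpIrn _ 2); rewrite ?nnegrE ?mulr_ge0//.
by rewrite -hdot_norm tmul_dot !hdot_norm exprMn.
Qed.

Lemma tmul_left_ex G H (W : htensor G H) (y : H) :
  exists A : 'B(G, W), forall x, A x = tmul W x y.
Proof.
have [//||A AE _] := @mkbop_ex _ _ _ (tmul W ^~ y) `|y| (tmul_linearl W y).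
  by move=> x; rewrite tmul_norm mulrC.
by exists A.
Qed.

Lemma tensor_bop_ext G H L (W : htensor G H) (Z Z' : 'B(W, L)) :
  (forall x y, Z (tmul W x y) = Z' (tmul W x y)) -> Z = Z'.
Proof. by move=> ZZ; apply: bop_ext => z; exact: (@tmul_total _ _ _ W (bop_equalizer Z Z')). Qed.

Lemma tensor_dot0 G H (W : htensor G H) (z : W) :
  (forall x y, '[z, tmul W x y] = 0) -> z = 0.
Proof.
move=> z0; have /(_ z erefl) : csub_set (orthocompl [set z]) z.
  by apply: tmul_total => x y w ->; rewrite hdotC z0 rmorph0.
by move=> /eqP; rewrite hdot_norm expf_eq0 /= normr_eq0 => /eqP.
Qed.

Let lsum G H (W : htensor G H) (l : seq (R[i] * (G * H))) (f : G -> G) : W :=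
  \sum_(c <- l) c.1 *: tmul W (f c.2.1) c.2.2.

Let lsum_norm2 G H (W : htensor G H) l (f : G -> G) :
  `|lsum W l f| ^+ 2 = \sum_(c <- l) \sum_(d <- l)
    c.1 * (d.1^* * ('[f c.2.1, f d.2.1] * '[c.2.2, d.2.2])).
Proof.
rewrite -hdot_norm hdot_suml; apply: eq_bigr => c _; rewrite hdot_sumr.
by apply: eq_bigr => d _; rewrite hdotZl hdotZr tmul_dot.
Qed.

(* If [c > |A|^2] then [c - A^* A = c D^2] with [D] self-adjoint, so that
   [c |sum x_k (x) y_k|^2 - |sum A x_k (x) y_k|^2 = c |sum D x_k (x) y_k|^2]. *)
Let lsum_dom G H (W : htensor G H) (A : 'B(G)) l : `|lsum W l A| <= `|A| * `|lsum W l id|.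
Proof.
have dom (c : R[i]) : `|A| ^+ 2 < c -> `|lsum W l A| ^+ 2 <= c * `|lsum W l id| ^+ 2.
  move=> Ac; have c0 : 0 < c by apply: le_lt_trans Ac; rewrite exprn_ge0.
  have cR : c^-1^* = c^-1 by apply/CrealP; rewrite realV gtr0_real.
  have [||D [D0 DD]] := @op_sqrt_exists _ _ (c^-1 *: (adj A \bo A)).
  - by rewrite adj_scale adj_comp adjK; congr (_ *: _); exact: cR.
  - rewrite normrZ gtr0_norm ?invr_gt0// mulrC ltr_pdivrMr// mul1r.
    by apply: le_lt_trans Ac; rewrite expr2 bop_comp_norm_le// adj_norm.
  have Dx x x' : '[A x, A x'] = c * ('[x, x'] - '[D x, D x']).
    rewrite -[D in RHS](op_ge0_selfadj D0) adjPr (op_ge0_selfadj D0).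
    rewrite -[D (D x')]/((D \bo D) x') DD bopB bopZ hdotBr opprB addrC subrK hdotZr cR.
    by rewrite mulrA mulfV ?gt_eqF// mul1r -adjP.
  have : 0 <= c * `|lsum W l D| ^+ 2 by rewrite mulr_ge0 ?exprn_ge0// ltW.
  suff -> : c * `|lsum W l D| ^+ 2 = c * `|lsum W l id| ^+ 2 - `|lsum W l A| ^+ 2.
    by rewrite subr_ge0.
  rewrite !lsum_norm2 !mulr_sumr -sumrB; apply: eq_bigr => u _.
  rewrite !mulr_sumr -sumrB; apply: eq_bigr => v _; rewrite Dx; ring.
(* The square root asks for [c > |A|^2] strictly. The excess [e / (t + 1)] contributes at most [e]
   after multiplication by [t]. *)
apply: ler_of_sqr => //; apply/ler_addgt0Pr => e e0.
have t0 : 0 < `|lsum W l id| ^+ 2 + 1 by rewrite ltr_wpDl ?exprn_ge0.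
set t := `|lsum W l id| ^+ 2 in t0 *.
have /dom/le_trans-> // : `|A| ^+ 2 < `|A| ^+ 2 + e / (t + 1) by rewrite ltrDl divr_gt0.
rewrite mulrDl lerD2l mulrAC ler_pdivrMr// ler_pM2l// lerDl //.
Qed.

Lemma tensor_ex G H (W : htensor G H) (A : 'B(G)) :
  exists2 Z : 'B(W), forall x y, Z (tmul W x y) = tmul W (A x) y & `|Z| <= `|A|.
Proof.
have [||Z ZP Zn] := @bop_extension R W W (G * H)%type
  (fun c => tmul W c.1 c.2) (fun c => tmul W (A c.1) c.2) `|A| (normr_ge0 A).
- by move=> N Nt z; apply: tmul_total => x y; exact: (Nt (x, y)).
- exact: lsum_dom.
by exists Z => // x y; exact: (ZP (x, y)).
Qed.

Lemma tensopE G H (W : htensor G H) (A : 'B(G)) x y :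
  tensop W A (bopid H) (tmul W x y) = tmul W (A x) y.
Proof.
apply: (getPex (_ : exists Z : 'B(W), forall x y, Z (tmul W x y) = _)).
by have [Z] := tensor_ex W A; exists Z.
Qed.

Lemma tensop_norm G H (W : htensor G H) (A : 'B(G)) : `|tensop W A (bopid H)| <= `|A|.
Proof.
have [Z ZP Zn] := tensor_ex W A.
suff -> : tensop W A (bopid H) = Z by [].
by apply: tensor_bop_ext => x y; rewrite tensopE ZP.
Qed.

Lemma tensop_comp G H (W : htensor G H) (A B : 'B(G)) :
  tensop W (A \bo B) (bopid H) = tensop W A (bopid H) \bo tensop W B (bopid H).
Proof.
apply: tensor_bop_ext => x y; rewrite tensopE.
by rewrite -[RHS]/(tensop W A (bopid H) (tensop W B (bopid H) (tmul W x y))) !tensopE.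
Qed.

Lemma tensop_linear G H (W : htensor G H) a (A B : 'B(G)) :
  tensop W (a *: A + B) (bopid H) = a *: tensop W A (bopid H) + tensop W B (bopid H).
Proof.
apply: tensor_bop_ext => x y; rewrite bopD bopZ !tensopE bopD bopZ.
exact: tmul_linearl.
Qed.

Lemma tensop_id G H (W : htensor G H) : tensop W (bopid G) (bopid H) = bopid W.
Proof. by apply: tensor_bop_ext => x y; rewrite tensopE. Qed.

Lemma tensop_adj G H (W : htensor G H) (A : 'B(G)) :
  adj (tensop W A (bopid H)) = tensop W (adj A) (bopid H).
Proof.
apply: tensor_bop_ext => x y; rewrite tensopE; apply/eqP; rewrite -subr_eq0; apply/eqP.
apply: (tensor_dot0 (W := W)) => x' y'.
by rewrite hdotBl adjPr tensopE !tmul_dot adjPr subrr.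
Qed.

End Tensor.

Section Flip.
Variables (R : realType) (G H : hilbertType R) (W : htensor G H).

Let flip_dot (y : H) (x : G) (y' : H) (x' : G) :
  '[tmul W x y, tmul W x' y'] = '[y, y'] * '[x, x'].
Proof. by rewrite tmul_dot mulrC. Qed.

Let flip_total (M : csubspace W) :
  (forall y x, csub_set M (tmul W x y)) -> forall z, csub_set M z.
Proof. by move=> Mt; apply: tmul_total => x y; exact: Mt. Qed.

(** The same space with the factors exchanged: results about operators or slices in one factor
    become available in the other. *)
Definition tensor_flip : htensor H G :=
  @HTensor R H G W (fun y x => tmul W x y)
    (tmul_linearr W) (tmul_linearl W) flip_dot flip_total.

End Flip.

(** * Hilbert sums and matrices of operators *)

Section HilbertSums.
Variables (R : realType) (I : countType).
Implicit Types H K L : hilbertType R.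

(** The partial sums along the enumeration are constant once it has covered [s], so the real and
    imaginary limits in [climn] are those of a constant. *)
Lemma hsum_dot_finsupp H (s : seq I) (f g : hsum I H) : uniq s ->
  (forall i, i \notin s -> '[f i, g i] = 0) ->
  '[f, g] = \sum_(i <- s) '[f i, g i].
Proof.
move=> us fg0.
have ev : \forall n \near \oo, hsum_dot_upto f g n = \sum_(i <- s) '[f i, g i].
  exists (\max_(i <- s) (choice.pickle i)).+1 => // n /= sn.
  rewrite /hsum_dot_upto (bigID (mem s)) /= addrC big1 ?add0r => [|i /fg0//].
  rewrite -big_filter; apply: perm_big; apply: uniq_perm => // [|i].
    exact/filter_uniq/enum_upto_uniq.
  rewrite mem_filter /= mem_enum_upto.
  case: (boolP (i \in s)) => //= si; apply: leq_trans sn; rewrite ltnS.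
  exact: leq_bigmax_seq.
change (climn (hsum_dot_upto f g) = \sum_(i <- s) '[f i, g i]).
rewrite /climn; set l := \sum_(i <- s) _ in ev *.
have lim_const (h : R[i] -> R) : limn (fun n => h (hsum_dot_upto f g n)) = h l.
  apply: cvg_lim => //; apply: cvg_near_cst.
  by apply: filterS ev => n ->.
by rewrite !lim_const; case: l {ev lim_const}.
Qed.

Lemma hsum_coord_le H (f : hsum I H) i : `|f i| <= `|f|.
Proof.
rewrite -(@ler_pXn2r _ 2) ?nnegrE ?normr_ge0//.
by have := @hsum_bounded _ _ _ f [:: i] isT; rewrite big_seq1.
Qed.

Let coord_linear H i : linear (fun f : hsum I H => f i).
Proof. by move=> a f g. Qed.

Let coord_bound H i (f : hsum I H) : `|f i| <= 1%:C%C * `|f|.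
Proof. by rewrite mul1r hsum_coord_le. Qed.

Definition hcoord H i : 'B(hsum I H, H) := mkbop (@coord_linear H i) (@coord_bound H i).

Definition delta_fun H i (h : H) (j : I) : H := if j == i then h else 0.

Let delta_bounded H i (h : H) : sq_bounded (`|h| ^+ 2) (delta_fun i h).
Proof.
move=> s us; have [si|si] := boolP (i \in s).
  rewrite (bigD1_seq i)//= /delta_fun eqxx big1 ?addr0// => j /negbTE ->.
  by rewrite normr0 expr0n.
rewrite big1_seq ?exprn_ge0// => j /= js; rewrite /delta_fun.
case: eqP => [ji|_]; last by rewrite normr0 expr0n.
by rewrite -ji js in si.
Qed.

Definition hdelta H i (h : H) : hsum I H := mkhsum (delta_bounded i h).

Lemma hdeltaE H i (h : H) j : hdelta i h j = if j == i then h else 0.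
Proof. by []. Qed.

Lemma hdot_delta H i (h : H) (f : hsum I H) : '[f, hdelta i h] = '[f i, h].
Proof.
rewrite (@hsum_dot_finsupp _ [:: i])//; first by rewrite big_seq1 hdeltaE eqxx.
by move=> j; rewrite inE hdeltaE => /negbTE ->; rewrite hdot0r.
Qed.

End HilbertSums.

Lemma sum_cvg (R : realType) (V : normedModType R[i]) (I T : Type) (F : set_system T)
    (FF : Filter F) (s : seq I) (f : I -> T -> V) (l : I -> V) :
  (forall i, f i @ F --> l i) -> (fun t => \sum_(i <- s) f i t) @ F --> \sum_(i <- s) l i.
Proof.
move=> fl; elim: s => [|i s ih].
  rewrite big_nil (_ : (fun _ => _) = cst 0); first exact: cvg_cst.
  by apply/funext => t; rewrite big_nil.
rewrite big_cons (_ : (fun _ => _) = fun t => f i t + \sum_(j <- s) f j t).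
  exact: cvgD (fl i) ih.
by apply/funext => t; rewrite big_cons.
Qed.

Section FiniteSums.
Variables (R : realType) (p : nat).
Implicit Types H K L : hilbertType R.

Lemma hsum_dot_ord H (f g : hsum 'I_p H) : '[f, g] = \sum_i '[f i, g i].
Proof.
apply: hsum_dot_finsupp; first exact: index_enum_uniq.
by move=> i; rewrite mem_index_enum.
Qed.

Let ord_bounded H (f : 'I_p -> H) : sq_bounded (\sum_i `|f i| ^+ 2) f.
Proof.
move=> s us; apply: sum_subseq_le => //.
- by move=> i; rewrite exprn_ge0.
- exact: index_enum_uniq.
- by move=> i _; rewrite mem_index_enum.
Qed.

Definition hsum_ord H (f : 'I_p -> H) : hsum 'I_p H := mkhsum (ord_bounded f).

Definition adjmx H K (X : 'M['B(H, K)]_p) : 'M['B(K, H)]_p := \matrix_(i, j) adj (X j i).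

Lemma adj_mxop H K (X : 'M['B(H, K)]_p) : adj (mxop X) = mxop (adjmx X).
Proof.
apply: adj_unique => f g; rewrite !hsum_dot_ord.
under eq_bigr => i _ do rewrite mxopE hdot_suml.
under [RHS]eq_bigr => i _ do rewrite mxopE hdot_sumr.
rewrite exchange_big /=; apply: eq_bigr => i _; apply: eq_bigr => j _.
by rewrite adjP mxE.
Qed.

(** A finite sum of products in which each entry occurs once: entrywise norm convergence of matrices
    therefore implies norm convergence of the operators. *)
Lemma mxop_coord H K (X : 'M['B(H, K)]_p) :
  mxop X = \sum_i \sum_j adj (hcoord K i) \bo X i j \bo hcoord H j.
Proof.
apply: bop_dot_ext => f g; rewrite hsum_dot_ord bop_sumE hdot_suml.
apply: eq_bigr => i _; rewrite mxopE bop_sumE !hdot_suml; apply: eq_bigr => j _.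
by rewrite -[(_ \bo _ \bo _) f]/(adj (hcoord K i) (X i j (hcoord H j f))) adjPr.
Qed.

Lemma mxop_cvg H K (T : Type) (F : set_system T) (FF : Filter F)
    (X : T -> 'M['B(H, K)]_p) (Y : 'M['B(H, K)]_p) :
  (forall i j, (fun t => X t i j) @ F --> Y i j) -> (fun t => mxop (X t)) @ F --> mxop Y.
Proof.
move=> XY; rewrite mxop_coord.
rewrite (_ : (fun t => _) = fun t =>
  \sum_i \sum_j adj (hcoord K i) \bo X t i j \bo hcoord H j); last first.
  by apply/funext => t; rewrite mxop_coord.
apply: sum_cvg => i; apply: sum_cvg => j.
apply: bopcomp_cvg; last exact: cvg_cst.
by apply: bopcomp_cvg; [exact: cvg_cst|exact: XY].
Qed.

Definition ampl H K (A : 'B(H, K)) : 'B(hsum 'I_p H, hsum 'I_p K) :=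
  mxop (\matrix_(i, j) if i == j then A else 0).

Lemma amplE H K (A : 'B(H, K)) f i : ampl A f i = A (f i).
Proof.
rewrite mxopE (bigD1 i)//= mxE eqxx big1 ?addr0// => j ji.
by rewrite mxE eq_sym (negbTE ji) bop0.
Qed.

Lemma adj_ampl H K (A : 'B(H, K)) : adj (ampl A) = ampl (adj A).
Proof.
rewrite adj_mxop; congr mxop; apply/matrixP => i j; rewrite !mxE eq_sym.
by case: eqP => // _; exact: adj0.
Qed.

Lemma mxop_ampl H K (A : 'B(H, K)) (X : 'M['B(K)]_p) :
  mxop (map_mx (fun Y => adj A \bo Y \bo A) X) = adj (ampl A) \bo mxop X \bo ampl A.
Proof.
apply: bop_ext => f; apply: hsum_ext => i.
rewrite -[RHS]/(adj (ampl A) (mxop X (ampl A f)) i) adj_ampl amplE !mxopE bop_sum.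
by apply: eq_bigr => j _; rewrite amplE mxE.
Qed.

Lemma ampl_isometry H K (A : 'B(H, K)) :
  adj A \bo A = bopid H -> adj (ampl A) \bo ampl A = bopid _.
Proof.
move=> AA; rewrite adj_ampl; apply: bop_ext => f; apply: hsum_ext => i.
rewrite -[LHS]/(ampl (adj A) (ampl A f) i) !amplE.
by rewrite -[LHS]/((adj A \bo A) (f i)) AA.
Qed.

Section TensorSum.
Variables (G H : hilbertType R) (W : htensor G H).

Let stm (h : H) (f : hsum 'I_p G) : hsum 'I_p W := hsum_ord (fun i => tmul W (f i) h).

Let stm_linearl f : linear (stm ^~ f).
Proof. by move=> a h h'; apply: hsum_ext => i; exact: tmul_linearr. Qed.

Let stm_linearr h : linear (stm h).
Proof. by move=> a f f'; apply: hsum_ext => i; exact: tmul_linearl. Qed.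

Let stm_dot h f h' f' : '[stm h f, stm h' f'] = '[h, h'] * '[f, f'].
Proof.
rewrite !hsum_dot_ord mulr_sumr; apply: eq_bigr => i _.
by rewrite tmul_dot mulrC.
Qed.

Let stm_total (M : csubspace (hsum 'I_p W)) :
  (forall h f, csub_set M (stm h f)) -> forall z, csub_set M z.
Proof.
move=> Mt; apply: total_orthogonal => z zM; apply: hsum_ext => i.
apply: (tensor_dot0 (W := W)) => x y.
rewrite -(zM _ (Mt y (hdelta i x))) -hdot_delta; congr '[_, _].
apply: hsum_ext => j; rewrite [RHS]/(tmul W (hdelta i x j) y) !hdeltaE.
by case: eqP => // _; exact: (esym (tmul0l W y)).
Qed.

(* H (x) G^(p), realized on (G (x) H)^(p): ampliation invariance of a radius has
   its identity factor on the left, the Poisson transform has it on the right. *)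
Definition tensor_sum : htensor H (hsum 'I_p G) :=
  HTensor stm_linearl stm_linearr stm_dot stm_total.

Lemma mxop_tensorE (X : 'M['B(G)]_p) x y :
  mxop (map_mx (fun Y => tensop W Y (bopid H)) X) (tmul tensor_sum x y)
  = tmul tensor_sum x (mxop X y).
Proof.
apply: hsum_ext => i; rewrite mxopE.
transitivity (tmul W (mxop X y i) x); last by [].
rewrite mxopE; transitivity (\sum_j tmul W (X i j (y j)) x).
  by apply: eq_bigr => j _; rewrite mxE tensopE.
by rewrite (big_morph (tmul W ^~ x) (fun u v => tmulDl W u v x) (tmul0l W x)).
Qed.

Lemma tensop_sum (X : 'M['B(G)]_p) :
  tensop tensor_sum (bopid H) (mxop X)
  = mxop (map_mx (fun Y => tensop W Y (bopid H)) X).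
Proof.
set Z := mxop (map_mx _ X).
apply: tensor_bop_ext => x y; rewrite mxop_tensorE.
apply: (getPex (_ : exists Z : 'B(tensor_sum), forall x y,
  Z (tmul tensor_sum x y) = tmul tensor_sum (bopid H x) (mxop X y))).
by exists Z => ? ?; exact: mxop_tensorE.
Qed.

(** In the flipped realization [G^(p) (x) H] the matrix of ampliations is the single operator
    [mxop X (x) 1], so the bound [tensop_norm] already gives the matrix case with no loss depending
    on [p]. *)
Lemma mxop_tensop_norm (X : 'M['B(G)]_p) :
  `|mxop (map_mx (fun Y => tensop W Y (bopid H)) X)| <= `|mxop X|.
Proof.
have := tensop_norm (tensor_flip tensor_sum) (mxop X).
set Z := mxop (map_mx _ X); set Z' := tensop _ (mxop X) _.
suff -> : Z' = Z :> 'B(tensor_sum) by [].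
apply: tensor_bop_ext => x y; rewrite mxop_tensorE.
exact: (tensopE (tensor_flip tensor_sum)).
Qed.

End TensorSum.
End FiniteSums.

(** * Separability and joint operator radii *)

Section Separability.
Variable R : realType.
Implicit Types H K : hilbertType R.

Lemma image_countable (T U : Type) (f : T -> U) (A : set T) : countable A -> countable (f @` A).
Proof. exact/sub_countable/card_image_le. Qed.

Lemma range_countable (T : countType) (U : Type) (f : T -> U) : countable (range f).
Proof. by apply: image_countable; exact: countableP. Qed.

Lemma dense_normP H (D : set H) :
  dense D <-> forall (x : H) (e : R[i]), 0 < e -> exists2 y, D y & `|x - y| < e.
Proof.
split=> [dD x e e0|DP O [x Ox] oO].
  have [|y [xy Dy]] := dD (ball x e) _ (ball_open _ _); first by exists x; exact: ballxx.
  by exists y => //; move: xy; rewrite -ball_normE.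
have : nbhs x O by apply: open_nbhs_nbhs.
rewrite -nbhs_ballE => -[e /= e0 eO]; have [y Dy xy] := DP x e e0.
by exists y; split=> //; apply: eO; rewrite -ball_normE.
Qed.

Lemma bop_dense_ext H K (A B : 'B(H, K)) (D : set H) :
  dense D -> (forall x, D x -> A x = B x) -> A = B.
Proof.
move=> /dense_normP dD AB; apply: bop_ext => x.
apply: (@closed_bop_eq _ _ _ A B); apply/closure_normP => e e0.
by have [y Dy xy] := dD x e e0; exists y => //; exact: AB.
Qed.

Lemma dot_dense_eq0 H (D : set H) (z : H) :
  dense D -> (forall x, D x -> '[z, x] = 0) -> z = 0.
Proof.
move=> dD z0; have E : hfun z = 0.
  by apply: (bop_dense_ext dD) => x /z0 zx; rewrite -[LHS]/('[x, z] : R[i]) hdotC zx rmorph0.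
by apply: hdot_ext => x; rewrite hdot0l hdotC -[ '[x, z] ]/(hfun z x) E rmorph0.
Qed.

Lemma complex_rat_dense (c : R[i]) (e : R[i]) : 0 < e ->
  exists q : rat * rat, `|c - ((ratr q.1)%:C%C + 'i%C * (ratr q.2)%:C%C)| < e.
Proof.
move=> e0; have eE : e = (complex.Re e)%:C%C by rewrite RRe_real ?gtr0_real.
move: e0; rewrite eE; move: (complex.Re e) => {eE}r; rewrite ltcR => r0.
have near_rat (x : R) : exists q : rat, `|x - ratr q| < r / 2.
  have [|q] := @rat_in_itvoo R (x - r / 2) (x + r / 2).
    by rewrite ltrD2l gtrN// divr_gt0.
  rewrite in_itv /= => qx; exists q; rewrite distrC ltr_distl; exact: qx.
have [q1 q1P] := near_rat (complex.Re c); have [q2 q2P] := near_rat (complex.Im c).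
exists (q1, q2) => /=; rewrite {1}[c]complexE.
have -> : (complex.Re c)%:C%C + 'i%C * (complex.Im c)%:C%C
    - ((ratr q1)%:C%C + 'i%C * (ratr q2)%:C%C)
    = (complex.Re c - ratr q1)%:C%C + 'i%C * (complex.Im c - ratr q2)%:C%C.
  by rewrite !rmorphB mulrBr opprD addrACA.
apply: (le_lt_trans (ler_normD _ _)); rewrite normrM.
have -> : `|'i%C : R[i]| = 1 by exact: (@normCi R[i]).
rewrite mul1r !normc_def /= !expr0n /= !addr0 !sqrtr_sqr -realcD ltcR [r]splitr.
exact: ltrD.
Qed.

Definition separable H := exists2 D : set H, countable D & dense D.

(* The combinations with coefficients in [Q[i]] of a total family are dense. *)
Lemma separable_total H (J : countType) (t : J -> H) :
  (forall z, (forall j, '[z, t j] = 0) -> z = 0) -> separable H.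
Proof.
move=> t0.
pose qc (q : rat * rat) : R[i] := (ratr q.1)%:C%C + 'i%C * (ratr q.2)%:C%C.
pose Q (l : seq (rat * rat * J)) := \sum_(c <- l) qc c.1 *: t c.2.
pose T (l : seq (R[i] * J)) := \sum_(c <- l) c.1 *: t c.2.
have TS : range T 0 /\ forall (a : R[i]) x y, range T x -> range T y -> range T (a *: x + y).
  split; first by exists [::]; rewrite // /T big_nil.
  move=> a _ _ [l _ <-] [l' _ <-]; exists ([seq (a * c.1, c.2) | c <- l] ++ l') => //.
  rewrite /T big_cat big_map /= scaler_sumr; congr (_ + _).
  by apply: eq_bigr => c _; rewrite scalerA.
have approx l : forall e : R[i], 0 < e -> exists l', `|T l - Q l'| < e.
  elim: l => [|[c j] l ih] e e0.
    by exists [::]; rewrite /T /Q !big_nil subrr normr0.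
  have e20 : 0 < e / 2 by rewrite divr_gt0.
  have [l' l'P] := ih _ e20.
  have d0 : 0 < e / 2 / (`|t j| + 1) by rewrite divr_gt0// ltr_wpDl.
  have [q qP] := complex_rat_dense c d0.
  exists ((q, j) :: l'); rewrite /T /Q !big_cons /= -/(T l) -/(Q l').
  rewrite opprD addrACA -scalerBl (splitr e); apply: (le_lt_trans (ler_normD _ _)).
  apply: ler_ltD => //; rewrite normrZ.
  apply: (@le_trans _ _ (e / 2 / (`|t j| + 1) * (`|t j| + 1))).
    by apply: ler_pM => //; [exact: ltW|rewrite lerDl].
  by rewrite divfK// gt_eqF// ltr_wpDl.
exists (range Q); first exact: range_countable.
apply/dense_normP => x e e0.
have : closure (range T) x.
  apply: (total_orthogonal (M := CSubspace (closure_submod TS) (@closed_closure _ _))) => z zT.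
  apply: t0 => j; apply: zT; apply: subset_closure; exists [:: (1, j)] => //.
  by rewrite /T big_seq1 scale1r.
have e20 : 0 < e / 2 by rewrite divr_gt0.
move=> /closure_normP/(_ _ e20)[_ [l _ <-] xl].
have [l' l'P] := approx l _ e20.
exists (Q l'); first by exists l'.
rewrite -(subrK (T l) x) -addrA (splitr e); apply: (le_lt_trans (ler_normD _ _)).
exact: ltrD.
Qed.

Lemma separable_seq H : separable H -> exists u : nat -> H, dense (range u).
Proof.
move=> [D /countable_injP[f fI] dD].
(* Where no point of [D] has index [n], [get] returns an arbitrary point; additional terms do not
   harm density. *)
exists (fun n => get [set x | D x /\ f x = n]).
apply/dense_normP => x e e0; have [y Dy xy] := (proj1 (dense_normP D) dD) x e e0.
exists y => //; exists (f y) => //.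
have [Dg fg] := getPex (ex_intro (fun x => D x /\ f x = f y) y (conj Dy erefl)).
by apply: fI; rewrite ?inE.
Qed.

Lemma separable_cline : separable (cline R).
Proof.
apply: (@separable_total _ unit (fun _ => (1 : R[i]) : cline R)) => z /(_ tt).
by rewrite cline_dotE rmorph1 mulr1.
Qed.

Lemma separable_csub H (M : csubspace H) : separable H -> separable (csub M).
Proof.
move=> [D cD /dense_normP dD]; exists (csub_proj M @` D); first exact: image_countable.
apply/dense_normP => x e e0; have [y Dy xy] := dD (csub_incl M x) e e0.
exists (csub_proj M y); first by exists y.
rewrite -[x](csub_projK (M := M)) -bop_sub csub_projE; apply: le_lt_trans xy.
apply: (le_trans (bop_bounded _ _)); rewrite adj_norm ler_piMl//.
by apply: bop_norm_le => // z; rewrite csub_incl_norm mul1r.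
Qed.

Lemma separable_hsum (I : countType) H : separable H -> separable (hsum I H).
Proof.
move=> /separable_seq[u du].
apply: (@separable_total _ (I * nat)%type (fun c => hdelta c.1 (u c.2))) => z z0.
apply: hsum_ext => i; apply: (dot_dense_eq0 du) => _ [n _ <-].
by rewrite -hdot_delta; exact: (z0 (i, n)).
Qed.

(** A vector orthogonal to all [u i (x) v j] is shown orthogonal to every elementary tensor one
    factor at a time: slices in either factor are bounded, so density applies to the image of the
    vector under the adjoint of a slice. *)
Lemma separable_tensor G H (W : htensor G H) : separable G -> separable H -> separable W.
Proof.
move=> /separable_seq[u du] /separable_seq[v dv].
apply: (@separable_total _ (nat * nat)%type (fun c => tmul W (u c.1) (v c.2))) => z z0.
apply: (tensor_dot0 (W := W)) => x y.
have [A AE] := tmul_left_ex W y; rewrite -AE -adjPr (_ : adj A z = 0) ?hdot0l//.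
apply: (dot_dense_eq0 du) => _ [i _ <-]; rewrite adjPr AE.
have [B BE] := tmul_left_ex (tensor_flip W) (u i).
rewrite -[tmul W (u i) y]/(tmul (tensor_flip W) y (u i)) -BE -adjPr.
rewrite (_ : adj B z = 0) ?hdot0l//.
apply: (dot_dense_eq0 dv) => _ [j _ <-]; rewrite adjPr BE; exact: (z0 (i, j)).
Qed.

End Separability.

(** * Radii of compressions and restrictions to the range of an isometry *)

Section Radius.
Variables (R : realType) (omega : radius_family R).
Implicit Types H K L : hilbertType R.

Lemma isometry_norm H K (V : 'B(H, K)) : adj V \bo V = bopid H -> forall x, `|V x| = `|x|.
Proof.
move=> VV x; apply: (@pexpIrn _ 2); rewrite ?nnegrE//.
by rewrite -!hdot_norm adjP -[adj V (V x)]/((adj V \bo V) x) VV.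
Qed.

(** Given as the fixed space of [V V^*], which is a closed subspace by construction; for an isometry
    it is the range. *)
Definition isometry_range H K (V : 'B(H, K)) : csubspace K :=
  bop_equalizer (V \bo adj V) (bopid K).

Lemma isometry_rangeP H K (V : 'B(H, K)) : adj V \bo V = bopid H ->
  forall x, csub_set (isometry_range V) (V x).
Proof.
move=> VV x; change (V ((adj V \bo V) x) = V x); by rewrite VV.
Qed.

Lemma isometry_range_surj H K (V : 'B(H, K)) y :
  csub_set (isometry_range V) y -> V (adj V y) = y.
Proof. exact. Qed.

Lemma isometry_range_neq0 H K (V : 'B(H, K)) : adj V \bo V = bopid H ->
  (exists x : H, x != 0) -> exists y : csub (isometry_range V), y != 0.
Proof.
move=> VV [x x0]; exists (csub_proj _ (V x)); apply: contra x0 => /eqP y0.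
rewrite -normr_eq0 -(isometry_norm VV) -(csub_proj_id (isometry_rangeP VV x)) y0.
by rewrite bop_zero normr0.
Qed.

(** [V] is the inclusion of its range preceded by a unitary [U] from [H] onto that range, and
    conjugation by [U] does not change the radius. *)
Lemma radius_compression H K (V : 'B(H, K)) d (T : 'I_d -> 'B(K)) :
  unitarily_invariant omega -> standing H -> standing K -> (0 < d)%N ->
  adj V \bo V = bopid H ->
  omega (fun i => adj V \bo T i \bo V)
  = omega (fun i => compression (isometry_range V) (T i)).
Proof.
move=> uinv sH sK d0 VV; set M := isometry_range V.
pose U : 'B(H, csub M) := csub_proj M \bo V.
have iU : csub_incl M \bo U = V.
  by apply: bop_ext => x; exact: csub_proj_id (isometry_rangeP VV x).
have aU : adj U = adj V \bo csub_incl M by rewrite adj_comp csub_projE adjK.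
have sM : standing (csub M).
  by split; [exact: separable_csub sK.1|exact: isometry_range_neq0 VV sH.2].
rewrite -(uinv _ _ U _ _ sM sH d0).
- congr omega; apply/funext => i; rewrite compressionE aU.
  apply: bop_ext => x.
  transitivity (adj V (csub_incl M (adj (csub_incl M) (T i (csub_incl M (U x)))))); last by [].
  rewrite -[csub_incl M (U x)]/((csub_incl M \bo U) x) iU.
  rewrite -[adj V (csub_incl M _)]/((adj V \bo csub_incl M) _) -aU.
  rewrite -[adj U _]/((adj U \bo adj (csub_incl M)) _) -adj_comp iU.
  by [].
- by rewrite aU -bopcompA iU.
- apply: bop_ext => y; apply: (@csub_incl_inj _ _ M).
  rewrite aU -[LHS]/((csub_incl M \bo U) (adj V (csub_incl M y))) iU.
  exact: isometry_range_surj (csub_inclP y).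
Qed.

Lemma isometry_compression_le H K (V : 'B(H, K)) d (T : 'I_d -> 'B(K)) :
  strongly_admissible omega -> standing H -> standing K -> (0 < d)%N ->
  adj V \bo V = bopid H -> omega (fun i => adj V \bo T i \bo V) <= omega T.
Proof.
move=> [uinv _ cm] sH sK d0 VV; rewrite radius_compression//.
by apply: cm => //; exact: isometry_range_neq0 VV sH.2.
Qed.

(** The relation [T i V = V T' i] makes the range of [V] invariant, so the compression is a
    restriction and the weaker monotonicity axiom suffices. *)
Lemma isometry_restriction_le H K (V : 'B(H, K)) d (T : 'I_d -> 'B(K)) (T' : 'I_d -> 'B(H)) :
  admissible omega -> standing H -> standing K -> (0 < d)%N ->
  adj V \bo V = bopid H -> (forall i, T i \bo V = V \bo T' i) ->
  omega (fun i => adj V \bo T i \bo V) <= omega T.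
Proof.
move=> [uinv _ rm] sH sK d0 VV TT; rewrite radius_compression//.
apply: rm => // [|i y My]; first exact: isometry_range_neq0 VV sH.2.
rewrite -(isometry_range_surj My) -[T i _]/((T i \bo V) _) TT.
exact: isometry_rangeP.
Qed.

Lemma radius_limit K d (S : Type) (F : set_system S) (FF : ProperFilter F)
    (X : S -> 'I_d -> 'B(K)) (Y : 'I_d -> 'B(K)) (b : R) :
  norm_quasi_continuous omega -> standing K -> (0 < d)%N -> 0 <= b ->
  (forall i, (fun t => X t i) @ F --> Y i) -> (\forall t \near F, omega (X t) <= b) ->
  omega Y <= b.
Proof.
move=> qc sK d0 b0 XY Xb.
apply: (closed_cvg _ (qc K d b sK d0 b0) Xb).
(* The pointwise topology is a supremum of topologies induced by evaluations, so convergence is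
   tested one coordinate at a time; constant families show that evaluations are onto. *)
rewrite cvg_sup => i.
rewrite cvg_image; last by rewrite eqEsubset; split=> v // _; exists (fun=> v).
move=> W /= /XY XW; exists (@^~ i @^-1` W) => //.
by rewrite eqEsubset; split=> [_ [f Wf <-] //|w Ww]; exists (fun=> w).
Qed.

End Radius.

(** * Fock space and Poisson kernels *)

Lemma catr_inj (T : eqType) (w : seq T) : injective (cat^~ w).
Proof.
move=> a b /(congr1 rev); rewrite !rev_cat => /eqP; rewrite eqseq_cat//.
by move=> /andP[_ /eqP/(can_inj revK)].
Qed.

Section Fock.
Variables (R : realType) (n : nat).
Local Notation F := (fock R n).

Lemma hbasis_delta (H : hilbertType R) (a : seq 'I_n) (h : H) :
  tmul (hsum_tensor (seq 'I_n) H) (hbasis R a) h = hdelta a h.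
Proof.
apply: hsum_ext => b; rewrite hsum_tensorE hdeltaE.
rewrite -[LHS]/((b == a)%:R *: h); by case: eqP; rewrite ?scale1r ?scale0r.
Qed.

Lemma hbasis_hdelta (a : seq 'I_n) : hbasis R a = hdelta a ((1 : R[i]) : cline R).
Proof. by apply: hsum_ext => b; rewrite hdeltaE -[LHS]/((b == a)%:R : R[i]); case: eqP. Qed.

Lemma hdot_basis (f : F) a : '[f, hbasis R a] = (f : hsum _ _) a.
Proof. by rewrite hbasis_hdelta hdot_delta cline_dotE rmorph1 mulr1. Qed.

Lemma hdot_basis2 (a b : seq 'I_n) : '[hbasis R a, hbasis R b] = (b == a)%:R.
Proof. exact: (hdot_basis (hbasis R a) b). Qed.

Lemma fock_total (M : csubspace F) :
  (forall a, csub_set M (hbasis R a)) -> forall z, csub_set M z.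
Proof.
move=> Mb; apply: total_orthogonal => z zM; apply: hsum_ext => a.
by rewrite -hdot_basis; exact: zM.
Qed.

Lemma fock_bop_ext (K : hilbertType R) (A B : 'B(F, K)) :
  (forall a, A (hbasis R a) = B (hbasis R a)) -> A = B.
Proof. by move=> AB; apply: bop_ext => z; exact: (@fock_total (bop_equalizer A B)). Qed.

Lemma opword_cat (H : hilbertType R) (T : 'I_n -> 'B(H)) a b :
  opword T (a ++ b) = opword T a \bo opword T b.
Proof. by elim: a => [|i a ih] /=; rewrite ?bopcomp1l// ih bopcompA. Qed.

Lemma opword_creation a b : opword (@creation R n) a (hbasis R b) = hbasis R (a ++ b).
Proof.
elim: a => [//|i a ih].
by rewrite -[LHS]/(creation R i (opword (@creation R n) a (hbasis R b))) ih creation_basis.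
Qed.

(** Appending [w] is injective on words, so inner products of basis vectors are preserved and the
    extension exists with bound 1. *)
Lemma right_creation_ex (w : seq 'I_n) :
  exists A : 'B(F), forall a, A (hbasis R a) = hbasis R (a ++ w).
Proof.
have [|||A AE _] := @bop_extension R F F (seq 'I_n)
  (fun a => hbasis R a) (fun a => hbasis R (a ++ w)) 1.
- by [].
- exact: fock_total.
- move=> l; rewrite mul1r -(@ler_pXn2r _ 2) ?nnegrE ?normr_ge0// -!hdot_norm.
  rewrite le_eqVlt; apply/orP; left; apply/eqP; rewrite !hdot_suml; apply: eq_bigr => c _.
  rewrite !hdot_sumr; apply: eq_bigr => d _.
  by rewrite !hdotZl !hdotZr !hdot_basis2 (inj_eq (@catr_inj _ w)).
by exists A.
Qed.

(** * Algebras closed in the weak operator topology *)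

Section Algebras.
Variable H : hilbertType R.
Implicit Types A B : set 'B(H).

Lemma subspace_sum A (I : Type) (s : seq I) (f : I -> 'B(H)) :
  is_subspace A -> (forall i, A (f i)) -> A (\sum_(i <- s) f i).
Proof.
move=> [A0 AL] Af; apply: big_ind => // x y Ax Ay.
by rewrite -[x]scale1r; exact: AL.
Qed.

Lemma subspace_scale A a X : is_subspace A -> A X -> A (a *: X).
Proof. by move=> [A0 AL] AX; rewrite -[_ *: _]addr0; exact: AL. Qed.

Lemma wot_algebra_alg A : is_subalgebra (wot_algebra A).
Proof.
split; first split.
- by move=> B [[[[B0 _] _] _] _].
- move=> a X Y AX AY B AB; have [[[[_ BL] _] _] _] := AB.
  by apply: BL; [exact: AX|exact: AY].
- move=> X Y AX AY B AB; have [[[_ BM] _] _] := AB.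
  by apply: BM; [exact: AX|exact: AY].
Qed.

Lemma wot_algebra_closed A : wot_closed (wot_algebra A).
Proof.
move=> T TA B AB; have [[_ Bc] _] := AB; apply: Bc => s e e0.
by have [X AX Xs] := TA s e e0; exists X => //; exact: AX.
Qed.

Lemma wot_eq0 (T : 'B(H)) (A : set 'B(H)) (s : seq (R[i] * (H * H))) :
  (forall (l : seq (H * H)) (e : R[i]), 0 < e ->
     exists2 X, A X & forall xy, xy \in l -> `|'[(X - T) xy.1, xy.2]| < e) ->
  (forall X, A X -> \sum_(c <- s) c.1 * '[X c.2.1, c.2.2] = 0) ->
  \sum_(c <- s) c.1 * '[T c.2.1, c.2.2] = 0.
Proof.
move=> TA As; apply/eqP; rewrite -normr_eq0; apply/eqP/complex_le_eps => // e e0.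
pose m := \sum_(c <- s) `|c.1| + 1.
have m0 : 0 < m by rewrite ltr_wpDl// sumr_ge0.
have d0 : 0 < e / m by rewrite divr_gt0.
have [X AX XT] := TA [seq c.2 | c <- s] _ d0.
have -> : \sum_(c <- s) c.1 * '[T c.2.1, c.2.2]
    = - \sum_(c <- s) c.1 * '[(X - T) c.2.1, c.2.2].
  apply/eqP; rewrite -subr_eq0 opprK -big_split /=; apply/eqP.
  rewrite -[RHS](As _ AX); apply: eq_bigr => c _.
  rewrite -mulrDr -hdotDl; congr (_ * '[_, _]).
  by rewrite -[LHS]/(T c.2.1 + (X c.2.1 - T c.2.1)) addrC subrK.
rewrite normrN.
apply: (le_trans (ler_norm_sum _ _ _)).
apply: (@le_trans _ _ (\sum_(c <- s) `|c.1| * (e / m))).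
  rewrite big_seq [leRHS]big_seq; apply: ler_sum => c cs.
  rewrite normrM ler_wpM2l// ltW//.
  by apply: XT; apply/mapP; exists c.
rewrite -mulr_suml mulrA ler_pdivrMr// [e * _]mulrC ler_wpM2r ?(ltW e0)//.
by rewrite lerDl.
Qed.

End Algebras.

Lemma Finfty_creation i : Finfty R n (creation R i).
Proof. by move=> B [_ sub]; apply: sub; left; exists i. Qed.

Lemma Finfty_id : Finfty R n (bopid F).
Proof. by move=> B [_ sub]; apply: sub; right. Qed.

Lemma Finfty_word a : Finfty R n (opword (@creation R n) a).
Proof.
elim: a => [|i a ih]; first exact: Finfty_id.
have [_ FM] := wot_algebra_alg (range (@creation R n)).
by apply: FM => //; exact: Finfty_creation.
Qed.

Lemma Finfty_poly (p : ncpoly R n) : Finfty R n (nceval p (@creation R n)).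
Proof.
have [FS _] := wot_algebra_alg (range (@creation R n)).
apply: (subspace_sum _ FS) => a; apply: (subspace_scale _ FS).
exact: Finfty_word.
Qed.

(* Elements of the noncommutative analytic Toeplitz algebra commute with right
   multiplication by words, hence are determined by their value at the vacuum. *)
Lemma Finfty_right (Y : 'B(F)) (A : 'B(F)) (w : seq 'I_n) :
  (forall a, A (hbasis R a) = hbasis R (a ++ w)) -> Finfty R n Y -> Y \bo A = A \bo Y.
Proof.
move=> Aw; apply: (smallest_sub (X := [set Y | Y \bo A = A \bo Y])); last first.
  move=> X [[i _ <-]|->] /=; last by rewrite bopcomp1l bopcomp1r.
  apply: fock_bop_ext => a.
  rewrite -[LHS]/(creation R i (A (hbasis R a))) -[RHS]/(A (creation R i (hbasis R a))).
  by rewrite Aw !creation_basis Aw.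
split; first split; first split.
- by rewrite /=; apply: bop_ext => x; rewrite -[RHS]/(A 0) bop_zero.
- by move=> a X X' /= XA X'A; rewrite bopcompDl bopcompZl XA X'A bopcompDr bopcompZr.
- by move=> X X' /= XA X'A; rewrite -bopcompA X'A bopcompA XA bopcompA.
move=> T TX /=; apply: bop_dot_ext => x y.
(* The functional [X |-> <X A x, y> - <X x, A^* y>], which vanishes exactly when
   [<X A x, y> = <A X x, y>]. *)
have := @wot_eq0 F T _ [:: (1, (A x, y)); (-1, (x, adj A y))] TX.
rewrite !big_cons !big_nil !addr0 !mul1r !mulN1r /= => eq0.
apply/eqP; rewrite -subr_eq0; apply/eqP.
rewrite -[ '[(T \bo A) x, y] ]/('[T (A x), y]) -[ '[(A \bo T) x, y] ]/('[A (T x), y]).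
rewrite [ '[A _, y] ]adjP.
apply: eq0 => X /= XA; rewrite !big_cons !big_nil !addr0 !mul1r !mulN1r /= -adjP.
by rewrite -[ '[X (A x), y] ]/('[(X \bo A) x, y]) XA subrr.
Qed.

End Fock.

Section Words.
Variable n : nat.

(** Words of length below [N], arranged by length so that sums over them split into homogeneous
    parts. *)
Fixpoint words_upto (N : nat) : seq (seq 'I_n) :=
  if N is M.+1 then words_upto M ++ [seq tval t | t <- index_enum {: M.-tuple 'I_n}]
  else [::].

Lemma mem_words_upto N a : (a \in words_upto N) = (size a < N)%N.
Proof.
elim: N => [//|N ih] /=; rewrite mem_cat ih ltnS [in RHS]leq_eqVlt [RHS]orbC; congr orb.
apply/mapP/eqP => [[t _ ->]|sa]; first exact: size_tuple.
by exists (Tuple (introT eqP sa)); rewrite ?mem_index_enum.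
Qed.

Lemma words_upto_uniq N : uniq (words_upto N).
Proof.
elim: N => [//|N ih] /=; rewrite cat_uniq ih /=.
rewrite map_inj_uniq ?index_enum_uniq ?andbT; last exact: val_inj.
by apply/hasPn => _ /mapP[t _ ->] /=; rewrite mem_words_upto size_tuple ltnn.
Qed.

End Words.

Lemma big_tuple_cons (R : Type) (idx : R) (op : Monoid.com_law idx) (T : finType) k
    (F : seq T -> R) :
  \big[op/idx]_(a : k.+1.-tuple T) F a
  = \big[op/idx]_(i : T) \big[op/idx]_(b : k.-tuple T) F (i :: b).
Proof.
rewrite pair_big /= (reindex (fun p : T * k.-tuple T => cons_tuple p.1 p.2)) //=.
exists (fun t => (thead t, behead_tuple t)) => [[i b] _|t _] /=.
  by congr (_, _); apply: val_inj.
by rewrite [RHS]tuple_eta; apply: val_inj.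
Qed.

Lemma big_tuple_nil (R : Type) (idx : R) (op : Monoid.com_law idx) (T : finType) (F : seq T -> R) :
  \big[op/idx]_(a : 0.-tuple T) F a = F [::].
Proof.
rewrite (big_pred1 [tuple]) // => t; apply/esym/eqP/val_inj.
by case: t => -[].
Qed.

(** * Existence and isometry of the Poisson kernel at a fixed radius *)

Section Poisson.
Variables (R : realType) (n : nat) (H : hilbertType R) (T : 'I_n -> 'B(H)).
Hypothesis rc : row_contraction T.

Let S : 'B(H) := \sum_i T i \bo adj (T i).

Let dot_S x y : '[S x, y] = \sum_i '[adj (T i) x, adj (T i) y].
Proof.
rewrite /S bop_sumE hdot_suml; apply: eq_bigr => i _.
by rewrite -[(T i \bo _) x]/(T i (adj (T i) x)) adjP.
Qed.

Lemma row_contraction_le x : \sum_i `|adj (T i) x| ^+ 2 <= `|x| ^+ 2.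
Proof.
have := rc x; rewrite bopB hdotBl -/S dot_S subr_ge0 hdot_norm; congr (_ <= _).
by apply: eq_bigr => i _; rewrite hdot_norm.
Qed.

Let S_adj : adj S = S.
Proof.
apply: adj_unique => x y; rewrite [RHS]hdotC !dot_S rmorph_sum.
by apply: eq_bigr => i _; rewrite [LHS]hdotC.
Qed.

(** [S = V^* V] for the column [V x = (T_i^* x)_i], a contraction by the row condition. With [r < 1]
    this puts [r^2 S] in the range where square roots are available. *)
Let S_norm : `|S| <= 1.
Proof.
pose f x : hsum 'I_n H := hsum_ord (fun i => adj (T i) x).
have fl : linear f by move=> a x y; apply: hsum_ext => i; exact: bop_linear.
have fb x : `|f x| <= 1 * `|x|.
  rewrite mul1r -(@ler_pXn2r _ 2) ?nnegrE ?normr_ge0// -hdot_norm hsum_dot_ord.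
  by apply: le_trans (row_contraction_le x); apply: ler_sum => i _; rewrite hdot_norm.
have [V Vf V1] := mkbop_ex fl ler01 fb.
have -> : S = adj V \bo V.
  apply: bop_dot_ext => x y; rewrite dot_S -[(adj V \bo V) x]/(adj V (V x)) adjPr.
  by rewrite !Vf hsum_dot_ord.
by rewrite -[leRHS]mulr1 bop_comp_norm_le// adj_norm.
Qed.

Variable r : R.
Hypotheses (r0 : 0 <= r) (r1 : r < 1).

Let D := defect T r.

Lemma defectP : op_ge0 D /\ D \bo D = bopid H - (r ^+ 2)%:C%C *: S.
Proof.
apply: (getPex (P := [set D : 'B(H) | op_ge0 D /\ D \bo D = bopid H - (r ^+ 2)%:C%C *: S])).
apply: op_sqrt_exists; first by rewrite adj_scale S_adj conjC_real.
have r2 : 0 <= r ^+ 2 by rewrite exprn_ge0.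
rewrite normrZ ger0_norm ?ler0c//.
apply: (@le_lt_trans _ _ ((r ^+ 2)%:C%C * 1)); first by rewrite ler_wpM2l ?ler0c.
by rewrite mulr1 ltcR expr_lt1.
Qed.

Lemma defect_adj : adj D = D.
Proof. exact: op_ge0_selfadj defectP.1. Qed.

Lemma defect_norm2 x :
  `|D x| ^+ 2 = `|x| ^+ 2 - (r ^+ 2)%:C%C * \sum_i `|adj (T i) x| ^+ 2.
Proof.
rewrite -hdot_norm -{1}defect_adj adjPr -[D (D x)]/((D \bo D) x) defectP.2.
rewrite bopB bopZ hdotBr hdotZr conjC_real hdot_norm; congr (_ - _ * _).
rewrite hdotC dot_S rmorph_sum; apply: eq_bigr => i _.
by rewrite -hdot_norm [RHS]hdotC.
Qed.

Lemma adj_opword_cons i b h : adj (opword T (i :: b)) h = adj (opword T b) (adj (T i) h).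
Proof. by rewrite /= adj_comp. Qed.

Definition poisson_coef (h : H) (a : seq 'I_n) : H :=
  (r ^+ size a)%:C%C *: D (adj (opword T a) h).

Let q (h : H) (k : nat) : R[i] :=
  \sum_(a : k.-tuple 'I_n) ((r ^+ k)%:C%C ^+ 2 * `|adj (opword T a) h| ^+ 2).

Let N (h : H) (k : nat) : R[i] := \sum_(a : k.-tuple 'I_n) `|poisson_coef h a| ^+ 2.

Let rp_ge0 k : 0 <= (r ^+ k)%:C%C :> R[i].
Proof. by rewrite ler0c exprn_ge0. Qed.

Let powS k : (r ^+ k.+1)%:C%C ^+ 2 = (r ^+ 2)%:C%C * (r ^+ k)%:C%C ^+ 2 :> R[i].
Proof. by rewrite (exprS r k) realcM exprMn; congr (_ * _); rewrite !expr2 realcM. Qed.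

Let qS h k : q h k.+1 = (r ^+ 2)%:C%C * \sum_i q (adj (T i) h) k.
Proof.
rewrite /q (big_tuple_cons _ _ (fun a => (r ^+ k.+1)%:C%C ^+ 2 * `|adj (opword T a) h| ^+ 2)).
rewrite mulr_sumr; apply: eq_bigr => i _; rewrite mulr_sumr; apply: eq_bigr => b _.
by rewrite adj_opword_cons mulrA powS.
Qed.

Let NS h k : N h k.+1 = (r ^+ 2)%:C%C * \sum_i N (adj (T i) h) k.
Proof.
rewrite /N (big_tuple_cons _ _ (fun a => `|poisson_coef h a| ^+ 2)).
rewrite mulr_sumr; apply: eq_bigr => i _; rewrite mulr_sumr; apply: eq_bigr => b _.
rewrite /poisson_coef adj_opword_cons !normrZ !exprMn [RHS]mulrA; congr (_ * _).
rewrite !(ger0_norm (rp_ge0 _)) /= size_tuple.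
exact: powS.
Qed.

Let q0 h : q h 0 = `|h| ^+ 2.
Proof.
rewrite /q (big_tuple_nil _ (fun a => (r ^+ 0)%:C%C ^+ 2 * `|adj (opword T a) h| ^+ 2)).
by rewrite expr0 expr1n mul1r /= adj_id.
Qed.

(* [q h k] is [r^(2k) sum_(|a| = k) |T_a^* h|^2], so the squared norms of the
   homogeneous parts of the Poisson kernel telescope. *)
Let NE h k : N h k = q h k - q h k.+1.
Proof.
elim: k h => [|k ih] h.
  rewrite qS q0 /N (big_tuple_nil _ (fun a => `|poisson_coef h a| ^+ 2)).
  rewrite /poisson_coef /= adj_id expr0 scale1r defect_norm2.
  by congr (_ - _ * _); apply: eq_bigr => i _; rewrite q0.
rewrite NS [in RHS]qS [q h k.+2]qS -mulrBr -sumrB; congr (_ * _).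
by apply: eq_bigr => i _; rewrite ih.
Qed.

Let q_ge0 h k : 0 <= q h k.
Proof. by rewrite sumr_ge0// => a _; rewrite mulr_ge0 ?exprn_ge0. Qed.

Let q_le h k : q h k <= (r ^+ k)%:C%C ^+ 2 * `|h| ^+ 2.
Proof.
elim: k h => [|k ih] h; first by rewrite q0 expr0 expr1n mul1r.
rewrite qS.
apply: (@le_trans _ _ ((r ^+ 2)%:C%C * \sum_i ((r ^+ k)%:C%C ^+ 2 * `|adj (T i) h| ^+ 2))).
  by rewrite ler_wpM2l ?rp_ge0//; apply: ler_sum => i _; exact: ih.
rewrite -mulr_sumr mulrA -powS.
by rewrite ler_wpM2l ?exprn_ge0 ?rp_ge0// row_contraction_le.
Qed.

Let tail_words h m M : (m <= M)%N ->
  \sum_(a <- words_upto n M | (m <= size a)%N) `|poisson_coef h a| ^+ 2 = q h m - q h M.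
Proof.
elim: M => [|M ih].
  by rewrite leqn0 => /eqP ->; rewrite big_nil subrr.
rewrite leq_eqVlt => /orP[/eqP->|].
  rewrite subrr big_seq_cond big1// => a /andP[]; rewrite mem_words_upto => aM.
  by rewrite leqNgt aM.
rewrite ltnS => mM; rewrite big_cat /= ih// big_map.
rewrite (eq_bigl xpredT) => [|t]; last by rewrite size_tuple mM.
by rewrite -/(N h M) NE addrA subrK.
Qed.

(** The family [s] is embedded in all words of bounded length, where the sum telescopes. The case
    [m = 0] gives square summability, general [m] the rate of convergence of the Poisson series. *)
Lemma poisson_tail h m (s : seq (seq 'I_n)) : uniq s ->
  \sum_(a <- s | (m <= size a)%N) `|poisson_coef h a| ^+ 2
  <= (r ^+ m)%:C%C ^+ 2 * `|h| ^+ 2.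
Proof.
move=> us; apply: le_trans (q_le h m).
pose M := maxn m (\max_(a <- s) size a).+1.
apply: (@le_trans _ _ (q h m - q h M)); last by rewrite gerBl.
rewrite -tail_words ?leq_maxl// [leLHS]big_mkcond [leRHS]big_mkcond /=.
apply: sum_subseq_le => // [a||a sa].
- by case: ifP => // _; rewrite exprn_ge0.
- exact: words_upto_uniq.
by rewrite mem_words_upto; apply: leq_trans (leq_maxr _ _); rewrite ltnS leq_bigmax_seq.
Qed.

Lemma poisson_bounded h : sq_bounded (`|h| ^+ 2) (poisson_coef h).
Proof. by move=> s us; have := poisson_tail h 0 us; rewrite expr0 expr1n mul1r. Qed.

Let pvec h : hsum (seq 'I_n) H := mkhsum (poisson_bounded h).

(** Summing over words shorter than [M] gives [|h|^2 - q h M], and [q h M <= r^(2M) |h|^2] tends to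
    0 because [r < 1]. *)
Let pvec_norm h : `|pvec h| = `|h|.
Proof.
apply: (@pexpIrn _ 2); rewrite ?nnegrE//; apply: le_anti.
rewrite hsum_norm_le//=; last exact: poisson_bounded.
apply/ler_addgt0Pr => e e0.
have [h0|h0] := eqVneq (`|h| ^+ 2) 0; first by rewrite h0 addr_ge0 ?exprn_ge0// ltW.
have hp : 0 < `|h| ^+ 2 by rewrite lt_neqAle eq_sym h0 exprn_ge0.
have rC1 : r%:C%C < 1 :> R[i] by rewrite ltcR.
have rC0 : 0 <= r%:C%C :> R[i] by rewrite ler0c.
have [M MP] := pow_small rC0 rC1 (divr_gt0 e0 hp).
have /= := @hsum_bounded _ _ _ (pvec h) _ (words_upto_uniq n M).
have := tail_words h (leq0n M); rewrite q0 /= => -> hM.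
rewrite -lerBlDr; apply: le_trans hM; rewrite lerD2l lerN2.
apply: (le_trans (q_le h M)); rewrite -ler_pdivlMr//; apply: le_trans (ltW MP).
rewrite rmorphXn expr2 ler_piMr ?exprn_ge0//.
by rewrite exprn_ile1// ltW.
Qed.

Let pvec_linear : linear pvec.
Proof.
move=> a x y; apply: hsum_ext => b; rewrite hsumD hsumZ /= /poisson_coef.
by rewrite !bop_linear scalerDr !scalerA mulrC.
Qed.

(** Coordinates and series are established for the same operator: uniqueness of limits then
    transfers the coordinates to the kernel chosen by [get]. *)
Lemma poisson_exists : exists K : 'B(H, fock_tensor n H), forall h,
  (forall a, (K h : hsum _ _) a = poisson_coef h a) /\
  series (fun k => \sum_(a : k.-tuple 'I_n)
      tmul (fock_tensor n H) (hbasis R (tval a))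
        ((r ^+ k)%:C%C *: defect T r (adj (opword T a) h))) @ \oo --> K h.
Proof.
have [|K KE _] := @mkbop_ex R H (hsum (seq 'I_n) H) pvec 1 pvec_linear ler01.
  by move=> h; rewrite pvec_norm mul1r.
have Ka h a : (K h : hsum _ _) a = poisson_coef h a by rewrite KE.
exists K => h; split=> //.
set u := (X in series X).
have uE k a : (u k : hsum _ _) a = if size a == k then poisson_coef h a else 0.
  have -> : u k = \sum_(t : k.-tuple 'I_n) hdelta (tval t) (poisson_coef h t) :> hsum _ _.
    by apply: eq_bigr => t _; rewrite hbasis_delta /poisson_coef size_tuple.
  rewrite -[LHS]/(hcoord H a _) bop_sum.
  under eq_bigr => t _ do rewrite -[hcoord H a _]/(hdelta _ _ a) hdeltaE.
  case: eqP => [sa|sa]; last first.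
    rewrite big1// => t _; case: eqP => // aE.
    by exfalso; apply: sa; rewrite aE size_tuple.
  rewrite (bigD1 (Tuple (introT eqP sa)))//= eqxx big1 ?addr0// => t tE.
  by case: eqP => // aE; rewrite -val_eqE /= aE eqxx in tE.
(* The sum of the first [m] terms is the truncation to words of length strictly below [m], so the
   remainder is exactly the tail bounded by [poisson_tail]. *)
have partial m a : (series u m : hsum _ _) a
    = if (size a < m)%N then poisson_coef h a else 0.
  rewrite -[LHS]/(hcoord H a (\sum_(0 <= k < m) (u k : hsum _ _))) bop_sum.
  rewrite (eq_bigr (fun k => if size a == k then poisson_coef h a else 0)); last first.
    by move=> k _; rewrite -uE.
  elim: m => [|m ih]; first by rewrite big_geq.
  rewrite big_nat_recr//= ih [in RHS]ltnS [in RHS]leq_eqVlt.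
  by case: (ltngtP (size a) m) => //= _; rewrite ?addr0 ?add0r.
apply/cvgrPdist_lt => e e0.
have e20 : 0 < e / (`|h| + 1) by rewrite divr_gt0// ltr_wpDl.
have rC1 : r%:C%C < 1 :> R[i] by rewrite ltcR.
have rC0 : 0 <= r%:C%C :> R[i] by rewrite ler0c.
have [M MP] := pow_small rC0 rC1 e20.
exists M => // m /= Mm.
have rm : (r ^+ m)%:C%C < e / (`|h| + 1).
  by apply: le_lt_trans MP; rewrite rmorphXn /= ler_wiXn2l// ltW.
apply: (@le_lt_trans _ _ ((r ^+ m)%:C%C * `|h|)); last first.
  apply: (@le_lt_trans _ _ ((r ^+ m)%:C%C * (`|h| + 1))).
    by rewrite ler_wpM2l ?rp_ge0// lerDl.
  by rewrite -ltr_pdivlMr// ltr_wpDl.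
apply: ler_of_sqr => //.
apply: hsum_norm_le => s us.
have -> : \sum_(a <- s) `|(K h - series u m : hsum _ _) a| ^+ 2
    = \sum_(a <- s | (m <= size a)%N) `|poisson_coef h a| ^+ 2.
  rewrite [RHS]big_mkcond; apply: eq_bigr => a _.
  rewrite -[(K h - _ : hsum _ _) a]/((K h : hsum _ _) a - (series u m : hsum _ _) a).
  rewrite partial Ka; case: (ltnP (size a) m) => _; first by rewrite subrr normr0 expr0n.
  by rewrite subr0.
exact: poisson_tail.
Qed.

Lemma poissonE h a : (poisson T r h : hsum _ _) a = (r ^+ size a)%:C%C *: D (adj (opword T a) h).
Proof.
have [K KP] := poisson_exists.
have P := getPex (ex_intro (fun K : 'B(H, fock_tensor n H) => forall h,
    series (fun k => \sum_(a : k.-tuple 'I_n)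
      tmul (fock_tensor n H) (hbasis R (tval a))
        ((r ^+ k)%:C%C *: defect T r (adj (opword T a) h))) @ \oo --> K h) K (fun h => (KP h).2)).
have -> : poisson T r h = K h.
  exact: (cvg_unique (@norm_hausdorff _ (fock_tensor n H)) (P h) (KP h).2).
exact: (KP h).1.
Qed.

Lemma poisson_norm h : `|poisson T r h| = `|h|.
Proof.
rewrite -(pvec_norm h); congr `|_|; apply: hsum_ext => a.
by rewrite poissonE.
Qed.

End Poisson.

Lemma isometry_adj (R : realType) (H K : hilbertType R) (V : 'B(H, K)) :
  (forall x, `|V x| = `|x|) -> adj V \bo V = bopid H.
Proof.
move=> Vn.
have n2 x : '[V x, V x] = '[x, x] by rewrite !hdot_norm Vn.
(* Polarization: the cross terms of [|V (c x + y)|^2 = |c x + y|^2], later separated by [c = 1] and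
   [c = i]. *)
have key (c : R[i]) x y : c * ('[V x, V y] - '[x, y]) + c^* * ('[V y, V x] - '[y, x]) = 0.
  have := n2 (c *: x + y); rewrite bop_linear !hdotDl !hdotDr !hdotZl !hdotZr !n2.
  set p := '[V x, V y]; set q := '[V y, V x]; set p' := '[x, y]; set q' := '[y, x].
  move=> /eqP; rewrite -subr_eq0 => /eqP <-; ring.
apply: bop_dot_ext => x y; rewrite -[(adj V \bo V) x]/(adj V (V x)) adjPr.
have := key 1 x y; have := key 'i x y.
rewrite rmorph1 conjCi !mul1r mulNr -mulrBr => /eqP.
rewrite mulf_eq0 (negbTE (neq0Ci _)) /= subr_eq0 => /eqP <-.
rewrite -mulr2n => /eqP; rewrite mulrn_eq0 /= subr_eq0 => /eqP ->.
by [].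
Qed.

(** * The adjoint Poisson kernel vanishes on the ideal *)

Section PoissonFock.
Variables (R : realType) (n : nat) (H : hilbertType R) (T : 'I_n -> 'B(H)).
Hypothesis rc : row_contraction T.
Variable r : R.
Hypotheses (r0 : 0 <= r) (r1 : r < 1).
Local Notation F := (fock R n).
Local Notation W := (fock_tensor n H).
Let K := poisson T r.

(** Equivalently [K^* (e_a (x) h) = r^|a| T_a Delta_r h]; the shift relation and the vanishing on
    the ideal are both computed from this formula. *)
Lemma hdot_poisson k a h :
  '[K k, tmul W (hbasis R a) h] = (r ^+ size a)%:C%C * '[k, opword T a (defect T r h)].
Proof.
rewrite hbasis_delta hdot_delta poissonE// hdotZl; congr (_ * _).
by rewrite -{1}defect_adj// !adjPr.
Qed.

Lemma poisson_creation i :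
  tensop W (adj (creation R i)) (bopid H) \bo K = r%:C%C *: (K \bo adj (T i)).
Proof.
apply: bop_ext => h; apply: hsum_ext => b; apply: hdot_ext => k.
rewrite -!hdot_delta -!hbasis_delta.
rewrite -[(tensop _ _ _ \bo K) h]/(tensop W (adj (creation R i)) (bopid H) (K h)).
rewrite -tensop_adj adjPr tensopE creation_basis hdot_poisson.
rewrite bopZ hdotZl -[(K \bo _) h]/(K (adj (T i) h)) hdot_poisson adjPr.
by rewrite mulrA -realcM -exprS.
Qed.

Section Vanishing.
Variables (d : nat) (q : 'I_d -> ncpoly R n).
Hypothesis q_hom : forall j, homogeneous (q j).
Hypothesis qT : forall j, nceval (q j) T = 0.

(** All words [c a b] have length [|c| + m + |b|], so one power of [r] factors out and leaves
    [T_c p(T) T_b]. Words of different lengths would weight the terms of [p] unequally, and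
    [p(T) = 0] could not be applied. *)
Lemma poisson_homogeneous (p : ncpoly R n) h c b : homogeneous p -> nceval p T = 0 ->
  \sum_(a <- finsupp p) p a *: adj K (tmul W (hbasis R (c ++ (a ++ b))) h) = 0.
Proof.
move=> [m pm] pT; apply: hdot_ext => k; rewrite hdot0l hdotC.
rewrite hdot_sumr (_ : \sum_(a <- finsupp p) _ = 0) ?rmorph0//.
transitivity (\sum_(a <- finsupp p) (r ^+ (size c + (m + size b)))%:C%C *
    '[k, opword T c (p a *: opword T a (opword T b (defect T r h)))]).
  rewrite big_seq [RHS]big_seq; apply: eq_bigr => a /pm am.
  rewrite hdotZr -adjP hdot_poisson !size_cat am bop_scale hdotZr mulrCA.
  by rewrite !opword_cat.
rewrite -mulr_sumr -hdot_sumr -bop_sum.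
have := congr1 (fun A : 'B(H) => A (opword T b (defect T r h))) pT.
rewrite /nceval bop_sumE => ->.
by rewrite bop0 bop_zero hdot0r mulr0.
Qed.

Lemma poisson_ideal X psi h : Jideal q X -> adj K (tmul W (X psi) h) = 0.
Proof.
have Fcl := @wot_algebra_closed R _ (range (@creation R n)).
have [FS FM] := wot_algebra_alg (range (@creation R n)).
have [P PE] : exists P : H -> 'B(F, H), forall h x, P h x = adj K (tmul W x h).
  suff /choice[P PE] : forall h, exists P : 'B(F, H), forall x, P x = adj K (tmul W x h).
    by exists P.
  move=> h'; have [A AE] := tmul_left_ex W h'; exists (adj K \bo A) => x.
  by rewrite -AE.
(* The condition is imposed for all left multipliers [Y], not just the identity, so that [A] is
   stable under left multiplication and hence an ideal. *)
pose A := [set X | Finfty R n X /\ forall Y h, Finfty R n Y -> P h \bo Y \bo X = 0].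
suff JA : Jideal q `<=` A.
  move=> /JA[_ /(_ (bopid F) h (@Finfty_id _ _))]; rewrite bopcomp1r => E.
  by rewrite -PE -[LHS]/((P h \bo X) psi) E.
apply: smallest_sub; first split; first split.
- by move=> Y [].
- split; first by split=> [|Y h' FY]; [exact: FS.1|apply: bop_ext => x; exact: bop_zero].
  move=> a Y Z [FY AY] [FZ AZ]; split; first exact: FS.2.
  by move=> Y' h' FY'; rewrite bopcompDr bopcompZr AY// AZ// scaler0 addr0.
- move=> Y Z FY [FZ AZ]; split; split; try exact: FM.
    by move=> Y' h' FY'; rewrite bopcompA -(bopcompA (P h')) AZ//; exact: FM.
  by move=> Y' h' FY'; rewrite bopcompA AZ//; apply: bop_ext.
- move=> Z ZA; split.
    by apply: Fcl => s e e0; have [X' [FX' _] X's] := ZA s e e0; exists X'.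
  move=> Y h' FY; apply: bop_dot_ext => x y; rewrite bop0 hdot0l.
  have := @wot_eq0 _ F Z _ [:: (1, (x, adj (P h' \bo Y) y))] ZA.
  rewrite !big_seq1 !mul1r /= -adjP; apply=> X' [_ AX'].
  by rewrite !big_seq1 mul1r /= -adjP -[_ (X' x)]/((P h' \bo Y \bo X') x) AX'// bop0 hdot0l.
move=> _ [j _ <-]; split; first exact: Finfty_poly.
move=> Y h' FY; apply: fock_bop_ext => b; rewrite bop0.
have [Rt RtE] := choice (@right_creation_ex R n).
(* Right multiplication by [q_j (x) e_b]. It commutes with [Y], so [Y q_j(S) e_b = Q (Y 1)]; it
   remains to kill [P h' Q] on basis vectors, with no expansion of [Y]. *)
pose Q := \sum_(a <- finsupp (q j)) q j a *: Rt (a ++ b).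
transitivity ((P h' \bo Q) (Y (hbasis R [::]))).
  rewrite -[LHS]/(P h' (Y (nceval (q j) (@creation R n) (hbasis R b)))).
  rewrite -[RHS]/(P h' (Q (Y (hbasis R [::])))); congr (P h' _).
  rewrite /nceval /Q !bop_sumE bop_sum; apply: eq_bigr => a _.
  rewrite !bopZ bop_scale opword_creation; congr (_ *: _).
  rewrite -[RHS]/((Rt (a ++ b) \bo Y) _) -(Finfty_right (RtE _) FY).
  by rewrite -[RHS]/(Y (Rt _ _)) RtE.
suff -> : P h' \bo Q = 0 by rewrite bop0.
apply: fock_bop_ext => c; rewrite bop0 -[LHS]/(P h' (Q _)) /Q bop_sumE bop_sum.
rewrite -[RHS](poisson_homogeneous h' c b (q_hom j) (qT j)); apply: eq_bigr => a _.
by rewrite bopZ bop_scale RtE PE.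
Qed.

Lemma poisson_MJ k m h : MJ q m -> '[K k, tmul W m h] = 0.
Proof.
have [A AE] := tmul_left_ex W h.
have sub : MJ q `<=` [set x | (adj K \bo A) x = (0 : 'B(F, H)) x].
  move=> x cx; apply: closed_bop_eq; apply: closure_subset cx => _ [X JX [psi _ <-]].
  by rewrite /= AE poisson_ideal.
move=> /sub mE; rewrite adjP -AE -[adj K (A m)]/((adj K \bo A) m) mE.
by rewrite bop0 hdot0r.
Qed.

(** The residual of [K k] after projection to [N_J (x) H] is orthogonal to [m (x) h] for [m] in
    [N_J], and also for [m] in [M_J], where both [K k] and its projection are. *)
Lemma poisson_range k : csub_set (subtensor_space W (NJ q)) (K k).
Proof.
have [y My yP] := projection (subtensor_space W (NJ q)) (K k).
suff z0 : K k - y = 0 by rewrite -[K k](subrK y) z0 add0r.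
apply: (tensor_dot0 (W := W)) => x h.
have [A AE] := tmul_left_ex W h.
have NM m : csub_set (NJ q) m -> '[K k - y, tmul W m h] = 0.
  move=> Nm; apply: yP; apply: sub_clspan.
  exists (CSub (introT (asboolP _) Nm)) => //; by exists h.
have MM m : MJ q m -> '[K k - y, tmul W m h] = 0.
  move=> Mm; rewrite hdotBl poisson_MJ// sub0r; apply/eqP; rewrite oppr_eq0; apply/eqP.
  have : csub_set (orthocompl [set tmul W m h]) y.
    apply: My => _ [x' _ [y' _ <-]] _ ->.
    by rewrite tmul_dot (csub_inclP x')// mul0r.
  exact.
(* [MJ] is given only as a set, so its linearity is avoided: a vector orthogonal to the subspace
   [V], which contains [MJ], lies in [NJ], hence in [V] itself, and is 0. *)
pose V := bop_equalizer (hfun (K k - y) \bo A) 0.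
have Vx v : csub_set V v <-> '[K k - y, tmul W v h] = 0.
  split=> [Vv|vE].
    rewrite hdotC -AE -[ '[_, _] ]/((hfun (K k - y) \bo A) v) Vv rmorph0 //.
  change (('[A v, K k - y] : cline R) = 0).
  by rewrite hdotC AE vE rmorph0.
suff : csub_set V x by move=> /Vx.
apply: total_orthogonal => w wV.
have Nw : csub_set (NJ q) w by move=> m Mm; apply: wV; apply/Vx; exact: MM.
have := wV w; rewrite Vx => /(_ (NM _ Nw)) /eqP.
by rewrite hdot_norm expf_eq0 /= normr_eq0 => /eqP.
Qed.

End Vanishing.
End PoissonFock.

Lemma csub_incl_comp_inj (R : realType) (H L : hilbertType R) (M : csubspace L)
  (A B : 'B(H, csub M)) : csub_incl M \bo A = csub_incl M \bo B -> A = B.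
Proof.
move=> AB; apply: bop_ext => x; apply: (@csub_incl_inj _ _ M).
exact: (congr1 (fun C : 'B(H, L) => C x) AB).
Qed.

(** * The compressed shifts, and transforms by an intertwining isometry *)

Section BShift.
Variables (R : realType) (n d : nat) (q : 'I_d -> ncpoly R n).
Local Notation F := (fock R n).

Lemma MJ_creation i m : MJ q m -> MJ q (creation R i m).
Proof.
move=> cm B /(@bop_continuous _ _ _ (creation R i) m) /cm[_ [[X JX [psi _ <-]] Bx]].
exists (creation R i (X psi)); split=> //; exists (creation R i \bo X); last by exists psi.
move=> A AP; have [[[_ _ Aid] _] _] := AP.
by have [] := Aid (creation R i) X (@Finfty_creation R n i) (JX _ AP).
Qed.

Lemma NJ_adj_creation i x : csub_set (NJ q) x -> csub_set (NJ q) (adj (creation R i) x).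
Proof. by move=> Nx m Mm; rewrite adjPr; apply: Nx; exact: MJ_creation. Qed.

(** [J] is a left ideal, so [M_J] is invariant under each [S_i] and [N_J] under each [S_i^*]: the
    projection in the adjoint of [B_i] does nothing. *)
Lemma incl_adj_Bshift i x :
  csub_incl (NJ q) (adj (Bshift q i) x) = adj (creation R i) (csub_incl (NJ q) x).
Proof.
rewrite adj_compression; apply: csub_proj_id; apply: NJ_adj_creation.
exact: csub_inclP.
Qed.

End BShift.

Section Intertwiner.
Variables (R : realType) (n : nat) (H N : hilbertType R) (W : htensor N H).
Variables (T : 'I_n -> 'B(H)) (B : 'I_n -> 'B(N)) (K : 'B(H, W)).
Hypothesis K_isometry : adj K \bo K = bopid H.

Lemma transform_linear a (X Y : 'B(N)) :
  adj K \bo tensop W (a *: X + Y) (bopid H) \bo K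
  = a *: (adj K \bo tensop W X (bopid H) \bo K) + adj K \bo tensop W Y (bopid H) \bo K.
Proof. by rewrite tensop_linear bopcompDr bopcompDl bopcompZr bopcompZl. Qed.

Lemma transform_norm (X : 'B(N)) : `|adj K \bo tensop W X (bopid H) \bo K| <= `|X|.
Proof.
have K1 : `|K| <= 1 by apply: bop_norm_le => // x; rewrite (isometry_norm K_isometry) mul1r.
rewrite -[leRHS]mulr1; apply: bop_comp_norm_le => //; rewrite -[leRHS]mul1r.
by apply: bop_comp_norm_le; [rewrite adj_norm|exact: tensop_norm].
Qed.

Lemma mxop_transform p (X : 'M['B(N)]_p) :
  mxop (map_mx (fun X => adj K \bo tensop W X (bopid H) \bo K) X)
  = adj (ampl p K) \bo mxop (map_mx (fun Y => tensop W Y (bopid H)) X) \bo ampl p K.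
Proof. by rewrite -mxop_ampl; congr mxop; apply/matrixP => i j; rewrite !mxE. Qed.

Lemma mxop_transform_norm p (X : 'M['B(N)]_p) :
  `|mxop (map_mx (fun X => adj K \bo tensop W X (bopid H) \bo K) X)| <= `|mxop X|.
Proof.
have V1 : `|ampl p K| <= 1.
  by apply: bop_norm_le => // x; rewrite (isometry_norm (ampl_isometry p K_isometry)) mul1r.
rewrite mxop_transform -[leRHS]mulr1; apply: bop_comp_norm_le => //.
rewrite -[leRHS]mul1r; apply: bop_comp_norm_le; first by rewrite adj_norm.
exact: mxop_tensop_norm.
Qed.

(* The operators [X] with [X^* (x) 1] leaving the range of [K] invariant. *)
Definition coinvariant : set 'B(N) :=
  [set X | (bopid W - K \bo adj K) \bo (tensop W (adj X) (bopid H) \bo K) = 0].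

Lemma coinvariantP X : coinvariant X <-> tensop W (adj X) (bopid H) \bo K
  = K \bo (adj K \bo tensop W (adj X) (bopid H) \bo K).
Proof.
have E : (bopid W - K \bo adj K) \bo (tensop W (adj X) (bopid H) \bo K)
    = tensop W (adj X) (bopid H) \bo K - K \bo (adj K \bo tensop W (adj X) (bopid H) \bo K).
  by rewrite bopcompBl bopcomp1l !bopcompA.
rewrite /coinvariant /mkset E; split=> [/eqP|->]; last exact: subrr.
by rewrite subr_eq0 => /eqP.
Qed.

Let co_lin a X Y : (bopid W - K \bo adj K) \bo (tensop W (adj (a *: X + Y)) (bopid H) \bo K)
  = a^* *: ((bopid W - K \bo adj K) \bo (tensop W (adj X) (bopid H) \bo K))
    + (bopid W - K \bo adj K) \bo (tensop W (adj Y) (bopid H) \bo K).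
Proof.
rewrite adjD adj_scale tensop_linear (bopcompDl _ _ K) bopcompDr.
by rewrite (bopcompZl _ _ K) bopcompZr.
Qed.

Lemma coinvariant_algebra : is_subalgebra coinvariant.
Proof.
split; first split.
- have := co_lin (-1) 0 0; rewrite scaler0 addr0 rmorphN1 scaleN1r addNr.
  exact.
- by move=> a X Y coX coY; rewrite /coinvariant /= co_lin coX coY scaler0 addr0.
move=> X Y /coinvariantP coX /coinvariantP coY; apply/coinvariantP.
rewrite adj_comp tensop_comp.
set U := tensop W (adj Y) _ in coY *; set V := tensop W (adj X) _ in coX *.
set C := adj K \bo V \bo K in coX; set D := adj K \bo U \bo K in coY.
have UVK : U \bo V \bo K = K \bo (D \bo C).
  by rewrite -bopcompA coX bopcompA coY bopcompA.
by rewrite -(bopcompA (adj K)) UVK (bopcompA (adj K)) K_isometry bopcomp1l.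
Qed.

Lemma coinvariant_closed : closed coinvariant.
Proof.
move=> X /closure_normP cX; apply/eqP; rewrite -normr_eq0; apply/eqP/complex_le_eps => // e e0.
set Q := bopid W - K \bo adj K.
have d0 : 0 < e / (`|Q| * `|K| + 1) by rewrite divr_gt0// ltr_wpDl ?mulr_ge0.
have [Y coY XY] := cX _ d0.
have -> : Q \bo (tensop W (adj X) (bopid H) \bo K)
    = Q \bo (tensop W (adj (X - Y)) (bopid H) \bo K).
  have -> : X - Y = (-1) *: Y + X by rewrite scaleN1r addrC.
  have coY0 : Q \bo (tensop W (adj Y) (bopid H) \bo K) = 0 by exact: coY.
  rewrite (co_lin (-1) Y X) coY0.
  by rewrite scaler0 add0r.
apply: (@le_trans _ _ (`|Q| * (`|X - Y| * `|K|))).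
  apply: bop_comp_norm_le => //; apply: bop_comp_norm_le => //.
  by apply: (le_trans (tensop_norm _ _)); rewrite adj_norm.
rewrite mulrCA; apply: (@le_trans _ _ (e / (`|Q| * `|K| + 1) * (`|Q| * `|K| + 1))).
  by apply: ler_pM; rewrite ?mulr_ge0 ?lerDl ?(ltW XY).
by rewrite divfK// gt_eqF// ltr_wpDl ?mulr_ge0.
Qed.

Section Radius.
Variables (omega : radius_family R) (k p : nat).
Hypotheses (omega_ampl : ampliation_invariant omega).
Hypotheses (k0 : (0 < k)%N) (p0 : (0 < p)%N) (sH : standing H) (sN : separable N).

Let hsum_neq0 (L : hilbertType R) : (exists x : L, x != 0) -> exists x : hsum 'I_p L, x != 0.
Proof.
move=> [x x0]; exists (hdelta (Ordinal p0) x); apply: contra x0 => /eqP xE.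
by have := hdeltaE (Ordinal p0) x (Ordinal p0); rewrite xE eqxx => <-.
Qed.

Lemma standing_hsum (L : hilbertType R) : standing L -> standing (hsum 'I_p L).
Proof. by move=> [sL nL]; split; [exact: separable_hsum|exact: hsum_neq0]. Qed.

Lemma standing_intermediate : standing W.
Proof.
split; first exact: separable_tensor sN sH.1.
have [x x0] := sH.2; exists (K x); rewrite -normr_eq0.
by rewrite (isometry_norm K_isometry) normr_eq0.
Qed.

(** If [N] were zero, every elementary tensor would vanish and [W] would be zero, although it
    contains an isometric copy of the nonzero space [H]. *)
Lemma standing_factor : standing N.
Proof.
split=> //; have [w w0] := standing_intermediate.2; apply: contrapT => /forallNP N0.
move/negP: w0; apply; apply/eqP; apply: (tensor_dot0 (W := W)) => x y.
have /negP/negPn/eqP -> := N0 x.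
by rewrite tmul0l hdot0r.
Qed.

(** On the realization [tensor_sum] of [H (x) N^(p)] the matrix with entries [X_ij (x) 1_H] is
    [1_H (x) mxop X], the shape required by ampliation invariance. *)
Lemma radius_tensop (X : 'I_k -> 'M['B(N)]_p) :
  omega (fun i => mxop (map_mx (fun Y => tensop W Y (bopid H)) (X i)))
  = omega (fun i => mxop (X i)).
Proof.
rewrite -(omega_ampl (tensor_sum p W) (fun i => mxop (X i)) sH _ k0); last first.
  exact: standing_hsum standing_factor.
by congr omega; apply/funext => i; rewrite tensop_sum.
Qed.

Lemma radius_transform (X : 'I_k -> 'M['B(N)]_p) : strongly_admissible omega ->
  omega (fun i => mxop (map_mx (fun X => adj K \bo tensop W X (bopid H) \bo K) (X i)))
  <= omega (fun i => mxop (X i)).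
Proof.
move=> sa; rewrite -radius_tensop.
rewrite (_ : (fun i => _) = fun i => adj (ampl p K) \bo
  mxop (map_mx (fun Y => tensop W Y (bopid H)) (X i)) \bo ampl p K); last first.
  by apply/funext => i; rewrite mxop_transform.
apply: isometry_compression_le => //.
- exact: standing_hsum.
- exact: standing_hsum standing_intermediate.
- exact: ampl_isometry.
Qed.

Lemma radius_transform_adj (X : 'I_k -> 'M['B(N)]_p) : admissible omega ->
  (forall i, mx_over coinvariant (X i)) ->
  omega (fun i => adj (mxop (map_mx (fun X => adj K \bo tensop W X (bopid H) \bo K) (X i))))
  <= omega (fun i => adj (mxop (X i))).
Proof.
move=> sa coX.
rewrite [leRHS](_ : _ = omega (fun i => mxop (adjmx (X i)))); last first.
  by congr omega; apply/funext => i; rewrite adj_mxop.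
rewrite -radius_tensop.
have tadj i : adjmx (map_mx (fun Y => tensop W Y (bopid H)) (X i))
    = map_mx (fun Y => tensop W Y (bopid H)) (adjmx (X i)).
  by apply/matrixP => a b; rewrite !mxE tensop_adj.
rewrite (_ : (fun i => adj _) = fun i => adj (ampl p K) \bo
  mxop (map_mx (fun Y => tensop W Y (bopid H)) (adjmx (X i))) \bo ampl p K); last first.
  by apply/funext => i; rewrite mxop_transform !adj_comp adjK adj_mxop tadj bopcompA.
apply: (isometry_restriction_le (T' := fun i => mxop (map_mx
  (fun Y => adj K \bo tensop W Y (bopid H) \bo K) (adjmx (X i))))) => //.
- exact: standing_hsum.
- exact: standing_hsum standing_intermediate.
- exact: ampl_isometry.
move=> i; apply: bop_ext => f; apply: hsum_ext => a.
rewrite -[LHS]/(mxop _ (ampl p K f) a) -[RHS]/(ampl p K (mxop _ f) a) amplE !mxopE bop_sum.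
apply: eq_bigr => b _; rewrite amplE !mxE.
(* Indices are swapped because entry [(a, b)] of the adjoint matrix is the adjoint of entry
   [(b, a)]. *)
have /coinvariantP E := coX i b a.
exact: (congr1 (fun A : 'B(H, W) => A (f b)) E).
Qed.

End Radius.

Variable c : R.
Hypothesis K_shift : forall i,
  tensop W (adj (B i)) (bopid H) \bo K = c%:C%C *: (K \bo adj (T i)).

Lemma intertwine_word a : tensop W (adj (opword B a)) (bopid H) \bo K
  = (c ^+ size a)%:C%C *: (K \bo adj (opword T a)).
Proof.
elim: a => [|i a ih] /=.
  by rewrite !adj_id tensop_id bopcomp1l bopcomp1r scale1r.
rewrite adj_comp tensop_comp -bopcompA K_shift bopcompZr bopcompA ih.
by rewrite bopcompZl scalerA -realcM -exprS -bopcompA -adj_comp.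
Qed.

Lemma transform_word a b :
  adj K \bo tensop W (opword B a \bo adj (opword B b)) (bopid H) \bo K
  = (c ^+ (size a + size b))%:C%C *: (opword T a \bo adj (opword T b)).
Proof.
rewrite tensop_comp bopcompA -bopcompA intertwine_word.
(* The shift relation concerns adjoints only; the left factor is reached as [K^* (B_a (x) 1)], the
   adjoint of [(B_a^* (x) 1) K]. *)
rewrite -[opword B a]adjK -tensop_adj -adj_comp intertwine_word.
rewrite adj_scale conjC_real adj_comp adjK bopcompZl bopcompZr scalerA.
by rewrite exprD realcM -bopcompA (bopcompA (adj K)) K_isometry bopcomp1l.
Qed.

End Intertwiner.

(** * Poisson transforms on N_J and their limit as r tends to 1 *)

Section PoissonJ.
Variables (R : realType) (n : nat) (H : hilbertType R) (T : 'I_n -> 'B(H)).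
Hypothesis rc : row_contraction T.
Variables (d : nat) (q : 'I_d -> ncpoly R n).
Hypothesis q_hom : forall j, homogeneous (q j).
Hypothesis qT : forall j, nceval (q j) T = 0.
Local Notation N := (csub (NJ q)).
Local Notation W := (NJ_tensor H q).
Local Notation F := (fock_tensor n H).

Section FixedRadius.
Variable r : R.
Hypotheses (r0 : 0 <= r) (r1 : r < 1).
Let K := poissonJ T q r.

Lemma poissonJP : csub_incl _ \bo K = poisson T r.
Proof.
apply: (getPex (P := [set K : 'B(H, W) | csub_incl _ \bo K = poisson T r])).
exists (csub_proj _ \bo poisson T r); apply: bop_ext => k.
exact: csub_proj_id (poisson_range rc r0 r1 q_hom qT k).
Qed.

Lemma poissonJ_isometry : adj K \bo K = bopid H.
Proof.
apply: isometry_adj => x; rewrite -csub_incl_norm.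
by rewrite -[csub_incl _ (K x)]/((csub_incl _ \bo K) x) poissonJP poisson_norm.
Qed.

Lemma poissonJ_shift i :
  tensop W (adj (Bshift q i)) (bopid H) \bo K = r%:C%C *: (K \bo adj (T i)).
Proof.
have inclW : csub_incl _ \bo tensop W (adj (Bshift q i)) (bopid H)
    = tensop F (adj (creation R i)) (bopid H) \bo csub_incl (subtensor_space F (NJ q)).
  apply: (tensor_bop_ext (W := W)) => x y.
  rewrite -[LHS]/(csub_incl _ (tensop W (adj (Bshift q i)) (bopid H) (tmul W x y))) tensopE.
  rewrite -[RHS]/(tensop F (adj (creation R i)) (bopid H) (tmul F (csub_incl (NJ q) x) y)) tensopE.
  by rewrite -incl_adj_Bshift.
have key : csub_incl _ \bo (tensop W (adj (Bshift q i)) (bopid H) \bo K)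
    = csub_incl _ \bo (r%:C%C *: (K \bo adj (T i))).
  rewrite bopcompA inclW -bopcompA poissonJP poisson_creation//.
  by rewrite bopcompZr bopcompA poissonJP.
exact: csub_incl_comp_inj key.
Qed.

Lemma poisson_transform_word a b :
  poisson_transform T r (opword (Bshift q) a \bo adj (opword (Bshift q) b))
  = (r ^+ (size a + size b))%:C%C *: (opword T a \bo adj (opword T b)).
Proof. exact: (transform_word poissonJ_isometry poissonJ_shift). Qed.

Lemma poisson_transform_norm (X : 'B(N)) : `|poisson_transform T r X| <= `|X|.
Proof. exact: (transform_norm poissonJ_isometry). Qed.

End FixedRadius.

Lemma near_radius : \forall r \near (1 : R)^'-, 0 <= r /\ r < 1.
Proof.
near=> r; split; first by apply: ltW; near: r; exact: nbhs_left_gt.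
by near: r; exact: nbhs_left_lt.
Unshelve. all: by end_near.
Qed.

Definition poisson_converges : set 'B(N) :=
  [set X | cvg (poisson_transform T r X @[r --> (1 : R)^'-])].

Lemma cvg_poisson_word a b :
  poisson_transform T r (opword (Bshift q) a \bo adj (opword (Bshift q) b))
    @[r --> (1 : R)^'-] --> opword T a \bo adj (opword T b).
Proof.
set Z := opword T a \bo _; set k := (size a + size b)%N.
apply: (@cvg_trans _ ((fun r : R => (r ^+ k)%:C%C *: Z) @ (1 : R)^'-)).
  apply: near_eq_cvg; have := near_radius; apply: filterS => r [r0 r1].
  by rewrite poisson_transform_word.
apply/cvgrPdist_lt => e e0.
have d0 : 0 < e / (`|Z| + 1) by rewrite divr_gt0// ltr_wpDl.
have dE : e / (`|Z| + 1) = (complex.Re (e / (`|Z| + 1)))%:C%C.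
  by rewrite RRe_real ?gtr0_real.
have dR : 0 < complex.Re (e / (`|Z| + 1)) by move: d0; rewrite {1}dE ltcR.
have : (fun r : R => r ^+ k) @ (1 : R)^'- --> (1 : R) ^+ k.
  apply: cvg_at_left_filter; elim: (k) => [|l ih]; first exact: cvg_cst.
  rewrite exprS (_ : (fun r => _) = fun r => r * r ^+ l); first exact: cvgM.
  by apply/funext => r; rewrite exprS.
rewrite expr1n => /cvgrPdist_lt/(_ _ dR); apply: filterS => r rk.
rewrite -{1}[Z]scale1r -scalerBl normrZ.
apply: (@le_lt_trans _ _ (`|1 - (r ^+ k)%:C%C| * (`|Z| + 1))).
  by rewrite ler_wpM2l// lerDl.
rewrite -ltr_pdivlMr ?ltr_wpDl// dE.
have -> : 1 - (r ^+ k)%:C%C = (1 - r ^+ k)%:C%C :> R[i] by rewrite rmorphB.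
by rewrite normc_def /= expr0n /= addr0 sqrtr_sqr ltcR.
Qed.

Lemma poisson_converges_subspace : is_subspace poisson_converges.
Proof.
have lin a X Y LX LY : poisson_transform T r X @[r --> (1 : R)^'-] --> LX ->
    poisson_transform T r Y @[r --> (1 : R)^'-] --> LY ->
    poisson_transform T r (a *: X + Y) @[r --> (1 : R)^'-] --> a *: LX + LY.
  move=> cX cY; rewrite (_ : (fun r => _) = fun r =>
      a *: poisson_transform T r X + poisson_transform T r Y).
    by apply: cvgD => //; exact: cvgZr.
  by apply/funext => r; exact: transform_linear.
split=> [|a X Y /cvg_ex[LX cX] /cvg_ex[LY cY]]; last first.
  by apply/cvg_ex; exists (a *: LX + LY); exact: lin.
apply/cvg_ex; exists 0; apply/cvgrPdist_lt => e e0.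
have := near_radius; apply: filterS => r [r0 r1].
rewrite sub0r normrN; apply: le_lt_trans e0.
by rewrite -[leRHS](normr0 'B(N)); exact: poisson_transform_norm.
Qed.

(** The transforms are contractive uniformly in [r], so the limit for a nearby [Y] is eventually
    within [e] of the transforms of [X]; completeness of ['B(H)] then gives convergence. *)
Lemma poisson_converges_closed : closed poisson_converges.
Proof.
move=> X /closure_normP cX; apply: cauchy_cvg; apply: cauchy_exP => e e0.
have e20 : 0 < e / 2 by rewrite divr_gt0.
have [Y /cvg_ex[L YL] XY] := cX _ e20; exists L.
move/cvgrPdist_lt: YL => /(_ _ e20) Ln.
change (\forall r \near (1 : R)^'-, ball L e (poisson_transform T r X)).
near=> r.
have Lr : `|L - poisson_transform T r Y| < e / 2 by near: r.
have [r0 r1] : 0 <= r /\ r < 1 by near: r; exact: near_radius.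
rewrite -ball_normE /=.
rewrite -(subrK (poisson_transform T r Y) L) -addrA (splitr e).
apply: (le_lt_trans (ler_normD _ _)); apply: ltrD => //.
have -> : poisson_transform T r Y - poisson_transform T r X = poisson_transform T r (Y - X).
  rewrite [RHS](_ : _ = poisson_transform T r ((-1) *: X + Y)); last first.
    by rewrite scaleN1r addrC.
  by rewrite [RHS](transform_linear (poissonJ T q r)) scaleN1r addrC.
by apply: le_lt_trans (poisson_transform_norm r0 r1 _) _; rewrite distrC.
Unshelve. all: by end_near.
Qed.

Lemma spanB_converges : closure (spanB q) `<=` poisson_converges.
Proof.
move=> X cX; apply: poisson_converges_closed; apply: closure_subset cX.
apply: smallest_sub; first exact: poisson_converges_subspace.
by move=> _ [a _ [b _ <-]]; apply/cvg_ex; eexists; exact: cvg_poisson_word.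
Qed.

End PoissonJ.

Lemma closure_lipschitz (R : realType) (V U : normedModType R[i]) (f : V -> U) (M : R[i])
    (S : set V) (S' : set U) : 0 <= M -> (forall x y, `|f x - f y| <= M * `|x - y|) ->
  (forall x, S x -> closure S' (f x)) -> forall x, closure S x -> closure S' (f x).
Proof.
move=> M0 fM SS x /closure_normP cx; apply/closure_normP => e e0.
have M1 : 0 < M + 1 by rewrite ltr_wpDl.
have d0 : 0 < e / 2 / (M + 1) by rewrite !divr_gt0.
have e20 : 0 < e / 2 by rewrite divr_gt0.
have [x' Sx' xx'] := cx _ d0.
have /closure_normP/(_ _ e20)[y S'y x'y] := SS _ Sx'.
exists y => //; rewrite -(subrK (f x') (f x)) -addrA (splitr e).
apply: (le_lt_trans (ler_normD _ _)); apply: ler_ltD => //.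
apply: (le_trans (fM _ _)); apply: (@le_trans _ _ ((M + 1) * (e / 2 / (M + 1)))).
  by apply: ler_pM => //; [rewrite lerDl|exact: ltW].
by rewrite mulrC divfK// gt_eqF.
Qed.

Lemma closure_subalgebra (R : realType) (H : hilbertType R) (A : set 'B(H)) :
  is_subalgebra A -> is_subalgebra (closure A).
Proof.
move=> [AS AM]; split; first exact: closure_submod.
have left X Y : A X -> closure A Y -> closure A (X \bo Y).
  move=> AX; apply: (@closure_lipschitz _ _ _ (bopcomp X) `|X|) => // [Y' Z|Y' AY].
    by rewrite -bopcompBr bop_norm_comp.
  by apply: subset_closure; exact: AM.
move=> X Y cX cY; apply: (@closed_closure _ A).
apply: (@closure_lipschitz _ _ _ (fun X => X \bo Y) `|Y| A) cX => // [Z Z'|Z AZ].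
  by rewrite -bopcompBl mulrC bop_norm_comp.
by apply: subset_closure; exact: left.
Qed.

Lemma lin_span_subspace (R : realType) (H : hilbertType R) (A : set 'B(H)) :
  is_subspace (lin_span A).
Proof.
split=> [B [[B0 _] _] //|a X Y AX AY B AB].
by have [[_ BL] _] := AB; apply: BL; [exact: AX|exact: AY].
Qed.

(** Bilinearity in two stages: a word times the span, by concatenation of words, and after that the
    span times a fixed element. *)
Lemma word_span_subalgebra (R : realType) (H : hilbertType R) n (B : 'I_n -> 'B(H)) :
  is_subalgebra (lin_span (range (opword B))).
Proof.
set P := lin_span _; have [P0 PL] : is_subspace P by exact: lin_span_subspace.
have Pw a : P (opword B a) by move=> A [_ sub]; apply: sub; exists a.
split=> // X Y PX PY.
have word_left a : P `<=` [set Y | P (opword B a \bo Y)].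
  apply: smallest_sub; last by move=> _ [b _ <-] /=; rewrite -opword_cat.
  split=> /= [|c Z Z' PZ PZ'].
    by rewrite (_ : opword B a \bo 0 = 0)//; apply: bop_ext => x; exact: bop_zero.
  by rewrite bopcompDr bopcompZr; exact: PL.
suff : P `<=` [set X | P (X \bo Y)] by apply.
apply: smallest_sub; last by move=> _ [a _ <-]; exact: word_left.
split=> /= [|c Z Z' PZ PZ']; first by rewrite (_ : 0 \bo Y = 0)//; exact: bop_ext.
by rewrite bopcompDl bopcompZl; exact: PL.
Qed.

(** Words span an algebra whose closure is a closed algebra containing the generators and the
    identity; a word [B_a] is [B_a B_b^*] with [b] empty. *)
Lemma algAJ_closure (R : realType) n d (q : 'I_d -> ncpoly R n) :
  algAJ q `<=` closure (spanB q).
Proof.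
set P := lin_span (range (opword (Bshift q))).
apply: (@subset_trans _ (closure P)).
  apply: smallest_sub.
    by split; [exact/closure_subalgebra/word_span_subalgebra|exact: closed_closure].
  move=> _ [[i _ <-]|->]; apply: subset_closure => A [_ sub]; apply: sub.
    by exists [:: i] => //=; rewrite bopcomp1r.
  by exists [::].
apply: closure_subset; apply: smallest_sub; first exact: lin_span_subspace.
move=> _ [a _ <-] A [_ sub]; apply: sub; exists a => //; exists [::] => //=.
by rewrite adj_id bopcomp1r.
Qed.

Lemma norm_limit_le (R : realType) (V : normedModType R[i]) (T : Type) (F : set_system T)
    (FF : ProperFilter F) (u : T -> V) (l : V) (M : R[i]) :
  u @ F --> l -> (\forall t \near F, `|u t| <= M) -> `|l| <= M.
Proof.
move=> ul uM; apply/ler_addgt0Pr => e e0.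
have [t [ut tM]] := filter_ex (filterI ((proj1 (cvgrPdist_lt _ _) ul) _ e0) uM).
by rewrite -(subrK (u t) l) addrC (le_trans (ler_normD _ _))// lerD// ltW.
Qed.

Theorem theorem6p6 (R : realType) (n d : nat) (omega : radius_family R)
    (q : 'I_d -> ncpoly R n) (H : hilbertType R) (T : 'I_n -> 'B(H)) :
  (0 < n)%N -> (0 < d)%N ->
  joint_operator_radius omega ->
  (forall j, homogeneous (q j)) ->
  standing H ->
  row_contraction T ->
  (forall j, nceval (q j) T = 0) ->
  exists Phi : 'B(csub (NJ q)) -> 'B(H),
    [/\ linear_on (closure (spanB q)) Phi,
        Phi (bopid (csub (NJ q))) = bopid H,
        completely_contractive_on (closure (spanB q)) Phi &
        forall a b : seq 'I_n,
          Phi (opword (Bshift q) a \bo adj (opword (Bshift q) b))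
          = opword T a \bo adj (opword T b)] /\
    [/\ forall X, closure (spanB q) X ->
          poisson_transform T r X @[r --> 1^'-] --> Phi X,
        norm_quasi_continuous omega -> admissible omega ->
          forall (k p : nat) (F : 'I_k -> 'M['B(csub (NJ q))]_p),
          (0 < k)%N -> (0 < p)%N -> (forall i, mx_over (algAJ q) (F i)) ->
          omega _ _ (fun i => adj (mxop (map_mx Phi (F i))))
          <= omega _ _ (fun i => adj (mxop (F i))) &
        norm_quasi_continuous omega -> strongly_admissible omega ->
          forall (k p : nat) (X : 'I_k -> 'M['B(csub (NJ q))]_p),
          (0 < k)%N -> (0 < p)%N ->
          (forall i, mx_over (closure (spanB q)) (X i)) ->
          omega _ _ (fun i => mxop (map_mx Phi (X i)))
          <= omega _ _ (fun i => mxop (X i))].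
Proof.
move=> _ _ jor q_hom sH rc qT.
pose N := csub (NJ q).
(* Total on ['B(N)] by the default value of [lim]; it is a genuine limit on the closure of
   [spanB q]. *)
pose Phi (X : 'B(N)) : 'B(H) := lim (poisson_transform T r X @[r --> (1 : R)^'-]).
have PhiE X L : poisson_transform T r X @[r --> (1 : R)^'-] --> L -> Phi X = L.
  by move=> XL; exact: (cvg_lim (@norm_hausdorff _ 'B(H))).
have PhiP X : closure (spanB q) X -> poisson_transform T r X @[r --> (1 : R)^'-] --> Phi X.
  by move=> /(spanB_converges rc q_hom qT).
have Phi_word a b : Phi (opword (Bshift q) a \bo adj (opword (Bshift q) b))
    = opword T a \bo adj (opword T b).
  by apply: PhiE; exact: cvg_poisson_word.
have Phi_mx p (X : 'M['B(N)]_p) : mx_over (closure (spanB q)) X ->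
    mxop (map_mx (poisson_transform T r) X) @[r --> (1 : R)^'-] --> mxop (map_mx Phi X).
  move=> cX; apply: mxop_cvg => i j; rewrite mxE (_ : (fun _ => _)
    = fun r => poisson_transform T r (X i j)); first exact: PhiP.
  by apply/funext => r; rewrite mxE.
have sN : separable N.
  by apply/separable_csub/separable_hsum; exact: separable_cline.
have shsum p (L : hilbertType R) : (0 < p)%N -> standing L -> standing (hsum 'I_p L).
  by move=> p0; exact: standing_hsum.
exists Phi; split; split => //.
- move=> a X Y cX cY; apply: PhiE.
  rewrite (_ : (fun r => _) = fun r =>
      a *: poisson_transform T r X + poisson_transform T r Y).
    by apply: cvgD; [apply: cvgZr|]; exact: PhiP.
  by apply/funext => r; exact: transform_linear.
- by have := Phi_word [::] [::]; rewrite /= !adj_id !bopcomp1l.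
- move=> p F p0 cF; apply: norm_limit_le (Phi_mx _ _ cF) _.
  have := near_radius R; apply: filterS => r [r0 r1].
  have iso := poissonJ_isometry rc q_hom qT r0 r1.
  by have := mxop_transform_norm iso F.
- move=> qc adm k p F k0 p0 FA.
  have [_ amp _] := adm.
  have isoK r (r0 : 0 <= r) (r1 : r < 1) := poissonJ_isometry rc q_hom qT r0 r1.
  (* Any one radius below 1 supplies an isometry showing that [N_J] is nonzero. *)
  have half : (0 : R) <= 2^-1 /\ 2^-1 < (1 : R) by split; lra.
  have sfac : standing N by exact: (standing_factor (isoK _ half.1 half.2) sH sN).
  (* Quasi-continuity concerns nonnegative levels [b]; the level here is the right-hand side,
     nonnegative as a value of a radius. *)
  have b0 : 0 <= omega _ _ (fun i => adj (mxop (F i))).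
    by have [] := jor _ _ (fun i => adj (mxop (F i))) (shsum _ _ p0 sfac) k0.
  apply: (@radius_limit R omega _ _ _ (1 : R)^'- _
    (fun r i => adj (mxop (map_mx (poisson_transform T r) (F i))))) => //.
  + exact: shsum.
  + move=> i; apply: adj_cvg; apply: Phi_mx => a b; exact: algAJ_closure (FA i a b).
  have := near_radius R; apply: filterS => r [r0 r1].
  apply: (radius_transform_adj (isoK _ r0 r1) amp k0 p0 sH sN adm) => i a b.
  apply: smallest_sub (FA i a b).
    split; first exact: (coinvariant_algebra (isoK _ r0 r1)).
    exact: coinvariant_closed.
  move=> _ [[j _ <-]|->].
    apply/coinvariantP; rewrite -(bopcompA (adj _)).
    rewrite (poissonJ_shift rc q_hom qT r0 r1) bopcompZr.
    by rewrite [in RHS]bopcompZr (bopcompA (adj _)) isoK// bopcomp1l.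
  by apply/coinvariantP; rewrite adj_id tensop_id bopcomp1r isoK// bopcomp1l bopcomp1r.
move=> qc sa k p X k0 p0 cX.
have [_ amp _] := sa.
have isoK r (r0 : 0 <= r) (r1 : r < 1) := poissonJ_isometry rc q_hom qT r0 r1.
have half : (0 : R) <= 2^-1 /\ 2^-1 < (1 : R) by split; lra.
have sfac : standing N by exact: (standing_factor (isoK _ half.1 half.2) sH sN).
have b0 : 0 <= omega _ _ (fun i => mxop (X i)).
  by have [] := jor _ _ (fun i => mxop (X i)) (shsum _ _ p0 sfac) k0.
apply: (@radius_limit R omega _ _ _ (1 : R)^'- _
  (fun r i => mxop (map_mx (poisson_transform T r) (X i)))) => //.
- exact: shsum.
- by move=> i; exact: Phi_mx.
have := near_radius R; apply: filterS => r [r0 r1].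
exact: (radius_transform (isoK _ r0 r1) amp k0 p0 sH sN _ sa).
Qed.
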